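(* Let $n\ge 3$ and $W=M_n(\mathbb C)$. The space $V_n$ (defined in the context) is a $GL_{n^2}$-submodule of the ideal of regular functions on $S^n(M_n(\mathbb C))^*$ that vanish on $\overline{GL_{n^2}\cdot[\det_n]}$ (i.e. on the affine cone over it), and: (1) $V_n$ contains an irreducible $GL_{n^2}$-module of highest weight $$2n(n-1)(n-2)\,\omega_1+(2n^2-4n-1)\,\omega_2+2\,\omega_{2n+1},$$ and $V_n$ is a subspace of the space of homogeneous polynomials of degree $2n(n-1)$ on $S^n(M_n(\mathbb C))^*$. (2) The variety $\overline{GL_{n^2}\cdot[\det_n]}$ is an irreducible component of the zero locus $\mathcal D_n\subset\mathbb P(S^n(M_n(\mathbb C))^* )$ of $V_n$.
   Context: $W=M_n(\mathbb C)$ is the space of complex $n\times n$ matrices, $S^nW^*$ is the space of homogeneous polynomials of degree $n$ on $W$, $\det_n\in S^nW^*$ is the determinant, and $GL_{n^2}=GL(W)$ acts on $S^nW^*$ by linear changes of variables. $\overline{GL_{n^2}\cdot[\det_n]}\subset\mathbb P(S^nW^* )$ is the Zariski closure of the orbit. $\omega_i$ denotes the $i$-th fundamental weight, the highest weight of $\Lambda^iW$; polynomials on $S^nW^*$ are elements of $\mathrm{Sym}(S^nW)$. Definition of $V_n$. Put $e=(2n+1)(n-2)$. For a basis $f=(f_1,\dots,f_{2n+1})$ of a $(2n+1)$-dimensional subspace $F\subset W$ and $P\in S^nW^*$, let $Q_f=\det\big(\partial_{f_i}\partial_{f_j}P\big)_{1\le i,j\le 2n+1}$, the determinant of the Hessian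 of $P$ restricted to $F$; it is a form of degree $e$ on $W$. For linearly independent $u,v\in W$ write $$P(xu+yv)=\sum_{j=0}^n p_jx^jy^{n-j},\qquad Q_f(xu+yv)=\sum_{i=0}^e q_ix^iy^{e-i},$$ and set $$E_{f,u,v}(P)=\sum_{i=n-1}^{e}\ \sum_{r\ge 0}\ \sum_{\substack{j_1+\cdots+j_r=i-n+1\\ 1\le j_s\le n}}(-1)^r\,q_i\,p_{n-j_1}\cdots p_{n-j_r}\,p_n^{\,e-n+1-r}.$$ (For $p_n\neq0$, $E_{f,u,v}(P)$ vanishes exactly when the coefficient of $x^{n-1}$ in the remainder of the Euclidean division of $Q_f(xu+v)$ by $P(xu+v)$, as polynomials in $x$, is zero.) Each $E_{f,u,v}$ is a polynomial function of $P\in S^nW^*$. $V_n$ is the linear span of all the $E_{f,u,v}$, over all $f$ and all linearly independent $(u,v)$; the plane $\langle u,v\rangle$ need not be contained in $F$. *)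

(* Defs.v *)
From HB Require Import structures.
From mathcomp Require Export all_boot all_order all_algebra.
From mathcomp Require Export complex.
From mathcomp Require Export classical_sets functions reals.
From mathcomp Require Export mpoly.

Set Implicit Arguments.
Unset Strict Implicit.
Unset Printing Implicit Defensive.

Import GRing.Theory.

Local Open Scope classical_set_scope.
Local Open Scope ring_scope.

(* Forms of degree d in N variables.  The library makes [dhomog N K d] a        *)
(* vector space only when N is syntactically a successor, so this alias         *)
(* carries an instance for every N, with the coefficients of the monomials of   *)
(* degree d as coordinates.                                                     *)
Section Forms.
Variables (K : fieldType) (N d : nat).

Definition homform := dhomog N K d.

HB.instance Definition _ := GRing.Lmodule.on homform.

Definition monom := {m : 'X_{1..N < d.+1} | mdeg m == d}.

Definition form_coefs (P : homform) : 'rV[K]_#|{: monom}| :=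
  \row_i (mpoly_of_dhomog P)@_(bmnm (val (enum_val i))).

Lemma form_coefs_linear : linear form_coefs.
Proof.
move=> a P Q; apply/rowP => i.
by rewrite !mxE (linearP (@mpoly_of_dhomog N K d)) mcoeffD mcoeffZ.
Qed.

Lemma sum_monom_homog (r : 'rV[K]_#|{: monom}|) :
  \sum_i r ord0 i *: 'X_[bmnm (val (enum_val i))] \is d.-homog.
Proof.
apply: rpred_sum => i _; apply: rpredZ; rewrite dhomogX.
exact: valP (enum_val i).
Qed.

Lemma form_vector_axiom : Vector.axiom #|{: monom}| homform.
Proof.
exists form_coefs; first exact: form_coefs_linear.
exists (fun r => DHomog (sum_monom_homog r)).
  move=> P; apply: (@val_inj _ _ (dhomog N K d)); apply/mpolyP => m /=; rewrite raddf_sum /=.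
  have [dm|dm] := eqVneq (mdeg m) d; last first.
    rewrite big1 ?(dhomog_nemf_coeff (dhomog_is_dhomog P) dm) // => i _.
    rewrite mcoeffZ mcoeffX; case: eqP => [mE|]; rewrite ?mulr0 //.
    by case/negP: dm; rewrite -mE; exact: valP (enum_val i).
  have lm : (mdeg m < d.+1)%N by rewrite dm.
  pose m' : monom := exist _ (BMultinom lm) (introT eqP dm : mdeg _ == d).
  rewrite (bigD1 (enum_rank m')) //= big1 => [|i im'].
    by rewrite addr0 mcoeffZ mxE enum_rankK mcoeffX eqxx mulr1.
  rewrite mcoeffZ mcoeffX; case: eqP => [mE|]; rewrite ?mulr0 //.
  case/negP: im'; apply/eqP/enum_val_inj; rewrite enum_rankK.
  by do 2!apply: val_inj.
move=> r; apply/rowP => j; rewrite mxE /= raddf_sum /= (bigD1 j) //= big1.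
  by rewrite addr0 mcoeffZ mcoeffX eqxx mulr1.
move=> i ij; rewrite mcoeffZ mcoeffX; case: eqP => [mE|]; rewrite ?mulr0 //.
by case/negP: ij; apply/eqP/enum_val_inj; do 2!apply: val_inj.
Qed.

HB.instance Definition _ :=
  Lmodule_hasFinDim.Build K homform form_vector_axiom.

End Forms.

Section ProjectiveGeometry.
Variables (K : fieldType) (V : vectType K).

(* Coordinates in some fixed basis; neither [regular_fun] nor [homog_fun]       *)
(* depends on it.                                                               *)
Definition coords (v : V) : 'I_(\dim {:V}) -> K :=
  fun i => coord (vbasis {:V}) i v.

Definition regular_fun : set (V -> K) :=
  [set F | exists p : {mpoly K[\dim {:V}]}, forall v, F v = p.@[coords v]].

Definition homog_fun (e : nat) : set (V -> K) :=
  [set F | exists2 p : {mpoly K[\dim {:V}]},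
     p \is e.-homog & forall v, F v = p.@[coords v]].

Record projsp := Projsp { proj_line : {vspace V}; proj_line_dim : \dim proj_line == 1%N }.

Definition zero_locus (S : set (V -> K)) : set projsp :=
  [set L | forall F, S F -> forall v, v \in proj_line L -> F v = 0].

Definition zariski_closed (Z : set projsp) : Prop :=
  exists2 S : set (V -> K),
    S `<=` \bigcup_(e in setT) homog_fun e & Z = zero_locus S.

Definition zariski_closure (X : set projsp) : set projsp :=
  \bigcap_(Z in [set Z | zariski_closed Z /\ X `<=` Z]) Z.

Definition irreducible_set (Y : set projsp) : Prop :=
  Y !=set0 /\
  forall A B, zariski_closed A -> zariski_closed B -> Y `<=` A `|` B ->
    Y `<=` A \/ Y `<=` B.

Definition irreducible_component (Y Z : set projsp) : Prop :=
  [/\ irreducible_set Y, Y `<=` Z &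
      forall Y', irreducible_set Y' -> Y `<=` Y' -> Y' `<=` Z -> Y' = Y].

Definition affine_cone (X : set projsp) : set V :=
  [set v | exists2 L, X L & v \in proj_line L].

Definition vanishing_ideal (X : set projsp) : set (V -> K) :=
  [set F | regular_fun F /\ forall v, affine_cone X v -> F v = 0].

Definition lin_span (G : set (V -> K)) : set (V -> K) :=
  [set F | exists m (c : 'I_m -> K) (B : 'I_m -> (V -> K)),
     (forall i, G (B i)) /\ F = (fun v => \sum_(i < m) c i * B i v)].

End ProjectiveGeometry.

(* GL_N acts on K^N (column vectors), on forms by (g P)(w) = P(g^-1 w), and on  *)
(* functions of forms by (g F)(P) = F(g^-1 P).  Evaluation at w is then sent    *)
(* to evaluation at g w, so that polynomial functions of degree k on            *)
(* S^d(K^N)^* form the module Sym^k(S^d(K^N)).                                  *)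
Section Action.
Variables (K : fieldType) (N d : nat).
Implicit Types (g b : 'M[K]_N) (P : homform K N d) (F : homform K N d -> K).
Implicit Types (M : set (homform K N d -> K)).

Definition lin_forms g : N.-tuple {mpoly K[N]} :=
  [tuple \sum_(l < N) g k l *: 'X_l | k < N].

Lemma prod_homog (I : finType) (D : I -> nat) (G : I -> {mpoly K[N]}) :
  (forall i, G i \is (D i).-homog) -> \prod_i G i \is (\sum_i D i).-homog.
Proof.
move=> hG; elim/big_rec2: _ => [|i e p _ hp]; first exact: dhomog1.
exact: dhomogM.
Qed.

Lemma lin_forms_homog g P : mpoly_of_dhomog P \mPo lin_forms g \is d.-homog.
Proof.
rewrite comp_mpolyE big_seq; apply: rpred_sum => m mP; apply: rpredZ.
have dm : mdeg m = d by exact: dhomog_mf (dhomog_is_dhomog P) _ mP.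
suff : \prod_i tnth (lin_forms g) i ^+ m i \is (\sum_i m i).-homog.
  by rewrite -mdegE dm.
apply: prod_homog => i.
suff h : tnth (lin_forms g) i \is 1.-homog.
  by have := dhomogMn (m i) h; rewrite mul1n.
rewrite tnth_mktuple.
by apply: rpred_sum => l _; apply: rpredZ; rewrite dhomogX; apply/eqP; exact: mdeg1.
Qed.

(* w |-> P (g w) *)
Definition precomp g P : homform K N d := DHomog (lin_forms_homog g P).

Definition act_form g P : homform K N d := precomp (invmx g) P.

Definition act_fun g F : homform K N d -> K := fun P => F (act_form (invmx g) P).

Definition gl_submodule M : Prop :=
  [/\ M (cst 0), forall a F G, M F -> M G -> M (fun P => a * F P + G P) &
      forall g F, g \in unitmx -> M F -> M (act_fun g F)].

Definition gl_irreducible M : Prop :=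
  [/\ gl_submodule M, exists2 F, M F & F <> cst 0 &
      forall M', gl_submodule M' -> M' `<=` M -> M' = [set cst 0] \/ M' = M].

(* Weights are in the basis of the diagonal characters t_1, ..., t_N; the i-th  *)
(* fundamental weight is t_1 ... t_i.                                           *)
Definition fund_weight (i : nat) : {ffun 'I_N -> int} :=
  [ffun k : 'I_N => if (k < i)%N then 1 else 0].

(* The Borel subgroup is that of the invertible upper triangular matrices,      *)
(* which stabilizes the flag <e_1> < <e_1, e_2> < ...                           *)
Definition highest_weight_vector (lambda : {ffun 'I_N -> int}) F : Prop :=
  F <> cst 0 /\
  forall b, b \in unitmx -> is_trig_mx b^T ->
    act_fun b F = (fun P => (\prod_(k < N) b k k ^ lambda k) * F P).

Definition irreducible_of_highest_weight lambda M : Prop :=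
  gl_irreducible M /\ exists2 F, M F & highest_weight_vector lambda F.

End Action.

(* W = 'M_n is identified with K^(n * n) by [mxvec]: the coordinate w i j is    *)
(* the variable of index [mxvec_index i j].                                     *)
Section Determinant.
Variables (K : fieldType) (n : nat).

Notation W := 'M[K]_n.
Notation SW := (homform K (n * n) n).
Notation poly_W := {mpoly K[n * n]}.

Definition det_poly : poly_W := \det (\matrix_(i, j) 'X_(mxvec_index i j)).

Lemma det_poly_homog : det_poly \is n.-homog.
Proof.
apply: rpred_sum => s _; rewrite rpredMsign.
have : \prod_(i < n) ('X_(mxvec_index i (perm.fun_of_perm s i)) : poly_W)
    \is (\sum_(i < n) 1).-homog.
  by apply: prod_homog => i; rewrite dhomogX; apply/eqP; exact: mdeg1.
by rewrite sum1_card card_ord; under [in X in _ -> X]eq_bigr do rewrite mxE.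
Qed.

Definition det_form : SW := DHomog det_poly_homog.

Definition det_orbit : set (projsp SW) :=
  [set L | exists2 g, g \in unitmx & proj_line L = <[act_form g det_form]>%VS].

Definition dderiv (w : W) (P : poly_W) : poly_W :=
  \sum_(k < n * n) mxvec w ord0 k *: P^`M(k).

Definition hess_det (f : (2 * n + 1).-tuple W) (P : poly_W) : poly_W :=
  \det (\matrix_(i, j) dderiv (tnth f i) (dderiv (tnth f j) P)).

(* The coefficient of x^j y^(d - j) in P(x u + y v), for P of degree d.         *)
Definition plane_coef (d : nat) (u v : W) (P : poly_W) (j : nat) : K :=
  (P \mPo [tuple mxvec u ord0 k *: 'X_ord0 + mxvec v ord0 k *: 'X_ord_max
          | k < n * n] : {mpoly K[2]})@_[multinom [tuple j; (d - j)%N]].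

(* p_n^(e - n + 2) times the coefficient of 1/x in Q/P, for Q = Q_f(x u + v)    *)
(* and P = P(x u + v), with 1/P expanded in powers of 1/x; this is a power of   *)
(* p_n times the coefficient of x^(n - 1) in the remainder of Q modulo P.       *)
(* The part size j_s ranges over 1..n, so r <= i - n + 1; for n >= 3 all the    *)
(* differences of naturals below are genuine.                                   *)
Definition E_fun (f : (2 * n + 1).-tuple W) (u v : W) (P : SW) : K :=
  let e := ((2 * n + 1) * (n - 2))%N in
  let p := plane_coef n u v P in
  let q := plane_coef e u v (hess_det f P) in
  \sum_(n - 1 <= i < e.+1) \sum_(r < (i - (n - 1)).+1)
   \sum_(j : {ffun 'I_r -> 'I_n.+1} |
         [forall s, 0 < j s]%N && (\sum_s j s == i - (n - 1))%N)
     (-1) ^+ r * q i * (\prod_s p (n - j s)%N) * p n ^+ (e - (n - 1) - r).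

Definition E_funs : set (SW -> K) :=
  [set F | exists (f : (2 * n + 1).-tuple W) (u v : W), [/\ free f, free [:: u; v] & F = E_fun f u v]].

Definition V_n : set (SW -> K) := lin_span E_funs.

End Determinant.

(* Main.v *)
(* At a point A of the hypersurface det = 0 the Hessian of det has rank at most
   2n, so its determinant on a space of dimension 2n + 1 is divisible by det along
   every line that is transversal to the hypersurface, and all E_{f,u,v} vanish on
   the orbit.  Taking for f the first 2n + 1 vectors of the flag and for u, v the
   first two gives a highest weight vector F0; with respect to the Hermitian Fischer
   product, a highest weight vector in the span of GL F0 orthogonal to F0 is
   orthogonal to the big cell B^- B F0, hence zero, and the span is irreducible.

   For the component it suffices that every form P killed by the differentials at
   det of all E_{f,u,v} is tangent to the orbit: then the equations and the orbit
   have the same formal neighbourhood at det, and Krull's intersection theorem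
   makes every function vanishing on the orbit vanish, up to a factor not zero at
   det, on each irreducible set of zeros containing the orbit.  The space of such P
   is stable under X |-> g X h.  In the Fischer complement of the tangent space, a
   vector of maximal weight for X |-> t X t takes at L U the value c d^m, where
   d_i = L_ii U_ii; the differential at diag(1,..,1,0), which says
   that the Hessian of P in a direction E_1j + E_j1 is -2 P there, and
   polynomiality at 2 x 2 blocks leave only det and x_11 times the minor
   complementary to x_nn.  Both are tangent, so the complement is zero. *)
From HB Require Import structures.
From mathcomp Require Import boolp.
From mathcomp Require Import ring zify perm.
From mathcomp Require Import separable.
Require Import Defs.

Set Implicit Arguments.
Unset Strict Implicit.
Unset Printing Implicit Defensive.

Import Order.TTheory GRing.Theory Num.Theory.
Local Open Scope classical_set_scope.
Local Open Scope ring_scope.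

(** * Graded algebras of functions *)

(** Up to a power of p_n, E_{f,u,v} is the coefficient of 1/x in Q/P. Treated as a polynomial
    expression over any commutative ring, it keeps its meaning for p_n = 0, and that is where it is
    linearized: on the line x diag(1,..,1,0) + E_nn the determinant is x^(n-1) and the Hessian
    determinant of an adapted frame is a multiple of x^(e-1), so the first variation has only two
    terms. Dimension counts and smoothness are replaced by leading forms: the curves (1 + sX) det
    realize every tangent vector of the orbit, so the leading form at det of a function vanishing on
    the orbit vanishes on the tangent space. Complete reducibility is replaced by adjunction: for
    the Fischer product, substitution of g is adjoint to substitution of its conjugate transpose.
    This is used on forms, for the complement of the tangent space, and again on polynomial
    functions of forms, for the irreducible module. Density arguments are reduced to one variable: a
    polynomial in s that vanishes off the zeros of some nonzero c is 0. *)

Section GradedAlgebra.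
Variables (K : fieldType) (X : Type).

(** Two instances share the closure lemmas: [homog_fun], where [d] is the degree in the coefficients
    of a form, and [polfun], where it bounds the degree in a curve parameter. The first gives the
    degree of the equations, the second polynomiality along curves of substitutions. *)
Record graded_alg (A : nat -> (X -> K) -> Prop) : Prop := GradedAlg {
  ga0 : forall d, A d (fun=> 0);
  ga1 : A 0%N (fun=> 1);
  gaZ : forall d c f, A d f -> A d (fun x => c * f x);
  gaD : forall d f g, A d f -> A d g -> A d (fun x => f x + g x);
  gaM : forall d e f g, A d f -> A e g -> A (d + e)%N (fun x => f x * g x) }.

Variables (A : nat -> (X -> K) -> Prop) (gA : graded_alg A).

Lemma ga_ext d f g : f =1 g -> A d f -> A d g.
Proof. by move=> /funext ->. Qed.

Lemma ga_cst c : A 0%N (fun=> c).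
Proof.
by apply: (ga_ext _ (gaZ gA c (ga1 gA))) => x; rewrite mulr1.
Qed.

Lemma ga_sum (I : Type) (r : seq I) (P : pred I) d (F : I -> X -> K) :
  (forall i, P i -> A d (F i)) -> A d (fun x => \sum_(i <- r | P i) F i x).
Proof.
move=> h; elim: r => [|i r IH].
  by apply: (ga_ext _ (ga0 gA d)) => x; rewrite big_nil.
case Pi: (P i).
  by apply: (ga_ext _ (gaD gA (h _ Pi) IH)) => x; rewrite big_cons Pi.
by apply: (ga_ext _ IH) => x; rewrite big_cons Pi.
Qed.

Lemma ga_prod (I : Type) (r : seq I) (P : pred I) (d : I -> nat) (F : I -> X -> K) :
  (forall i, P i -> A (d i) (F i)) ->
  A (\sum_(i <- r | P i) d i) (fun x => \prod_(i <- r | P i) F i x).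
Proof.
move=> h; elim: r => [|i r IH].
  by rewrite big_nil; apply: (ga_ext _ (ga1 gA)) => x; rewrite big_nil.
rewrite big_cons; case Pi: (P i).
  by apply: (ga_ext _ (gaM gA (h _ Pi) IH)) => x; rewrite big_cons Pi.
by apply: (ga_ext _ IH) => x; rewrite big_cons Pi.
Qed.

Lemma ga_exp d n f : A d f -> A (n * d)%N (fun x => f x ^+ n).
Proof.
move=> h; elim: n => [|n IH]; first exact: (ga1 gA).
by rewrite mulSn; apply: (ga_ext _ (gaM gA h IH)) => x; rewrite exprS.
Qed.

Lemma ga_meval n d e (p : {mpoly K[n]}) (F : 'I_n -> X -> K) :
  p \is d.-homog -> (forall i, A e (F i)) ->
  A (d * e)%N (fun x => p.@[fun i => F i x]).
Proof.
move=> hp hF.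
pose G x := \sum_(m <- msupp p | m \in msupp p) p@_m * \prod_i F i x ^+ m i.
apply: (@ga_ext _ G) => [x|]; first by rewrite mevalE [RHS]big_seq.
apply: ga_sum => m mp; apply: gaZ => //.
rewrite -(dhomog_mf hp mp) /= mdegE big_distrl /=.
by apply: ga_prod => i _; exact: ga_exp.
Qed.

Section MpolyValued.
Variable n : nat.

Definition gam d (Phi : X -> {mpoly K[n]}) := forall m, A d (fun x => (Phi x)@_m).

Lemma gam_ext d Phi Psi : Phi =1 Psi -> gam d Phi -> gam d Psi.
Proof. by move=> /funext ->. Qed.

Lemma gam0 d : gam d (fun=> 0).
Proof. by move=> m; apply: (ga_ext _ (ga0 gA d)) => x; rewrite mcoeff0. Qed.

Lemma gam_cst p : gam 0 (fun=> p).
Proof. by move=> m; exact: ga_cst. Qed.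

Lemma gamZ d e f Phi : A d f -> gam e Phi -> gam (d + e) (fun x => f x *: Phi x).
Proof.
by move=> h1 h2 m; apply: (ga_ext _ (gaM gA h1 (h2 m))) => x; rewrite mcoeffZ.
Qed.

Lemma gamM d e Phi Psi : gam d Phi -> gam e Psi -> gam (d + e) (fun x => Phi x * Psi x).
Proof.
move=> h1 h2 m.
pose G x := \sum_(k : 'X_{1..n < (mdeg m).+1, (mdeg m).+1} | m == (k.1 + k.2)%MM)
  ((Phi x)@_k.1 * (Psi x)@_k.2).
apply: (@ga_ext _ G) => [x|]; first by rewrite mcoeffM.
by apply: ga_sum => k _; exact: gaM.
Qed.

Lemma gam_sum (I : Type) (r : seq I) (P : pred I) d (F : I -> X -> {mpoly K[n]}) :
  (forall i, P i -> gam d (F i)) -> gam d (fun x => \sum_(i <- r | P i) F i x).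
Proof.
move=> h m; pose G x := \sum_(i <- r | P i) (F i x)@_m.
apply: (@ga_ext _ G) => [x|]; first by rewrite raddf_sum.
by apply: ga_sum => i Pi; exact: h.
Qed.

Lemma gam_prod (I : Type) (r : seq I) (P : pred I) (d : I -> nat)
    (F : I -> X -> {mpoly K[n]}) : (forall i, P i -> gam (d i) (F i)) ->
  gam (\sum_(i <- r | P i) d i) (fun x => \prod_(i <- r | P i) F i x).
Proof.
move=> h; elim: r => [|i r IH].
  by rewrite big_nil; apply: (gam_ext _ (gam_cst 1)) => x; rewrite big_nil.
rewrite big_cons; case Pi: (P i).
  by apply: (gam_ext _ (gamM (h _ Pi) IH)) => x; rewrite big_cons Pi.
by apply: (gam_ext _ IH) => x; rewrite big_cons Pi.
Qed.

Lemma gam_exp d k Phi : gam d Phi -> gam (k * d) (fun x => Phi x ^+ k).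
Proof.
move=> h; elim: k => [|k IH]; first exact: gam_cst.
by rewrite mulSn; apply: (gam_ext _ (gamM h IH)) => x; rewrite exprS.
Qed.

Lemma gam_det k d (M : X -> 'M[{mpoly K[n]}]_k) :
  (forall i j, gam d (fun x => M x i j)) -> gam (k * d) (fun x => \det (M x)).
Proof.
move=> h; apply: gam_sum => s _.
have -> : (k * d = 0 + \sum_(i < k) d)%N by rewrite sum_nat_const card_ord.
apply: gamM; first exact: gam_cst.
by apply: gam_prod => i _; exact: h.
Qed.

Lemma gam_mderiv d i Phi : gam d Phi -> gam d (fun x => (Phi x)^`M(i)).
Proof.
move=> h m; apply: (ga_ext _ (gaZ gA (m i).+1%:R (h (m + U_(i))%MM))) => x.
by rewrite mcoeff_mderiv mulr_natl.
Qed.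

End MpolyValued.

Lemma gam_comp n k d e (Phi : X -> {mpoly K[n]}) (G : 'I_n -> X -> {mpoly K[k]}) r :
  (forall x, Phi x \is r.-homog) ->
  gam d Phi -> (forall i, gam e (G i)) ->
  gam (d + r * e) (fun x => Phi x \mPo [tuple G i x | i < n]).
Proof.
move=> hr hP hG.
(* The support of [Phi x] varies with [x], so the sum runs over a fixed finite set of monomials;
   homogeneity leaves those of degree [r], which gives all terms the same degree. *)
pose H x := \sum_(m : 'X_{1..n < r.+1}) (if mdeg m == r then
   (Phi x)@_m *: \prod_(i < n) (G i x) ^+ m i else 0).
apply: (@gam_ext _ _ H) => [x|].
  rewrite /= (@comp_mpolywE _ _ _ _ _ r.+1); last first.
    rewrite msizeE; apply/bigmax_leqP_seq => m mP _.
    by rewrite ltnS -(dhomog_mf (hr x) mP).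
  rewrite /H; apply: eq_bigr => m _; case: eqP => dm.
    by congr (_ *: _); apply: eq_bigr => i _; rewrite tnth_mktuple.
  by rewrite (dhomog_nemf_coeff (hr x)) ?scale0r //; apply/eqP.
apply: gam_sum => m _; case: eqP => [dm|_]; last exact: gam0.
apply: gamZ; first exact: hP.
rewrite -[X in (X * _)%N]dm mdegE big_distrl /=.
by apply: gam_prod => i _; exact: gam_exp.
Qed.


End GradedAlgebra.

Lemma homog_fun_graded (K : fieldType) (V : vectType K) :
  graded_alg (@homog_fun K V).
Proof.
split=> [d||d c f|d f g|d e f g].
- by exists 0; [exact: dhomog0|move=> v; rewrite meval0].
- by exists 1; [exact: dhomog1|move=> v; rewrite meval1].
- move=> [p hp hf]; exists (c *: p); first exact: rpredZ.
  by move=> v; rewrite mevalZ hf.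
- move=> [p hp hf] [q hq hg]; exists (p + q); first exact: rpredD.
  by move=> v; rewrite mevalD hf hg.
move=> [p hp hf] [q hq hg]; exists (p * q); first exact: dhomogM.
by move=> v; rewrite mevalM hf hg.
Qed.

Lemma homog_fun_linear (K : fieldType) (V : vectType K) (l : V -> K) :
  (forall a u v, l (a *: u + v) = a * l u + l v) -> homog_fun 1 l.
Proof.
move=> hl; pose b := vbasis {:V}.
have l0 : l 0 = 0 by have := hl (-1) 0 0; rewrite scaler0 addr0 mulN1r addNr.
exists (\sum_(i < \dim {:V}) l b`_i *: 'X_i).
  by apply: rpred_sum => i _; apply: rpredZ; rewrite dhomogX; apply/eqP; exact: mdeg1.
move=> v; rewrite raddf_sum /= [in LHS](coord_vbasis (memvf v)).
rewrite (big_morph l (id1 := 0) (op1 := +%R)) //; last first.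
  by move=> x y; have := hl 1 x y; rewrite scale1r mul1r.
apply: eq_bigr => i _; rewrite mevalZ mevalXU /coords mulrC.
by have := hl (coord (vbasis {:V}) i v) b`_i 0; rewrite !addr0 l0 addr0.
Qed.

Definition polfun (K : fieldType) d (f : K -> K) : Prop :=
  exists2 p : {poly K}, (size p <= d.+1)%N & forall s, f s = p.[s].

Lemma polfun_graded (K : fieldType) : graded_alg (@polfun K).
Proof.
split=> [d||d c f|d f g|d e f g].
- by exists 0; rewrite ?size_poly0 // => s; rewrite horner0.
- by exists 1; rewrite ?size_poly1 // => s; rewrite hornerC.
- move=> [p hp hf]; exists (c *: p); first exact: leq_trans (size_scale_leq _ _) hp.
  by move=> s; rewrite hornerZ hf.
- move=> [p hp hf] [q hq hg]; exists (p + q); last by move=> s; rewrite hornerD hf hg.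
  by rewrite (leq_trans (size_polyD _ _)) // geq_max hp.
move=> [p hp hf] [q hq hg]; exists (p * q); last by move=> s; rewrite hornerM hf hg.
apply: leq_trans (size_polyMleq _ _) _.
have [->//|pq] := posnP (size p + size q).
by rewrite -ltnS prednK // -addSn -addnS leq_add.
Qed.

Lemma polfun_le (K : fieldType) d e (f : K -> K) :
  (d <= e)%N -> polfun d f -> polfun e f.
Proof. by move=> de [p hp hf]; exists p => //; exact: leq_trans hp _. Qed.

Lemma polfun_id (K : fieldType) : polfun 1 (@id K).
Proof. by exists 'X; rewrite ?size_polyX // => s; rewrite hornerX. Qed.

Lemma polfun_affine (K : fieldType) (a b : K) : polfun 1 (fun s => a + b * s).
Proof.
exists (a%:P + b *: 'X); last by move=> s; rewrite !hornerE.
rewrite (leq_trans (size_polyD _ _)) // geq_max.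
rewrite (leq_trans (size_polyC_leq1 _)) //.
by rewrite (leq_trans (size_scale_leq _ _)) // size_polyX.
Qed.

(** * Generic vanishing and interpolation in one variable *)

Section InfiniteField.
Variable K : numFieldType.

Lemma natr_uniq d e : uniq [seq i%:R : K | i <- iota e d].
Proof.
rewrite map_inj_uniq ?iota_uniq // => i j /eqP.
by rewrite eqr_nat => /eqP.
Qed.

Lemma natr_nonroot_from (p : {poly K}) e : p != 0 ->
  exists2 i : nat, (e <= i)%N & p.[i%:R] != 0.
Proof.
move=> pn0.
have : ~~ all (root p) [seq i%:R : K | i <- iota e (size p)].
  apply/negP => h; have := max_poly_roots pn0 h (natr_uniq _ _).
  by rewrite size_map size_iota ltnn.
rewrite -has_predC has_map => /hasP[j]; rewrite mem_iota => /andP[i0 _] /= pi.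
by exists j.
Qed.

Lemma natr_nonroot (p : {poly K}) : p != 0 -> exists2 s : K, s != 0 & p.[s] != 0.
Proof.
move=> /(natr_nonroot_from 1)[j i0 pi].
by exists j%:R => //; rewrite pnatr_eq0 -lt0n.
Qed.

(** The form in which Zariski density is used: an identity polynomial in a parameter may be checked
    away from 0 and from the zeros of an auxiliary polynomial. *)
Lemma poly_generic_eq0 (p c : {poly K}) :
  c != 0 -> (forall s, s != 0 -> c.[s] != 0 -> p.[s] = 0) -> p = 0.
Proof.
move=> cn0 h; apply/eqP; apply/negPn/negP => pn0.
have [s s0] := natr_nonroot (mulf_neq0 pn0 cn0).
by rewrite hornerM mulf_eq0 negb_or => /andP[ps /(h _ s0)/eqP]; exact/negP.
Qed.

Lemma poly_fun_eq (p q : {poly K}) : (forall s, s != 0 -> p.[s] = q.[s]) -> p = q.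
Proof.
move=> h; apply/subr0_eq/(@poly_generic_eq0 _ 1) => [|s s0 _]; first exact: oner_neq0.
by rewrite hornerD hornerN h // subrr.
Qed.

(** Inversion of a Vandermonde matrix. The nodes avoid 0 and the zeros of [c], so that a coefficient
    of a polynomial curve becomes a combination of its values at generic parameters. *)
Lemma interpolation (c : {poly K}) d (h : nat) : c != 0 ->
  exists (t : 'I_d.+1 -> K) (w : 'I_d.+1 -> K),
    (forall i, t i != 0 /\ c.[t i] != 0) /\
    forall p : {poly K}, (size p <= d.+1)%N -> p`_h = \sum_i w i * p.[t i].
Proof.
move=> cn0.
have [t t_inj ht] : exists2 t : 'I_d.+1 -> K, injective t &
    forall i, t i != 0 /\ c.[t i] != 0.
  (* The nodes will be i + (d+1)k. The polynomial [g i] is c(x)x at x = i + (d+1)X, and one natural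
     number k avoids the zeros of all of them. *)
  pose g (i : 'I_d.+1) := (c * 'X) \Po (i%:R%:P + d.+1%:R *: 'X).
  have gn0 i : g i != 0.
    have sg : size (i%:R%:P + d.+1%:R *: 'X : {poly K}) = 2.
      rewrite addrC size_polyDl size_scale ?pnatr_eq0 ?size_polyX //.
      by rewrite (leq_ltn_trans (size_polyC_leq1 _)).
    by rewrite comp_poly2_eq0 // mulf_neq0 ?polyX_eq0.
  have gP : \prod_i g i != 0 by apply/prodf_neq0 => i _.
  have [k _ hk] := natr_nonroot_from 0 gP.
  exists (fun i : 'I_d.+1 => i%:R + d.+1%:R * k%:R) => [i j /addIr/eqP|i].
    by rewrite eqr_nat => /eqP; exact: val_inj.
  move: hk; rewrite horner_prod => /prodf_neq0/(_ i isT).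
  by rewrite horner_comp !hornerE mulf_eq0 negb_or => /andP[c1 c2].
exists t; pose Vm := Vandermonde d.+1 (\row_i t i).
have uV : Vm \in unitmx.
  rewrite unitmxE det_Vandermonde unitfE; apply/prodf_neq0 => i _.
  apply/prodf_neq0 => j ij; rewrite !mxE subr_eq0.
  by apply: contraTneq ij => /t_inj ->; rewrite ltnn.
have [hd|hd] := ltnP h d.+1; last first.
  exists (fun=> 0); split=> // p sp; rewrite nth_default ?(leq_trans sp) //.
  by rewrite big1 // => i _; rewrite mul0r.
exists (fun i => invmx Vm i (Ordinal hd)); split=> // p sp.
pose a : 'rV[K]_d.+1 := \row_i p`_i.
have ha i : p.[t i] = (a *m Vm) 0 i.
  rewrite (horner_coef_wide _ sp) mxE; apply: eq_bigr => j _.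
  by rewrite !mxE.
under eq_bigr do rewrite ha mulrC.
have -> : p`_h = a 0 (Ordinal hd) by rewrite mxE.
by rewrite -{1}(mulmxK uV a) mxE.
Qed.

End InfiniteField.

(** * Theorems of Hilbert and Krull *)

Section Noetherian.

Definition is_ideal (R : comNzRingType) (I : R -> Prop) : Prop :=
  I 0 /\ forall a x y, I x -> I y -> I (a * x + y).

Lemma ideal_add (R : comNzRingType) (I : R -> Prop) x y : is_ideal I -> I x -> I y -> I (x + y).
Proof. by move=> [_ hI] hx hy; rewrite -[x]mul1r; exact: hI. Qed.

Lemma ideal_mul (R : comNzRingType) (I : R -> Prop) a x : is_ideal I -> I x -> I (a * x).
Proof. by move=> [h0 hI] hx; rewrite -[a * x]addr0; exact: hI. Qed.

Lemma ideal_sum (R : comNzRingType) (I : R -> Prop) (T : Type) (r : seq T) (P : pred T)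
    (F : T -> R) :
  is_ideal I -> (forall i, P i -> I (F i)) -> I (\sum_(i <- r | P i) F i).
Proof.
move=> hI h; elim/big_rec: _ => [|i x Pi hx]; first by case: hI.
by apply: ideal_add => //; exact: h.
Qed.

(** Finite generation, with the ideal generated by [s] replaced by its universal property. *)
Definition noetherian (R : comNzRingType) : Prop :=
  forall I : R -> Prop, is_ideal I -> exists2 s : seq R,
    (forall x, x \in s -> I x) &
    forall x, I x -> forall J, is_ideal J -> (forall y, y \in s -> J y) -> J x.

Lemma noetherian_surj (A B : comNzRingType) (f : {rmorphism A -> B}) :
  (forall y, exists x, f x = y) -> noetherian A -> noetherian B.
Proof.
move=> fs nA I [I0 hI].
have [|s sI gen] := nA (fun x => I (f x)).
  split; first by rewrite rmorph0.
  by move=> a x y hx hy; rewrite rmorphD rmorphM; exact: hI.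
exists [seq f x | x <- s] => [y /mapP[x xs ->]|y Iy J [J0 hJ] sJ]; first exact: sI.
have [x fx] := fs y; rewrite -fx.
apply: (gen x _ (fun z => J (f z))); rewrite ?fx //.
  split; first by rewrite rmorph0.
  by move=> a z t hz ht; rewrite rmorphD rmorphM; exact: hJ.
by move=> z zs; apply: sJ; exact: map_f.
Qed.

Lemma noetherian_field (K : fieldType) : noetherian K.
Proof.
move=> I hI; have [[x Ix xn0]|h] := pselect (exists2 x, I x & x != 0).
  exists [:: x] => [y /[1!inE]/eqP->//|y _ J hJ sJ].
  by rewrite -[y](mulfVK xn0); apply: ideal_mul => //; apply: sJ; rewrite inE.
exists [::] => // y Iy J [J0 _] _.
suff -> : y = 0 by [].
by apply: contrapT => yn0; apply: h; exists y => //; exact/eqP.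
Qed.

Theorem hilbert_basis (R : comNzRingType) : noetherian R -> noetherian {poly R}.
Proof.
move=> nR I hI; have [I0 hI'] := hI.
(* [LC d] is the ideal of coefficients of x^d in the elements of [I] of degree at most [d]. It grows
   with [d], and finitely many generators of the union all occur in some degree [D]. *)
pose LC d a := exists2 p : {poly R}, I p & (size p <= d.+1)%N /\ p`_d = a.
have sizeDM (d : nat) (a : R) (p q : {poly R}) : (size p <= d)%N -> (size q <= d)%N ->
    (size (a *: p + q)%R <= d)%N.
  move=> hp hq; rewrite (leq_trans (size_polyD _ _)) // geq_max hq.
  by rewrite (leq_trans (size_scale_leq _ _)).
have LCi d : is_ideal (LC d).
  split; first by exists 0; rewrite ?size_poly0 ?coef0.
  move=> a x y [p Ip [sp <-]] [q Iq [sq <-]]; exists (a *: p + q).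
    by rewrite -mul_polyC; exact: hI'.
  by split; [exact: sizeDM|rewrite coefD coefZ].
have LCS d e a : LC d a -> LC (d + e)%N a.
  move=> [p Ip [sp <-]]; exists ('X^e * p); first exact: ideal_mul.
  split; last by rewrite coefXnM ltnNge leq_addl addnK.
  apply: leq_trans (size_polyMleq _ _) _; rewrite size_polyXn /=.
  by rewrite addnC -addSn leq_add2r.
have [|s sL genL] := nR (fun a => exists d, LC d a).
  split; first by exists 0%N; case: (LCi 0%N).
  move=> a x y [d hd] [e he]; exists (d + e)%N; apply: (LCi _).2; first exact: LCS.
  by rewrite addnC; exact: LCS.
have [D hD] : exists D, forall a, a \in s -> LC D a.
  elim: s sL {genL} => [|a s IH] sL; first by exists 0%N.
  have [D hD] := IH (fun x xs => sL x (mem_behead (s := a :: s) xs)).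
  have [d hd] := sL a (mem_head _ _).
  exists (D + d)%N => x; rewrite inE => /orP[/eqP->|/hD]; last exact: LCS.
  by rewrite addnC; exact: LCS.
have LCD d a : LC d a -> LC D a.
  by move=> h; apply: (genL a) => //; exists d.
(* [G d] lifts generators of [LC d]; the lists for d <= D together will generate [I]. *)
have /choice[G hG] : forall d, exists g : seq {poly R},
    (forall p, p \in g -> I p /\ (size p <= d.+1)%N) /\
    forall a, LC d a -> forall J, is_ideal J -> (forall p, p \in g -> J p`_d) -> J a.
  move=> d; have [g gL gen] := nR _ (LCi d).
  have [g' gg' hg'] : exists2 g' : seq {poly R}, [seq (p : {poly R})`_d | p <- g'] = g &
      forall p, p \in g' -> I p /\ (size p <= d.+1)%N.
    elim: g gL {gen} => [|a g IH] gL; first by exists [::].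
    have [g' <- hg'] := IH (fun x xs => gL x (mem_behead (s := a :: g) xs)).
    have [p Ip [sp <-]] := gL a (mem_head _ _).
    by exists (p :: g') => // q; rewrite inE => /orP[/eqP->//|/hg'].
  exists g'; split=> // a La J hJ sJ; apply: gen => // y.
  by rewrite -gg' => /mapP[p /sJ h ->].
exists (flatten [seq G d | d <- iota 0 D.+1]).
  by move=> p /flatten_mapP[d _ /(hG d).1[]].
move=> p Ip J hJ sJ.
have sJ' d q : (d <= D)%N -> q \in G d -> J q.
  by move=> dD qG; apply/sJ/flatten_mapP; exists d => //; rewrite mem_iota.
move: {2}(size p) (leqnn (size p)) => k; elim: k p Ip => [|k IH] p Ip.
  by rewrite leqn0 size_poly_eq0 => /eqP ->; case: hJ.
move=> sp.
suff [q [Jq Iq sq qp]] : exists q, [/\ J q, I q, (size q <= k.+1)%N & q`_k = p`_k].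
  rewrite -[p](subrK q); apply: ideal_add => //; apply: IH.
    by rewrite addrC -mulN1r; exact: hI'.
  apply/leq_sizeP => j; rewrite leq_eqVlt => /orP[/eqP <-|kj].
    by rewrite coefB qp subrr.
  by rewrite coefB !nth_default ?subrr // (leq_trans _ kj).
(* The generators of [LC d] are known only through ideals containing them. Hence the element
   cancelling a top coefficient is found by applying this property to the ideal of coefficients of
   x^(d+e) realized in [J] and [I] at once. *)
have hJ' d e (dD : (d <= D)%N) : is_ideal (fun a =>
    exists q, [/\ J q, I q, (size q <= (d + e).+1)%N & q`_(d + e) = a]).
  split; first by exists 0; rewrite size_poly0 coef0; split => //; case: hJ.
  move=> a x y [q [Jq Iq sq <-]] [r [Jr Ir sr <-]]; exists (a *: q + r).
  rewrite coefD coefZ -mul_polyC; split=> //; [exact: hJ.2|exact: hI'|].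
  by rewrite mul_polyC; exact: sizeDM.
have key d e : (d <= D)%N -> LC d p`_(d + e) ->
    exists q, [/\ J q, I q, (size q <= (d + e).+1)%N & q`_(d + e) = p`_(d + e)].
  move=> dD hLC; apply: ((hG d).2 _ hLC _ (hJ' d e dD)) => q qG.
  have [Iq sq] := (hG d).1 _ qG; exists ('X^e * q); split.
  - by apply: ideal_mul => //; exact: sJ' qG.
  - exact: ideal_mul.
  - apply: leq_trans (size_polyMleq _ _) _; rewrite size_polyXn /=.
    by rewrite addnC -addSn leq_add2r.
  by rewrite coefXnM ltnNge leq_addl addnK.
have hLC : LC k p`_k by exists p.
have [kD|/ltnW Dk] := leqP k D; first by have := key k 0%N kD; rewrite addn0; exact.
by have := key D (k - D)%N (leqnn D); rewrite subnKC //; apply; exact: LCD hLC.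
Qed.

(** Induction on the number of variables: a ring in n + 1 variables is the image of the univariate
    polynomials over the ring in n variables, the new variable going to ['X_ord_max]. *)
Lemma noetherian_mpoly (R : comNzRingType) n : noetherian R -> noetherian {mpoly R[n]}.
Proof.
move=> nR; elim: n => [|n IH].
  apply: (noetherian_surj (f := @mpolyC 0 R)) nR => p; exists p@_0%MM.
  by apply/mpolyP => m; rewrite mcoeffC (_ : m = 0%MM) ?eqxx ?mulr1 //; apply/mnmP; case.
pose w : n.-tuple {mpoly R[n.+1]} := [tuple 'X_(lift ord_max i) | i < n].
have cw : commr_rmorph (comp_mpoly w) ('X_ord_max) by move=> x; exact: mulrC.
apply: (noetherian_surj (f := horner_morph cw)) (hilbert_basis IH) => p.
elim/mpolyind: p => [|c m p _ _ [q <-]]; first by exists 0; rewrite rmorph0.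
suff [r hr] : exists r, horner_morph cw r = 'X_[m].
  exists ((c%:MP)%:P * r + q); rewrite rmorphD rmorphM /= hr horner_morphC /=.
  by rewrite comp_mpolyC mul_mpolyC.
exists (\prod_(i < n.+1) (if unlift ord_max i is Some j then ('X_j)%:P else 'X) ^+ m i).
rewrite rmorph_prod [RHS]mpolyXE_id; apply: eq_bigr => i _; rewrite rmorphXn /=.
congr (_ ^+ _); case: unliftP => [j ->|->]; last by rewrite horner_morphX.
by rewrite horner_morphC /= comp_mpolyXU (nth_map j) ?size_enum_ord // nth_ord_enum.
Qed.

Lemma noetherian_chain (R : comNzRingType) (P : nat -> R) : noetherian R ->
  exists N (c : 'I_N -> R), P N = \sum_(i < N) c i * P i.
Proof.
move=> nR; pose J N x := exists c : nat -> R, x = \sum_(i < N) c i * P i.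
have hJ N : is_ideal (J N).
  split; first by exists (fun=> 0); rewrite big1 // => i _; rewrite mul0r.
  move=> a x y [c ->] [d ->]; exists (fun i => a * c i + d i).
  rewrite mulr_sumr -big_split; apply: eq_bigr => i _ /=.
  by rewrite mulrDl mulrA.
have JS N M x : (N <= M)%N -> J N x -> J M x.
  move=> NM [c ->]; exists (fun i => if (i < N)%N then c i else 0).
  rewrite (big_ord_widen M (fun i => c i * P i) NM) [LHS]big_mkcond.
  by apply: eq_bigr => i _; case: ifP; rewrite ?mul0r.
have [|s sJ gen] := nR (fun x => exists N, J N x).
  split; first by exists 0%N; case: (hJ 0%N).
  move=> a x y [N hN] [M hM]; exists (maxn N M); apply: (hJ _).2.
    by apply: JS hN; exact: leq_maxl.
  by apply: JS hM; exact: leq_maxr.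
have [D hD] : exists D, forall a, a \in s -> J D a.
  elim: s sJ {gen} => [|a s IH] sJ; first by exists 0%N.
  have [D hD] := IH (fun x xs => sJ x (mem_behead (s := a :: s) xs)).
  have [d hd] := sJ a (mem_head _ _).
  exists (maxn D d) => x; rewrite inE => /orP[/eqP->|/hD].
    by apply: JS hd; exact: leq_maxr.
  by apply: JS; exact: leq_maxl.
have [|c hc] := gen (P D) _ _ (hJ D) hD.
  exists D.+1; exists (fun i => (i == D)%:R).
  rewrite big_ord_recr /= eqxx mul1r big1 ?add0r // => i _.
  by rewrite (ltn_eqF (ltn_ord i)) mul0r.
by exists D, c.
Qed.

End Noetherian.

Section Krull.
Variables (K : fieldType) (M : nat).
Implicit Types (p h : {mpoly K[M]}) (I : {mpoly K[M]} -> Prop).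

(* Encodes the N-th power of the ideal of the origin: the outer variables stand
   for the generators 'X_i, with arbitrary polynomials as coefficients. *)
Definition max_pow N p : Prop :=
  exists2 P : {mpoly {mpoly K[M]}[M]}, P \is N.-homog & p = P.@[fun i => 'X_i].

Lemma max_pow0 N : max_pow N 0.
Proof. by exists 0; [exact: dhomog0|rewrite meval0]. Qed.

Lemma max_powD N p q : max_pow N p -> max_pow N q -> max_pow N (p + q).
Proof.
by move=> [P hP ->] [Q hQ ->]; exists (P + Q); [exact: rpredD|rewrite mevalD].
Qed.

Lemma max_powM N N' p q : max_pow N p -> max_pow N' q -> max_pow (N + N') (p * q).
Proof.
by move=> [P hP ->] [Q hQ ->]; exists (P * Q); [exact: dhomogM|rewrite mevalM].
Qed.

Lemma max_pow_cst p : max_pow 0 p.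
Proof.
exists (p%:MP); last by rewrite mevalC.
by rewrite -[p%:MP]mulr1 mul_mpolyC; apply: rpredZ; exact: dhomog1.
Qed.

Lemma max_powX N (m : 'X_{1..M}) : (N <= mdeg m)%N -> max_pow N 'X_[m].
Proof.
elim: N m => [|N IH] m Nm; first exact: max_pow_cst.
have [i mi] : exists i, (0 < m i)%N.
  apply: contrapT => h; move: Nm; rewrite mdegE big1 // => i _.
  by apply/eqP; rewrite -leqn0 leqNgt; apply/negP => mi; apply: h; exists i.
have em : m = (U_(i) + (m - U_(i)))%MM by rewrite addmC submK // lep1mP -lt0n.
rewrite em mpolyXD -add1n; apply: max_powM.
  by exists 'X_i; [rewrite dhomogX; apply/eqP; exact: mdeg1|rewrite mevalXU].
by apply: IH; move: Nm; rewrite [in X in X -> _]em mdegD mdeg1.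
Qed.

Lemma max_powP N p : (forall m, (mdeg m < N)%N -> p@_m = 0) -> max_pow N p.
Proof.
move=> hp; rewrite [p]mpolyE.
apply: (big_ind (max_pow N)); [exact: max_pow0|exact: max_powD|move=> m _].
have [mN|mN] := ltnP (mdeg m) N; first by rewrite hp // scale0r; exact: max_pow0.
by rewrite -mul_mpolyC -[N]add0n; apply: max_powM; [exact: max_pow_cst|exact: max_powX].
Qed.

(** Write h - g_N = P_N(X) with P_N homogeneous of degree N in the outer variables of [max_pow]. The
    two-level polynomial ring is noetherian, so some P_N is a combination of P_0, ..., P_(N-1).
    Evaluated at the generators, this becomes h - g_N = sum x_i (h - g_i) with all x_i zero at the
    origin, and x is the sum of the x_i. *)
Lemma krull_intersection I h : is_ideal I ->
  (forall N, exists2 g, I g & max_pow N (h - g)) ->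
  exists2 x, x.@[fun=> 0] = 0 & I (h * (1 - x)).
Proof.
move=> hI hh.
have /choice[gP hgP] : forall N, exists gP : {mpoly K[M]} * {mpoly {mpoly K[M]}[M]},
    [/\ I gP.1, gP.2 \is N.-homog & h - gP.1 = gP.2.@[fun i => 'X_i]].
  by move=> N; have [g Ig [P hP e]] := hh N; exists (g, P).
have [N [c hc]] := noetherian_chain (fun i => (gP i).2)
  (noetherian_mpoly (n := M) (noetherian_mpoly (n := M) (@noetherian_field K))).
(* Only the part of [c i] of degree N - i contributes in degree N. This degree is positive as i < N,
   which makes [d i] vanish at the origin once evaluated. *)
pose d (i : 'I_N) := pihomog mdeg (N - i) (c i).
have hd : (gP N).2 = \sum_(i < N) d i * (gP i).2.
  have [_ hN _] := hgP N; rewrite -[LHS](pihomog_dE hN) hc raddf_sum /=.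
  apply: eq_bigr => i _; have [_ hi _] := hgP i.
  rewrite {1}(pihomog_partitionE (leqnn (mmeasure mdeg (c i)))) mulr_suml raddf_sum /=.

  have hom (e : nat) : pihomog mdeg e (c i) * (gP i).2 \is (e + i).-homog.
    by apply: dhomogM => //; exact: pihomogP.
  have NiN : (N - i + i)%N = N by rewrite subnK // ltnW.
  have [kN|kN] := leqP (mmeasure mdeg (c i)) (N - i).
    rewrite big1 => [|e _].
      rewrite /d (_ : pihomog mdeg _ _ = 0) ?mul0r //.
      rewrite pihomogE big_seq_cond big1 // => m /andP[mc /eqP mN].
      by have := mmeasure_mnm_lt mdeg mc; rewrite mN ltnNge kN.
    apply: (pihomog_ne0 _ (hom e)); rewrite -[X in _ != X]NiN eqn_add2r.
    by rewrite neq_ltn (leq_trans (ltn_ord e)).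
  rewrite (bigD1 (Ordinal kN)) //= big1 ?addr0 => [|e eN].
    by rewrite pihomog_dE // -[X in X.-homog]NiN; exact: hom.
  apply: (pihomog_ne0 _ (hom e)); rewrite -[X in _ != X]NiN eqn_add2r.
  by apply: contra eN => /eqP eN; apply/eqP/val_inj.
have hx : h - (gP N).1 = \sum_(i < N) (d i).@[fun i => 'X_i] * (h - (gP i).1).
  have [_ _ ->] := hgP N; rewrite hd raddf_sum /=; apply: eq_bigr => i _.
  by rewrite mevalM; have [_ _ ->] := hgP i.
exists (\sum_(i < N) (d i).@[fun i => 'X_i]).
  rewrite raddf_sum /= big1 // => i _.
  have hdi : d i \is (N - i).-homog by exact: pihomogP.
  rewrite [X in meval _ X]mevalE raddf_sum big_seq big1 // => m md /=.
  rewrite mevalM rmorph_prod /=.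
  have : (0 < mdeg m)%N by rewrite (dhomog_mf hdi md) subn_gt0.
  rewrite lt0n mdeg_eq0 => /eqP mn0.
  have [j mj] : exists j, m j != 0%N.
    by apply: contrapT => hn; apply: mn0; apply/mnmP => j; rewrite mnm0E;
       apply: contrapT => /eqP; move=> ?; apply: hn; exists j.
  by rewrite (bigD1 j) //= rmorphXn /= mevalXU expr0n (negPf mj) mul0r mulr0.
rewrite (_ : h * _ = (gP N).1 + \sum_(i < N) (- (d i).@[fun i => 'X_i]) * (gP i).1).
  apply: ideal_add => //; first by case: (hgP N).
  by apply: ideal_sum => // i _; apply: ideal_mul => //; case: (hgP i).
rewrite mulrBr mulr1 -[X in X - _](subrK (gP N).1) hx addrAC addrC; congr (_ + _).
rewrite mulr_sumr -sumrB; apply: eq_bigr => i _; ring.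
Qed.

End Krull.

(** * Comparison of two ideals at a point *)

(** Uniqueness of digits in base [B]. It serves for Kronecker substitution and later for telling
    apart the torus weights of diagonal monomials. *)
Lemma digits_inj n B (m m' : 'I_n -> nat) :
  (forall i, m i < B)%N -> (forall i, m' i < B)%N ->
  (\sum_(i < n) m i * B ^ i = \sum_(i < n) m' i * B ^ i)%N -> m =1 m'.
Proof.
elim: n m m' => [|n IH] m m' hm hm'; first by move=> _ [].
have step (k : 'I_n.+1 -> nat) : (\sum_(i < n.+1) k i * B ^ i =
    k ord0 + (\sum_(i < n) k (lift ord0 i) * B ^ i) * B)%N.
  rewrite big_ord_recl muln1 big_distrl /=; congr (_ + _)%N; apply: eq_bigr => i _.
  by rewrite /bump /= expnS -mulnA [(B * _)%N]mulnC.
rewrite !step => e.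
have e0 : m ord0 = m' ord0.
  by have := congr1 (modn^~ B) e; rewrite /= ![(_ ord0 + _)%N]addnC !modnMDl !modn_small.
move/eqP: e; rewrite e0 eqn_add2l eqn_pmul2r ?(leq_ltn_trans _ (hm ord0)) // => /eqP e.
move=> i; case: (unliftP ord0 i) => [j ->|->]//.
exact: (IH (fun i => m (lift ord0 i)) (fun i => m' (lift ord0 i))).
Qed.

(** Kronecker substitution of s^(B^i) for the i-th variable: with [B] above all exponents, distinct
    monomials become distinct powers of s. *)
Lemma mpoly_fun_eq0 (K : numFieldType) n (p : {mpoly K[n]}) :
  (forall v, p.@[v] = 0) -> p = 0.
Proof.
move=> hp; apply/mpolyP => m0; rewrite mcoeff0; apply/eqP; rewrite mcoeff_eq0.
apply/negP => m0p.
pose B := msize p; pose dig (m : 'X_{1..n}) := (\sum_(i < n) m i * B ^ i)%N.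
have hB m : m \in msupp p -> forall i, (m i < B)%N.
  move=> mp i; apply: leq_ltn_trans (msize_mdeg_lt mp).
  by rewrite mdegE (bigD1 i) //= leq_addr.
pose q : {poly K} := \sum_(m <- msupp p) p@_m *: 'X^(dig m).
have q0 : q = 0.
  apply: poly_fun_eq => s _; rewrite horner0 -(hp (fun i => s ^+ (B ^ i))) mevalE.
  rewrite horner_sum; apply: eq_bigr => m _; rewrite hornerZ hornerXn; congr (_ * _).
  by rewrite /dig -prodrXr; apply: eq_bigr => i _; rewrite -exprM mulnC.
have : q`_(dig m0) = p@_m0.
  rewrite coef_sum (bigD1_seq m0) ?msupp_uniq //= coefZ coefXn eqxx mulr1.
  rewrite big_seq_cond big1 ?addr0 // => m /andP[mp mm0]; rewrite coefZ coefXn.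
  case: eqP => [e|]; rewrite ?mulr0 //; case/eqP: mm0; apply/mnmP.
  by apply: (@digits_inj _ B) => //; exact: hB.
by rewrite q0 coef0 => /esym/eqP; rewrite mcoeff_eq0 m0p.
Qed.

Section LocalInclusion.
Variables (K : numFieldType) (M : nat).
Implicit Types (p q h : {mpoly K[M]}) (I J : {mpoly K[M]} -> Prop) (v : 'rV[K]_M).

Definition has_order N p := forall m, (mdeg m < N)%N -> p@_m = 0.

Lemma has_orderD N p q : has_order N p -> has_order N q -> has_order N (p + q).
Proof. by move=> hp hq m mN; rewrite mcoeffD hp // hq // addr0. Qed.

Lemma has_orderN N p : has_order N p -> has_order N (- p).
Proof. by move=> hp m mN; rewrite mcoeffN hp // oppr0. Qed.

Lemma has_order_sum N (T : Type) (r : seq T) (F : T -> {mpoly K[M]}) :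
  (forall i, has_order N (F i)) -> has_order N (\sum_(i <- r) F i).
Proof.
move=> h; apply: (big_ind (has_order N)) => //; last exact: has_orderD.
by move=> m _; rewrite mcoeff0.
Qed.

Lemma has_orderM N N' p q : has_order N p -> has_order N' q -> has_order (N + N') (p * q).
Proof.
move=> hp hq m mN; rewrite mcoeffM big1 // => -[k1 k2] /= /eqP mE.
have [k1N|k1N] := ltnP (mdeg k1) N; first by rewrite hp // mul0r.
rewrite [q@__]hq ?mulr0 // ltnNge; apply/negP => k2N.
by move: mN; rewrite mE mdegD ltnNge leq_add.
Qed.

Lemma has_order_homog N p : p \is N.-homog -> has_order N p.
Proof.
by move=> hp m mN; rewrite (dhomog_nemf_coeff hp) //= neq_ltn mN.
Qed.

Lemma mcoeff_pihomog d p m : (pihomog mdeg d p)@_m = if mdeg m == d then p@_m else 0.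
Proof.
case: eqP => [md|/eqP md]; last exact: dhomog_nemf_coeff (pihomogP mdeg d p) md.
rewrite pihomogE [p in RHS]mpolyE !raddf_sum /= [RHS](bigID (fun k => mdeg k == d)) /=.
rewrite [X in _ = _ + X]big1 ?addr0 // => k kd; rewrite mcoeffZ mcoeffX.
by case: eqP => [kE|]; rewrite ?mulr0 //; rewrite kE md eqxx in kd.
Qed.

Lemma has_order_lead N p : has_order N p -> has_order N.+1 (p - pihomog mdeg N p).
Proof.
move=> hp m; rewrite ltnS leq_eqVlt mcoeffB mcoeff_pihomog => /orP[/eqP->|mN].
  by rewrite eqxx subrr.
by rewrite hp // ltn_eqF // subr0.
Qed.

(** Modulo the differences X_i - w_i each variable may be replaced by w_i. The cofactors are kept
    explicit because [local_inclusion] takes their homogeneous components. *)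
Lemma sub_comp_ideal (w : M.-tuple {mpoly K[M]}) p :
  exists b : 'I_M -> {mpoly K[M]}, p - (p \mPo w) = \sum_i ('X_i - tnth w i) * b i.
Proof.
pose Q p := exists b : 'I_M -> {mpoly K[M]}, p - (p \mPo w) = \sum_i ('X_i - tnth w i) * b i.
have Q0 c : Q c%:MP.
  by exists (fun=> 0); rewrite comp_mpolyC subrr big1 // => i _; rewrite mulr0.
have QM p1 q1 : Q p1 -> Q q1 -> Q (p1 * q1).
  move=> [b hb] [c hc]; exists (fun i => b i * q1 + (p1 \mPo w) * c i).
  rewrite rmorphM /=.
  transitivity ((p1 - (p1 \mPo w)) * q1 + (p1 \mPo w) * (q1 - (q1 \mPo w))); first by ring.
  rewrite hb hc mulr_suml mulr_sumr -big_split /=; apply: eq_bigr => i _; ring.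
have QD p1 q1 : Q p1 -> Q q1 -> Q (p1 + q1).
  move=> [b hb] [c hc]; exists (fun i => b i + c i).
  rewrite rmorphD /= opprD addrACA hb hc -big_split; apply: eq_bigr => i _ /=.
  by rewrite mulrDr.
have QX i : Q 'X_i.
  exists (fun j => (j == i)%:R); rewrite comp_mpolyXU -tnth_nth (bigD1 i) //= eqxx mulr1.
  by rewrite big1 ?addr0 // => j /negPf ->; rewrite mulr0.
rewrite -/(Q p); elim/mpolyind: p => [|c m p _ _ hp]; first by rewrite -mpolyC0.
apply: (QD) => //; rewrite -mul_mpolyC; apply: (QM) => //.
rewrite mpolyXE_id; apply: (big_ind Q); [by rewrite -mpolyC1; exact: Q0|exact: QM|].
move=> i _; move: (m i) => k; elim: k => [|k IH]; first by rewrite expr0 -mpolyC1; exact: Q0.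
by rewrite exprS; exact: QM.
Qed.

Definition evalr p v := p.@[fun i => v 0 i].

(* The covectors vanishing on L are linear parts of elements of I, so modulo I
   every form can be rewritten, up to higher order, as a form in coordinates of
   L; the leading form of an element of J then disappears. *)
Lemma local_inclusion r (L : 'M[K]_(r, M)) I J :
  is_ideal I -> is_ideal J -> (forall p, I p -> J p) ->
  (forall c : 'rV[K]_M, (forall v, (v <= L)%MS -> \sum_i c 0 i * v 0 i = 0) ->
     exists2 p, I p & p@_0%MM = 0 /\ forall i, p@_U_(i) = c 0 i) ->
  (forall N h, J h -> has_order N h ->
     forall v, (v <= L)%MS -> evalr (pihomog mdeg N h) v = 0) ->
  forall h, J h -> forall N, exists2 g, I g & max_pow N (h - g).
Proof.
move=> hI hJ IJ hlin hlead h Jh N.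
suff [g Ig hg] : exists2 g, I g & has_order N (h - g) by exists g => //; exact: max_powP.
elim: N => [|N [g Ig hg]]; first by exists 0 => //; case: hI.
have Jhg : J (h - g).
  by apply: ideal_add => //; rewrite -mulN1r; apply: ideal_mul => //; exact: IJ.
have {hlead} := hlead _ _ Jhg hg; have := has_order_lead hg.
have := pihomogP mdeg N (h - g); have : pihomog mdeg N (h - g) = pihomog mdeg N (h - g) by [].
move: {1 3 4 5}(pihomog mdeg N (h - g)) => a; case: N hg => [|N] hg aE ha hla lead.
  (* In degree 0 the leading form is a constant, read off at the vector 0 of [L]. *)
  exists g => // m; rewrite ltnS leqn0 => m0; move: (lead 0 (sub0mx _ _)).
  rewrite /evalr (_ : a = (a@_0%MM)%:MP); last first.
    apply/mpolyP => k; rewrite mcoeffC; case: eqP => [->|/eqP k0]; rewrite ?mulr1 // mulr0.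
    by rewrite (dhomog_nemf_coeff ha) //= mdeg_eq0.
  rewrite mevalC aE mcoeff_pihomog mdeg0 eqxx => <-.
  by rewrite mdeg_eq0 in m0; rewrite (eqP m0).
(* [Pi] projects onto [L] and [w] lists its coordinate functions. As [a] vanishes on [L],
   substituting [w] kills it, so [a] is a combination of the X_i - w_i. *)
pose Pi := pinvmx L *m L.
have PiL v : (v *m Pi <= L)%MS by rewrite mulmxA submxMl.
have PiK v : (v <= L)%MS -> v *m Pi = v by move=> vL; rewrite mulmxA mulmxKpV.
pose w := [tuple \sum_l Pi l i *: 'X_l | i < M] : M.-tuple {mpoly K[M]}.
have aw : a \mPo w = 0.
  apply: mpoly_fun_eq0 => v; rewrite comp_mpoly_meval -(lead ((\row_i v i) *m Pi)) //.
  apply: meval_eq => i; rewrite tnth_mktuple raddf_sum mxE /=; apply: eq_bigr => l _.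
  by rewrite mevalZ mevalXU mxE mulrC.
have [b hb] := sub_comp_ideal w a; rewrite aw subr0 in hb.
(* X_i - w_i vanishes on [L], hence is the linear part of an element [G i] of [I], with an error of
   order 2. *)
have /choice[G hG] : forall i, exists p, I p /\
    exists2 q, has_order 2 q & p = ('X_i - tnth w i) + q.
  move=> i; have [v vL|p Ip [p0 pU]] := hlin (\row_k ((k == i)%:R - Pi k i)).
    have vE : v 0 i = \sum_k v 0 k * Pi k i by rewrite -[v in LHS]PiK // mxE.
    rewrite (eq_bigr (fun k => (k == i)%:R * v 0 k - v 0 k * Pi k i)); last first.
      by move=> k _; rewrite mxE mulrBl [X in _ - X]mulrC.
    rewrite sumrB -vE (bigD1 i) //= eqxx mul1r big1 ?addr0 ?subrr // => k ki.
    by rewrite (negPf ki) mul0r.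
  exists p; split=> //; exists (p - ('X_i - tnth w i)); last by rewrite addrC subrK.
  have hl : 'X_i - tnth w i \is 1.-homog.
    rewrite tnth_mktuple; apply: rpredB; first by rewrite dhomogX; apply/eqP; exact: mdeg1.
    by apply: rpred_sum => l _; apply: rpredZ; rewrite dhomogX; apply/eqP; exact: mdeg1.
  move=> m; rewrite ltnS leq_eqVlt ltnS leqn0 => /orP[|m0]; last first.
    rewrite mcoeffB (dhomog_nemf_coeff hl) /= ?(eqP m0) // subr0.
    by rewrite mdeg_eq0 in m0; rewrite (eqP m0).
  move=> /mdeg1P[j /eqP ->]; rewrite mcoeffB pU tnth_mktuple mcoeffB raddf_sum /=.
  rewrite mxE (bigD1 j) //= mcoeffZ !mcoeffXU eqxx mulr1 big1 ?addr0 => [|l lj].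
    by rewrite eq_sym subrr.
  by rewrite mcoeffZ mcoeffXU (negPf lj) mulr0.
(* [a] has degree N + 1, so the cofactors may be cut down to degree N; the errors q_i b'_i then have
   order N + 2. *)
pose b' i := pihomog mdeg N (b i).
have hab : a = \sum_i ('X_i - tnth w i) * b' i.
  rewrite -(pihomog_dE ha) hb raddf_sum /=; apply: eq_bigr => i _.
  have hl : 'X_i - tnth w i \is 1.-homog.
    rewrite tnth_mktuple; apply: rpredB; first by rewrite dhomogX; apply/eqP; exact: mdeg1.
    by apply: rpred_sum => l _; apply: rpredZ; rewrite dhomogX; apply/eqP; exact: mdeg1.
  rewrite /b' {1}(pihomog_partitionE (leqnn (mmeasure mdeg (b i)))) mulr_sumr raddf_sum /=.
  have hom (e : nat) : ('X_i - tnth w i) * pihomog mdeg e (b i) \is e.+1.-homog.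
    by rewrite -add1n; apply: dhomogM => //; exact: pihomogP.
  have [kN|kN] := leqP (mmeasure mdeg (b i)) N.
    rewrite big1 => [|e _].
      rewrite (_ : pihomog mdeg _ _ = 0) ?mulr0 //.
      rewrite pihomogE big_seq_cond big1 // => m /andP[mc /eqP mN].
      by have := mmeasure_mnm_lt mdeg mc; rewrite mN ltnNge kN.
    by apply: (pihomog_ne0 _ (hom e)); rewrite eqSS neq_ltn (leq_trans (ltn_ord e)).
  rewrite (bigD1 (Ordinal kN)) //= big1 ?addr0 => [|e eN]; first exact: pihomog_dE.
  apply: (pihomog_ne0 _ (hom e)); rewrite eqSS.
  by apply: contra eN => /eqP eN; apply/eqP/val_inj.
exists (g + \sum_i b' i * G i).
  apply: ideal_add => //; apply: ideal_sum => // i _; apply: ideal_mul => //.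
  by case: (hG i).
have /choice[q hq] : forall i, exists q, has_order 2 q /\ G i = 'X_i - tnth w i + q.
  by move=> i; have [_ [q hq1 hq2]] := hG i; exists q.
have -> : h - (g + \sum_i b' i * G i) = (h - g - a) - \sum_i q i * b' i.
  rewrite hab opprD addrA -[RHS]addrA; congr (_ + _); rewrite -opprD -big_split /=.
  congr (- _); apply: eq_bigr => i _; have [_ ->] := hq i; ring.
apply: has_orderD => //; apply: has_orderN; apply: has_order_sum => i.
rewrite -[N.+2]add2n; apply: has_orderM; first by case: (hq i).
by apply: has_order_homog; exact: pihomogP.
Qed.

End LocalInclusion.

(** * Forms and linear substitutions *)

Lemma homog_mderiv (K : fieldType) n d i (p : {mpoly K[n]}) :
  p \is d.-homog -> p^`M(i) \is d.-1.-homog.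
Proof.
move=> hp; apply/dhomogP => m; rewrite mcoeff_msupp mcoeff_mderiv => nz.
have : p@_(m + U_(i)) != 0 by apply: contraNneq nz => ->; rewrite mul0rn.
by rewrite -mcoeff_msupp => /(dhomog_mf hp) /=; rewrite mdegD mdeg1 addn1 => <-.
Qed.

Section DirectionalDerivative.
Variables (K : fieldType) (N : nat).

Definition dirder (a : 'I_N -> K) (p : {mpoly K[N]}) : {mpoly K[N]} :=
  \sum_k a k *: p^`M(k).

Lemma dirder_is_linear a : linear (dirder a).
Proof.
move=> c p q; rewrite /dirder scaler_sumr -big_split; apply: eq_bigr => k _ /=.
by rewrite linearP scalerDr !scalerA mulrC.
Qed.

HB.instance Definition _ a := GRing.isLinear.Build K {mpoly K[N]} {mpoly K[N]} _
  (dirder a) (dirder_is_linear a).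

Lemma dirderM a p q : dirder a (p * q) = dirder a p * q + p * dirder a q.
Proof.
rewrite /dirder mulr_suml mulr_sumr -big_split; apply: eq_bigr => k _ /=.
by rewrite mderivM scalerDr scalerAl scalerAr.
Qed.

Lemma dirderC a c : dirder a c%:MP = 0.
Proof. by rewrite /dirder big1 // => k _; rewrite mderivC scaler0. Qed.

Lemma dirderX a i : dirder a 'X_i = (a i)%:MP.
Proof.
rewrite /dirder (bigD1 i) //= big1 ?addr0 => [|k ki].
  by rewrite mderivX mnm1E eqxx scale1r (_ : (_ - _)%MM = 0%MM) ?mpolyX0 -?mul_mpolyC
    ?mulr1 //; apply/mnmP => j; rewrite mnmBE subnn mnm0E.
by rewrite mderivX mnm1E eq_sym (negPf ki) scale0r scaler0.
Qed.

Lemma dirder_homog a d p : p \is d.-homog -> dirder a p \is d.-1.-homog.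
Proof. by move=> hp; apply: rpred_sum => k _; apply: rpredZ; exact: homog_mderiv. Qed.

(** Chain rule for a linear substitution, checked on variables and extended by the Leibniz rule. *)
Lemma dirder_lin (g : 'M[K]_N) a p :
  dirder a (p \mPo lin_forms g) = dirder (fun k => \sum_l g k l * a l) p \mPo lin_forms g.
Proof.
set b := fun k => _; pose Q p := dirder a (p \mPo lin_forms g) = dirder b p \mPo lin_forms g.
have Q0 c : Q c%:MP by rewrite /Q comp_mpolyC !dirderC comp_mpoly0.
have QD p1 q1 : Q p1 -> Q q1 -> Q (p1 + q1).
  by rewrite /Q => h1 h2; rewrite comp_mpolyD !(linearD (dirder _)) /= comp_mpolyD h1 h2.
have QM p1 q1 : Q p1 -> Q q1 -> Q (p1 * q1).
  rewrite /Q => h1 h2.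
  by rewrite (rmorphM (comp_mpoly (lin_forms g))) !dirderM linearD /= !rmorphM /= h1 h2.
have QX i : Q 'X_i.
  rewrite /Q comp_mpolyXU -tnth_nth tnth_mktuple dirderX comp_mpolyC linear_sum /=.
  rewrite /b rmorph_sum /=.
  by apply: eq_bigr => l _; rewrite linearZ /= dirderX rmorphM /= mul_mpolyC.
rewrite -/(Q p); elim/mpolyind: p => [|c m p _ _ hp]; first by rewrite -mpolyC0.
apply: (QD) => //; rewrite -mul_mpolyC; apply: (QM) => //.
rewrite mpolyXE_id; apply: (big_ind Q); [by rewrite -mpolyC1; exact: Q0|exact: QM|].
move=> i _; move: (m i) => k; elim: k => [|k IH]; first by rewrite expr0 -mpolyC1; exact: Q0.
by rewrite exprS; exact: QM.
Qed.

End DirectionalDerivative.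

Lemma homform_valP (K : fieldType) N d a (P Q : homform K N d) :
  mpoly_of_dhomog (a *: P + Q) = a *: mpoly_of_dhomog P + mpoly_of_dhomog Q.
Proof. by []. Qed.

Lemma homform_valZ (K : fieldType) N d a (P : homform K N d) :
  mpoly_of_dhomog (a *: P) = a *: mpoly_of_dhomog P.
Proof. by []. Qed.

Section Precomp.
Variables (K : numFieldType) (N d : nat).
Implicit Types (g h : 'M[K]_N) (P Q : homform K N d).

Definition pt m (w : 'cV[K]_m) : 'I_m -> K := fun i => w i 0.

Lemma mpoly_ext m (p q : {mpoly K[m]}) : (forall w, p.@[pt w] = q.@[pt w]) -> p = q.
Proof.
move=> h; apply/subr0_eq/mpoly_fun_eq0 => v; rewrite mevalB.
have := h (\col_i v i); rewrite !(@meval_eq _ _ (pt _) v); first by move=> ->; rewrite subrr.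
- by move=> i; rewrite /pt mxE.
- by move=> i; rewrite /pt mxE.
Qed.

Lemma form_ext P Q : (forall w, (mpoly_of_dhomog P).@[pt w] = (mpoly_of_dhomog Q).@[pt w]) ->
  P = Q.
Proof. by move=> h; apply: val_inj; exact: mpoly_ext. Qed.

Lemma lin_forms_eval g w (p : {mpoly K[N]}) :
  (p \mPo lin_forms g).@[pt w] = p.@[pt (g *m w)].
Proof.
rewrite comp_mpoly_meval; apply: meval_eq => i.
rewrite tnth_mktuple raddf_sum /pt mxE; apply: eq_bigr => l _ /=.
by rewrite mevalZ mevalXU.
Qed.

Lemma precomp_eval g P w :
  (mpoly_of_dhomog (precomp g P)).@[pt w] = (mpoly_of_dhomog P).@[pt (g *m w)].
Proof. exact: lin_forms_eval. Qed.

Lemma precomp_is_linear g : linear (precomp g : homform K N d -> homform K N d).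
Proof.
move=> a P Q; apply: val_inj => /=.
by rewrite linearP.
Qed.

HB.instance Definition _ g := GRing.isLinear.Build K (homform K N d) (homform K N d) _
  (precomp g) (precomp_is_linear g).

Lemma precomp_comp g h P : precomp g (precomp h P) = precomp (h *m g) P.
Proof. by apply: form_ext => w; rewrite !precomp_eval mulmxA. Qed.

Lemma precomp1 P : precomp 1%:M P = P.
Proof. by apply: form_ext => w; rewrite precomp_eval mul1mx. Qed.

Lemma act_funE g (F : homform K N d -> K) P : act_fun g F P = F (precomp g P).
Proof. by rewrite /act_fun /act_form invmxK. Qed.

End Precomp.

Section Curves.
Variables (K : numFieldType) (N d : nat).

Lemma mcoeff_homog_fun m : @homog_fun K (homform K N d) 1 (fun P => (mpoly_of_dhomog P)@_m).
Proof.
apply: homog_fun_linear => a u v.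
by rewrite homform_valP mcoeffD mcoeffZ.
Qed.

Lemma form_coefs_inj : injective (@form_coefs K N d).
Proof.
move=> P Q e; apply: val_inj; apply/mpolyP => m /=.
have [dm|dm] := eqVneq (mdeg m) d; last first.
  by rewrite !(dhomog_nemf_coeff (dhomog_is_dhomog _) dm).
have lm : (mdeg m < d.+1)%N by rewrite dm.
pose m' : monom N d := exist _ (BMultinom lm) (introT eqP dm : mdeg _ == d).
by have := congr1 (fun r : 'rV_#|{: monom N d}| => r 0 (enum_rank m')) e; rewrite !mxE enum_rankK.
Qed.

Definition form_of_coefs (r : 'rV[K]_#|{: monom N d}|) : homform K N d :=
  DHomog (sum_monom_homog r).

Lemma form_of_coefsK : cancel form_of_coefs (@form_coefs K N d).
Proof.
move=> r; apply/rowP => j; rewrite mxE /= raddf_sum /= (bigD1 j) //= big1.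
  by rewrite addr0 mcoeffZ mcoeffX eqxx mulr1.
move=> k kj; rewrite mcoeffZ mcoeffX; case: eqP => [mE|]; rewrite ?mulr0 //.
by case/negP: kj; apply/eqP/enum_val_inj; do 2!apply: val_inj.
Qed.

Lemma form_coefsK : cancel (@form_coefs K N d) form_of_coefs.
Proof. by move=> P; apply: form_coefs_inj; rewrite form_of_coefsK. Qed.

Lemma form_expand (l : homform K N d -> K) :
  (forall a u v, l (a *: u + v) = a * l u + l v) ->
  exists c : 'I_#|{: monom N d}| -> K, forall P,
    l P = \sum_i c i * (mpoly_of_dhomog P)@_(bmnm (val (enum_val i))).
Proof.
move=> hl; have l0 : l 0 = 0 by have := hl (-1) 0 0; rewrite scaler0 addr0 mulN1r addNr.
pose g := form_of_coefs; have fK := form_coefsK.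
have gl a r s : g (a *: r + s) = a *: g r + g s.
  by apply: form_coefs_inj; rewrite form_of_coefsK form_coefs_linear !form_of_coefsK.
pose lg r := l (g r).
have lgl a r s : lg (a *: r + s) = a * lg r + lg s by rewrite /lg gl hl.
have lg0 : lg 0 = 0 by have := lgl (-1) 0 0; rewrite scaler0 addr0 mulN1r addNr.
exists (fun i => lg (delta_mx 0 i)) => P.
rewrite -[P in LHS]fK -/(lg _) [form_coefs P]row_sum_delta.
rewrite (big_morph lg (id1 := 0) (op1 := +%R)) //; last first.
  by move=> x y; have := lgl 1 x y; rewrite scale1r mul1r.
apply: eq_bigr => i _; have := lgl (form_coefs P 0 i) (delta_mx 0 i) 0.
by rewrite !addr0 lg0 addr0 mulrC => ->; rewrite mxE.
Qed.

Section GradedCurves.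
Variables (X : Type) (A : nat -> (X -> K) -> Prop) (gA : graded_alg A).

Lemma ga_form_linear e (Phi : X -> homform K N d) (l : homform K N d -> K) :
  (forall a u v, l (a *: u + v) = a * l u + l v) ->
  gam A e (fun x => mpoly_of_dhomog (Phi x)) -> A e (fun x => l (Phi x)).
Proof.
move=> /form_expand[c hc] hP.
apply: (ga_ext (f := fun x => \sum_i c i *
   (mpoly_of_dhomog (Phi x))@_(bmnm (val (enum_val i))))) => [x|]; first by rewrite hc.
by apply: ga_sum => // i _; apply: gaZ => //; exact: hP.
Qed.

Lemma ga_homog_fun k e (Phi : X -> homform K N d) (F : homform K N d -> K) :
  @homog_fun K (homform K N d) k F ->
  gam A e (fun x => mpoly_of_dhomog (Phi x)) -> A (k * e)%N (fun x => F (Phi x)).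
Proof.
move=> [p hp hF] hP.
apply: (ga_ext (f := fun x => p.@[fun i => coords (Phi x) i])) => [x|]; first by rewrite hF.
apply: ga_meval => // i; apply: (@ga_form_linear _ _ (fun v => coords v i)) => // a u v.
by rewrite /coords linearP.
Qed.

End GradedCurves.

Lemma precomp_curve (g h : 'M[K]_N) (P : homform K N d) :
  gam (@polfun K) d (fun s => mpoly_of_dhomog (precomp (g + s *: h) P)).
Proof.
have := @gam_comp _ _ _ (polfun_graded K) N N 0 1 (fun=> mpoly_of_dhomog P)
  (fun k s => \sum_(l < N) (g + s *: h) k l *: 'X_l) d.
rewrite muln1 add0n; apply;
  [by move=> s; exact: (dhomog_is_dhomog P)|exact: (gam_cst (polfun_graded K))|].
move=> i; apply: gam_sum => [|l _]; first exact: polfun_graded.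
rewrite -[1%N]addn0; apply: gamZ; first exact: polfun_graded.
  by apply: ga_ext (polfun_affine (g i l) (h i l)) => s; rewrite !mxE mulrC.
exact: (gam_cst (polfun_graded K)).
Qed.

Lemma homog_fun_precomp_curve k (F : homform K N d -> K) (g h : 'M[K]_N) (P : homform K N d) :
  @homog_fun K (homform K N d) k F ->
  polfun (k * d) (fun s => F (precomp (g + s *: h) P)).
Proof.
by move=> hF; apply: (ga_homog_fun (polfun_graded K) hF); exact: precomp_curve.
Qed.

Lemma homog_funZ k (F : homform K N d -> K) a P :
  @homog_fun K (homform K N d) k F -> F (a *: P) = a ^+ k * F P.
Proof.
move=> [p hp hF]; rewrite !hF !mevalE big_distrr /= big_seq [RHS]big_seq.
apply: eq_bigr => m mP; rewrite mulrCA; congr (_ * _).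
rewrite -(dhomog_mf hp mP) /= mdegE -prodrXr -big_split; apply: eq_bigr => i _ /=.
by rewrite /coords linearZ exprMn.
Qed.

End Curves.

(** * Residue of a quotient of polynomials *)

Lemma coef_signM (R : nzRingType) (x : {poly R}) r k :
  ((-1) ^+ r * x)`_k = (-1) ^+ r * x`_k.
Proof. by rewrite -polyC1 -polyCN -polyC_exp coefCM. Qed.

Section Residue.
Variables (n e : nat).
Hypotheses (n_gt0 : (0 < n)%N) (n_le_e : (n <= e)%N).
Let D := (e - (n - 1))%N.

(** The expression of [E_fun] for arbitrary coefficient sequences. The ring is left free so that the
    coefficients can be polynomials in a deformation parameter. *)
Definition residue (R : comNzRingType) (q p : nat -> R) : R :=
  \sum_(n - 1 <= i < e.+1) \sum_(r < (i - (n - 1)).+1)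
   \sum_(j : {ffun 'I_r -> 'I_n.+1} |
         [forall s, 0 < j s]%N && (\sum_s j s == i - (n - 1))%N)
     (-1) ^+ r * q i * (\prod_s p (n - j s)%N) * p n ^+ (e - (n - 1) - r).

Section Ring.
Variable R : comNzRingType.
Implicit Types (p q : nat -> R).

(* The polynomial t^n p(1/t), without its constant term. *)
Definition rev_tail p : {poly R} := \sum_(j < n.+1 | (0 < j)%N) p (n - j)%N *: 'X^j.

(** Truncated geometric series: with t = 1/x, this is p_n^(D+1) / (p_n + rev_tail p) modulo t^(D+1),
    cleared of denominators and so meaningful for p_n = 0. *)
Definition inv_series p : {poly R} :=
  \sum_(r < D.+1) ((-1) ^+ r * p n ^+ (D - r)) *: rev_tail p ^+ r.

Lemma rev_tail_exp p r k : (rev_tail p ^+ r)`_k =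
  \sum_(j : {ffun 'I_r -> 'I_n.+1} | [forall s, 0 < j s]%N && (\sum_s j s == k)%N)
     \prod_s p (n - j s)%N.
Proof.
have -> : rev_tail p ^+ r = \prod_(s < r) rev_tail p by rewrite prodr_const card_ord.
rewrite bigA_distr_big /= coef_sum [RHS]big_mkcond [LHS]big_mkcond /=.
apply: eq_bigr => j _.
have -> : (j \in ffun_on (fun i : 'I_n.+1 => (0 < i)%N)) = [forall s, 0 < j s]%N.
  by apply/ffun_onP/forallP.
case: ifP => //= _.
have -> : \prod_(s < r) (p (n - j s)%N *: 'X^(j s)) =
   (\prod_(s < r) p (n - j s)%N) *: 'X^(\sum_s j s) :> {poly R}.
  by rewrite scaler_prod prodrXr.
by rewrite coefZ coefXn eq_sym; case: eqP; rewrite ?mulr1 ?mulr0.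
Qed.

Lemma rev_tail_lt p r k : (k < r)%N -> (rev_tail p ^+ r)`_k = 0.
Proof.
move=> kr; rewrite rev_tail_exp big1 // => j /andP[/forallP j0 /eqP jk].
suff : (r <= k)%N by rewrite leqNgt kr.
rewrite -jk -{1}(card_ord r) -sum1_card; apply: leq_sum => s _; exact: j0.
Qed.

Lemma rev_tail_diag p r : (rev_tail p ^+ r)`_r = p (n - 1)%N ^+ r.
Proof.
have aE : rev_tail p = 'X * (\sum_(j < n.+1 | (0 < j)%N) p (n - j)%N *: 'X^(j.-1)).
  rewrite mulr_sumr; apply: eq_bigr => j j0.
  by rewrite -scalerAr -exprS prednK.
rewrite aE exprMn_comm ?coefXnM ?ltnn ?subnn; last exact: mulrC.
rewrite -!horner_coef0 horner_exp horner_coef0 coef_sum.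
congr (_ ^+ _); rewrite (bigD1 (inord 1)) ?inordK ?ltnS //= big1 ?addr0.
  by rewrite coefZ coefXn eqxx mulr1.
move=> j /andP[j0 j1]; rewrite coefZ coefXn; case: eqP; rewrite ?mulr0 //.
move=> j1'; case/eqP: j1; apply: val_inj; rewrite /= inordK ?ltnS //.
by rewrite -(prednK j0) -j1'.
Qed.

Lemma residueE q p :
  residue q p = \sum_(n - 1 <= i < e.+1) q i * (inv_series p)`_(i - (n - 1)).
Proof.
apply: eq_big_nat => i /andP[ni ie]; rewrite coef_sum mulr_sumr.
have hi : ((i - (n - 1)).+1 <= D.+1)%N by rewrite ltnS leq_sub2r.
pose G r := q i * (((-1) ^+ r * p n ^+ (D - r)) * (rev_tail p ^+ r)`_(i - (n - 1))).
transitivity (\sum_(r < (i - (n - 1)).+1) G r).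
  apply: eq_bigr => r _; rewrite /G rev_tail_exp !mulr_sumr; apply: eq_bigr => j _.
  rewrite -/D; ring.
rewrite (big_ord_widen D.+1 G hi) [LHS]big_mkcond /=.
apply: eq_bigr => r _; case: ifP => [_|]; first by rewrite coefZ.
by move/negbT; rewrite -leqNgt => ir; rewrite coefZ rev_tail_lt // !mulr0.
Qed.

Lemma inv_seriesP p : ((p n)%:P + rev_tail p) * inv_series p =
  (p n)%:P ^+ D.+1 - (- rev_tail p) ^+ D.+1.
Proof.
rewrite subrXX opprK; congr (_ * _); apply: eq_bigr => r _.
rewrite -mul_polyC [(- rev_tail p) ^+ r]exprNn polyCM !polyC_exp polyCN polyC1.
by rewrite mulrCA mulrA.
Qed.

(** For q = p s the quotient q/p is a polynomial and has no term in 1/x. The argument on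
    coefficients never divides by p_n. *)
Lemma residue_dvd (p s : {poly R}) : (size p <= n.+1)%N -> (size s <= D)%N ->
  residue (fun i => (p * s)`_i) (fun i => p`_i) = 0.
Proof.
move=> sp ss; rewrite residueE; set B := inv_series _.
(* For s = x^k the sum is the coefficient of t^(k+1) in the product of [inv_seriesP], which is a
   constant minus a series of order at least D + 1. *)
have hX k : (k < D)%N ->
    \sum_(n - 1 <= i < e.+1) (p * 'X^k)`_i * B`_(i - (n - 1)) = 0.
  move=> kD.
  have : (((p`_n)%:P + rev_tail (fun i => p`_i)) * B)`_k.+1 = 0.
    rewrite inv_seriesP coefB -polyC_exp coefC /= [(- rev_tail _) ^+ _]exprNn.
    by rewrite coef_signM rev_tail_lt // mulr0 subrr.
  move=> h0; apply: etrans h0; rewrite coefM.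
  have De : (D + (n - 1) = e)%N by rewrite /D; lia.
  have cE i : ((p`_n)%:P + rev_tail (fun i => p`_i))`_i = if (i <= n)%N then p`_(n - i) else 0.
    rewrite coefD coefC coef_sum.
    case: i => [|i] /=.
      rewrite subn0 big1 ?addr0 // => j j0; rewrite coefZ coefXn.
      by rewrite eq_sym (gtn_eqF j0) mulr0.
    rewrite add0r; case: ifP => [iN|/negbT]; last rewrite -leqNgt => iN.
      rewrite (bigD1 (Ordinal (iN : (i.+1 < n.+1)%N))) //= coefZ coefXn eqxx mulr1.
      rewrite big1 ?addr0 // => j /andP[_ ji]; rewrite coefZ coefXn.
      case: eqP => [ij|]; rewrite ?mulr0 //; case/eqP: ji; exact: val_inj.
    rewrite big1 // => j _; rewrite coefZ coefXn gtn_eqF ?mulr0 //.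
    by apply: (leq_trans (ltn_ord j)); rewrite ltnS.
  pose F i := (if (i <= n)%N then p`_(n - i) else 0) * B`_(k.+1 - i).
  rewrite (eq_bigr (fun i : 'I_k.+2 => F i)); last by move=> i _; rewrite cE.
  rewrite -(big_mkord predT F) [in RHS]big_nat_rev /= add0n.
  rewrite -{1}[(n - 1)%N]add0n big_addn.
  have -> : (e.+1 - (n - 1) = D.+1)%N by rewrite /D; lia.
  rewrite (big_cat_nat (n := k.+2)) //=.
  rewrite [X in _ + X]big_nat_cond [X in _ + X]big1 ?addr0; last first.
    move=> i /andP[/andP[ki iD] _].
    rewrite coefMXn; case: ifP => _; first by rewrite mul0r.
    by rewrite nth_default ?mul0r // (leq_trans sp) //; lia.
  apply: eq_big_nat => i /andP[_ ik]; rewrite coefMXn addnK /F subSS.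
  have -> : (k.+1 - (k.+1 - i) = i)%N by lia.
  case: ltnP => h1; case: leqP => h2; try lia; rewrite ?mul0r //.
  by have -> : (i + (n - 1) - k = n - (k.+1 - i))%N by lia.
rewrite -[s]coefK poly_def.
have -> : p * (\sum_(i < size s) s`_i *: 'X^i) = \sum_(k < size s) s`_k *: (p * 'X^k).
  by rewrite mulr_sumr; apply: eq_bigr => k _; rewrite scalerAr.
under eq_bigr do rewrite coef_sum mulr_suml.
rewrite exchange_big /= big1 // => k _.
under eq_bigr do rewrite coefZ -mulrA.
by rewrite -mulr_sumr hX ?mulr0 // (leq_trans (ltn_ord k)).
Qed.

(** All terms have the same weight: the j_s add up to i - n + 1, so [a] has exponent i + (nr - (i -
    n + 1)) + n(D - r) = nD + n - 1, and [b] has exponent (e - i) + (i - n + 1) = D. *)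
Lemma residue_scale (a b : R) q p q' p' :
  (forall i, (i <= e)%N -> q' i = a ^+ i * b ^+ (e - i) * q i) ->
  (forall i, (i <= n)%N -> p' i = a ^+ i * b ^+ (n - i) * p i) ->
  residue q' p' = a ^+ (n * D + (n - 1)) * b ^+ D * residue q p.
Proof.
move=> hq hp; rewrite /residue mulr_sumr; apply: eq_big_nat => i /andP[ni ie].
rewrite mulr_sumr; apply: eq_bigr => r _; rewrite mulr_sumr; apply: eq_bigr => j.
move=> /andP[_ /eqP js].
have jn s : (j s <= n)%N by rewrite -ltnS.
have -> : \prod_s p' (n - j s)%N = a ^+ (n * r - (i - (n - 1))) * b ^+ (i - (n - 1)) *
    \prod_s p (n - j s)%N.
  rewrite (eq_bigr (fun s => a ^+ (n - j s) * b ^+ j s * p (n - j s)%N)); last first.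
    by move=> s _; rewrite hp ?leq_subr // subKn.
  rewrite !big_split /= !prodrXr js; congr (a ^+ _ * _ * _).
  by rewrite sumnB // js sum_nat_const card_ord mulnC.
rewrite hq // hp // subnn expr0 mulr1 -/D !exprMn -exprM.
have jr : (i - (n - 1) <= n * r)%N.
  have : (\sum_s j s <= \sum_(s < r) n)%N by apply: leq_sum => s _; exact: jn.
  by rewrite js sum_nat_const card_ord mulnC.
have rD : (r <= D)%N by rewrite (leq_trans (ltn_ord r : (r <= i - (n - 1))%N)) // leq_sub2r.
have -> : (n * D + (n - 1) = i + (n * r - (i - (n - 1))) + n * (D - r))%N.
  by rewrite mulnBr; have := leq_mul (leqnn n) rD; lia.
have -> : D = (e - i + (i - (n - 1)))%N by rewrite /D; lia.
rewrite !exprD; have -> : (e - i + (i - (n - 1)) - r = D - r)%N by rewrite /D; lia.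
ring.
Qed.

(** Without p_n only r = D survives, which forces i = e and all j_s = 1. *)
Lemma residue_pn0 q p : p n = 0 -> residue q p = (-1) ^+ D * q e * p (n - 1)%N ^+ D.
Proof.
move=> pn0; rewrite residueE.
have BE : inv_series p = (-1) ^+ D *: rev_tail p ^+ D.
  rewrite /inv_series big_ord_recr /= subnn expr0 mulr1 big1 ?add0r // => r _.
  by rewrite pn0 expr0n subn_eq0 leqNgt ltn_ord mulr0 scale0r.
rewrite BE big_nat_recr /=; last by lia.
rewrite big_nat_cond big1 ?add0r; last first.
  by move=> i /andP[/andP[ni ie] _]; rewrite coefZ rev_tail_lt ?mulr0 // /D; lia.
rewrite -/D coefZ rev_tail_diag; ring.
Qed.

End Ring.

Lemma residue_rmorph (R S : comNzRingType) (f : {rmorphism R -> S}) (q p : nat -> R) :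
  f (residue q p) = residue (fun i => f (q i)) (fun i => f (p i)).
Proof.
rewrite rmorph_sum; apply: eq_bigr => i _; rewrite rmorph_sum; apply: eq_bigr => r _.
rewrite rmorph_sum; apply: eq_bigr => j _.
by rewrite !rmorphM !rmorphXn rmorph_prod rmorphN1.
Qed.

Lemma eq_residue (R : comNzRingType) (q p q' p' : nat -> R) :
  q =1 q' -> p =1 p' -> residue q p = residue q' p'.
Proof. by move=> /funext -> /funext ->. Qed.

(* First-order variation at p = x^(n-1), q = z x^(e-1). *)
Lemma residue_deriv (R : comNzRingType) (q p : nat -> {poly R}) z :
  (1 < n)%N ->
  (forall i, (i <= n)%N -> (p i)`_0 = (i == (n - 1)%N)%:R) ->
  (forall i, (i <= e)%N -> (q i)`_0 = if i == (e - 1)%N then z else 0) ->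
  (residue q p)`_1 = (-1) ^+ D * ((q e)`_1 - z * (p n)`_1).
Proof.
move=> n1 hp hq; rewrite residueE.
have D0 : (0 < D)%N by rewrite /D; lia.
have coefM1 (x y : {poly R}) : (x * y)`_1 = x`_0 * y`_1 + x`_1 * y`_0.
  by rewrite coefM big_ord_recl big_ord_recl big_ord0 /= addr0 /bump /=.
have coefX0 (x : {poly R}) k : (x ^+ k)`_0 = x`_0 ^+ k.
  by rewrite -!horner_coef0 horner_exp.
have pn0 : (p n)`_0 = 0 by rewrite hp //; case: eqP => //; lia.
have pn1 : (p (n - 1)%N)`_0 = 1 by rewrite hp ?leq_subr // eqxx.
have pnX k : (1 < k)%N -> (p n ^+ k)`_1 = 0.
  case: k => [|[|k]] // _; rewrite exprS coefM1 pn0 mul0r add0r exprS.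
  by rewrite coefM big_ord_recl big_ord0 /= pn0 mul0r addr0 mulr0.
(* At parameter 0 the tail of p = x^(n-1) is t, and the series reduces to (-1)^D t^D. *)
have B0 k : (k <= D)%N -> ((inv_series p)`_k)`_0 = if k == D then (-1) ^+ D else 0.
  move=> kD; rewrite coef_sum coef_sum big_ord_recr /= big1 ?add0r.
    rewrite coefZ subnn expr0 mulr1; case: eqP => [->|/eqP kD'].
      by rewrite rev_tail_diag coef_signM coefX0 pn1 expr1n mulr1.
    by rewrite rev_tail_lt ?mulr0 ?coef0 // ltn_neqAle kD' kD.
  move=> r _; rewrite coefZ -mulrA coef_signM.
  rewrite coefM big_ord_recl big_ord0 coefX0 pn0 expr0n subn_eq0 leqNgt ltn_ord /=.
  by rewrite mul0r addr0 mulr0.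
(* To first order, the coefficient of t^(D-1) sees only r = D - 1, the term with p_n to the first
   power. *)
have B1 : ((inv_series p)`_(D - 1))`_1 = - (-1) ^+ D * (p n)`_1.
  have [D' DE] : exists D', D = D'.+1 by exists D.-1; rewrite prednK.
  rewrite !coef_sum DE subn1 /= big_ord_recr /= big_ord_recr /= big1 ?add0r.
    rewrite !coefZ (@rev_tail_lt _ _ D'.+1) // mulr0 coef0 addr0 rev_tail_diag subSnn expr1.
    rewrite -mulrA coef_signM coefM1 pn0 mul0r add0r coefX0 pn1 expr1n.
    by rewrite mulr1 [in RHS]exprS mulN1r opprK.
  move=> r _; rewrite coefZ -mulrA coef_signM coefM1 coefX0 pn0 expr0n.
  have rD : (r < D')%N := ltn_ord r.
  rewrite pnX ?mul0r; last by lia.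
  rewrite (_ : (D'.+1 - r == 0)%N = false) ?mul0r ?addr0 ?mulr0 //.
  by apply/eqP; lia.
rewrite coef_sum big_nat_recr /=; last by lia.
have [e' eE] : exists e', e = e'.+1 by exists e.-1; rewrite prednK; lia.
rewrite {1}eE big_nat_recr /=; last by lia.
rewrite big_nat_cond big1 ?add0r; last first.
  move=> i /andP[/andP[ni ie] _]; rewrite coefM1 hq; last by lia.
  rewrite (_ : (i == _) = false) ?mul0r ?add0r; last by apply/eqP; lia.
  rewrite B0; last by rewrite /D; lia.
  by rewrite (_ : (_ == D) = false) ?mulr0 //; apply/eqP; rewrite /D; lia.
rewrite !coefM1 hq; last by lia.
rewrite (_ : (e' == _) = true); last by apply/eqP; lia.
have -> : (e' - (n - 1) = D - 1)%N by rewrite /D; lia.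
rewrite hq // (_ : (e == _) = false); last by apply/eqP; lia.
rewrite -/D !B0 ?leq_subr // eqxx B1 (_ : (_ == D) = false); last by apply/eqP; lia.
ring.
Qed.

Section Field.
Variable K : numFieldType.
Implicit Types (p q : {poly K}).

(** The multiple of p contributes 0 by [residue_dvd]. Of the remainder only the coefficient of
    x^(n-1) is in range, paired with the constant term p_n^D of the series. *)
Lemma residue_modp p q : size p = n.+1 -> (size q <= e.+1)%N ->
  residue (fun i => q`_i) (fun i => p`_i) = p`_n ^+ D * (q %% p)`_(n - 1).
Proof.
move=> sp sq.
have pn0 : p != 0 by rewrite -size_poly_eq0 sp.
have : residue (fun i => (p * (q %/ p))`_i) (fun i => p`_i) = 0.
  apply: residue_dvd; first by rewrite sp.
  rewrite size_divp // sp /= /D. rewrite leq_subLR; apply: leq_trans sq _;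
    clear -n_gt0 n_le_e; lia.
rewrite !residueE => h.
have -> : \sum_(n - 1 <= i < e.+1) q`_i * (inv_series (fun i0 => p`_i0))`_(i - (n - 1)) =
    \sum_(n - 1 <= i < e.+1) (q %% p)`_i * (inv_series (fun i0 => p`_i0))`_(i - (n - 1)).
  rewrite -[RHS]add0r -[X in _ = X + _]h -big_split /=.
  by apply: eq_bigr => i _; rewrite {1}(divp_eq q p) coefD mulrDl [_ %/ _ * _]mulrC.
rewrite big_ltn; last by lia.
rewrite big_nat_cond big1 ?addr0; last first.
  move=> i /andP[/andP[ni ie] _]; rewrite nth_default ?mul0r //.
  have h2 : (size (q %% p)%R <= n)%N by rewrite -ltnS -sp ltn_modp.
  apply: leq_trans h2 _; clear -ni n_gt0; lia.
rewrite subnn mulrC; congr (_ * _).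
rewrite coef_sum big_ord_recl /= subn0 mul1r expr0 coefZ coefC eqxx mulr1 big1 ?addr0 //.
by move=> r _; rewrite coefZ rev_tail_lt ?mulr0.
Qed.

(** Translation of x commutes with Euclidean division and preserves p_n and the coefficient of
    x^(n-1) of a remainder of degree less than n. To get rid of the condition deg p = n, p is
    deformed to p + s x^n: both sides are polynomial in s and agree for s other than -p_n. *)
Lemma residue_shift p q c : (size p <= n.+1)%N -> (size q <= e.+1)%N ->
  residue (fun i => (q \Po ('X + c%:P))`_i) (fun i => (p \Po ('X + c%:P))`_i) =
  residue (fun i => q`_i) (fun i => p`_i).
Proof.
have sXc : size ('X + c%:P) = 2 by rewrite size_XaddC.
have sc (r : {poly K}) : size (r \Po ('X + c%:P)) = size r by rewrite size_comp_poly2.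
have gen (p1 : {poly K}) : size p1 = n.+1 -> (size q <= e.+1)%N ->
    residue (fun i => (q \Po ('X + c%:P))`_i) (fun i => (p1 \Po ('X + c%:P))`_i) =
    residue (fun i => q`_i) (fun i => p1`_i).
  move=> sp sq; rewrite !residue_modp ?sc //.
  have lc : lead_coef ('X + c%:P) = 1 by rewrite lead_coefXaddC.
  congr (_ ^+ _ * _).
    have := lead_coef_comp p1 (q := 'X + c%:P); rewrite sXc lc expr1n mulr1 => /(_ isT).
    by rewrite !lead_coefE sc sp.
  have -> : (q \Po ('X + c%:P)) %% (p1 \Po ('X + c%:P)) = (q %% p1) \Po ('X + c%:P).
    rewrite {1}(divp_eq q p1) comp_polyD comp_polyM modpD modp_mull add0r modp_small //.
    by rewrite !sc ltn_modp -size_poly_eq0 sp.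
  set r := q %% p1.
  have sr : (size r <= n)%N by rewrite -ltnS -sp ltn_modp -size_poly_eq0 sp.
  move: sr; rewrite leq_eqVlt => /orP[/eqP sr|sr]; last first.
    have sr2 : (size r <= n - 1)%N by rewrite -ltnS subn1 prednK.
    by rewrite !nth_default ?sc.
  have := lead_coef_comp r (q := 'X + c%:P); rewrite sXc lc expr1n mulr1 => /(_ isT).
  by rewrite !lead_coefE sc sr subn1.
move=> sp sq.
pose f (q1 p1 : {poly {poly K}}) := residue (fun i => q1`_i) (fun i => p1`_i).
pose P1 : {poly {poly K}} := map_poly polyC p + 'X%:P * 'X^n.
pose P2 : {poly {poly K}} := map_poly polyC (p \Po ('X + c%:P)) +
  'X%:P * map_poly polyC ('X^n \Po ('X + c%:P)).
pose E1 := f (map_poly polyC q) P1.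
pose E2 := f (map_poly polyC (q \Po ('X + c%:P))) P2.
have ev1 s : E1.[s] = residue (fun i => q`_i) (fun i => (p + s *: 'X^n)`_i).
  rewrite -/(horner_eval s _) residue_rmorph; apply: eq_residue => i /=.
    by rewrite coef_map /= /horner_eval hornerC.
  rewrite /P1 coefD coef_map /= coefCM coefXn /horner_eval hornerD hornerC coefD coefZ coefXn.
  by rewrite hornerM hornerX; case: eqP; rewrite hornerC.
have ev2 s : E2.[s] = residue (fun i => (q \Po ('X + c%:P))`_i)
    (fun i => ((p + s *: 'X^n) \Po ('X + c%:P))`_i).
  rewrite -/(horner_eval s _) residue_rmorph; apply: eq_residue => i /=.
    by rewrite coef_map /= /horner_eval hornerC.
  rewrite /P2 coefD coef_map /= coefCM coef_map /= /horner_eval hornerD hornerC.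
  by rewrite comp_polyD comp_polyZ coefD coefZ hornerM hornerX hornerC.
suff E12 : E1 = E2.
  have := ev2 0; rewrite -E12 ev1 scale0r addr0 => ->.
  by [].
apply/subr0_eq/(@poly_generic_eq0 _ _ ('X + (p`_n)%:P)).
  by rewrite -size_poly_eq0 size_XaddC.
move=> s _; rewrite hornerD hornerX hornerC => sn.
rewrite hornerD hornerN ev1 ev2 gen ?subrr //.
have s2 : (size (p + s *: 'X^n)%R <= n.+1)%N.
  rewrite (leq_trans (size_polyD _ _)) // geq_max sp.
  by rewrite (leq_trans (size_scale_leq _ _)) // size_polyXn.
apply/eqP; rewrite eqn_leq s2 /= ltnNge; apply/negP => /leq_sizeP/(_ n (leqnn n)).
by rewrite coefD coefZ coefXn eqxx mulr1 addrC; exact/eqP.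
Qed.

End Field.
End Residue.

(** * The equations as functions of the form *)

Lemma comp_homog (K : fieldType) m k d e (P : {mpoly K[m]}) (t : m.-tuple {mpoly K[k]}) :
  P \is d.-homog -> (forall i, tnth t i \is e.-homog) -> P \mPo t \is (d * e).-homog.
Proof.
move=> hP ht; rewrite comp_mpolyE big_seq; apply: rpred_sum => j jP; apply: rpredZ.
rewrite -(dhomog_mf hP jP) /= mdegE big_distrl /=.
by apply: prod_homog => i; rewrite mulnC; exact: dhomogMn.
Qed.

Section LinePolynomial.
Variables (K : numFieldType) (N : nat).
Implicit Types (a b : 'I_N -> K) (P Q : {mpoly K[N]}).

Definition linep a b : {mpoly K[N]} -> {poly K} :=
  mmap polyC (fun k => a k *: 'X + (b k)%:P).

HB.instance Definition _ a b := GRing.Additive.on (linep a b).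
HB.instance Definition _ a b := GRing.RMorphism.on (linep a b).

Lemma horner_linep a b P x : (linep a b P).[x] = P.@[fun k => a k * x + b k].
Proof.
rewrite /linep /mmap horner_sum mevalE; apply: eq_bigr => m _.
rewrite hornerM hornerC; congr (_ * _); rewrite /mmap1 horner_prod.
by apply: eq_bigr => i _; rewrite horner_exp !hornerE.
Qed.

Lemma linep_lin_forms (g : 'M[K]_N) a b P :
  linep a b (P \mPo lin_forms g) =
  linep (fun k => \sum_l g k l * a l) (fun k => \sum_l g k l * b l) P.
Proof.
apply: poly_fun_eq => x _; rewrite !horner_linep comp_mpoly_meval; apply: meval_eq => i.
rewrite tnth_mktuple raddf_sum mulr_suml -big_split; apply: eq_bigr => l _ /=.
by rewrite mevalZ mevalXU mulrDr mulrA.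
Qed.

Definition plane_tuple a b : N.-tuple {mpoly K[2]} :=
  [tuple a k *: 'X_ord0 + b k *: 'X_ord_max | k < N].

Lemma plane_tuple_homog a b i : tnth (plane_tuple a b) i \is 1.-homog.
Proof.
rewrite tnth_mktuple; apply: rpredD; apply: rpredZ; rewrite dhomogX;
  by apply/eqP; exact: mdeg1.
Qed.

Lemma linep_coef d a b P j : P \is d.-homog ->
  (P \mPo plane_tuple a b)@_[multinom [tuple j; (d - j)%N]] = (linep a b P)`_j.
Proof.
move=> hP; set B := P \mPo _.
have hB : B \is d.-homog.
  by rewrite -[d]muln1; apply: comp_homog => // i; exact: plane_tuple_homog.
have lE : linep a b P = \sum_(m <- msupp B) B@_m *: 'X^(m ord0).
  apply: poly_fun_eq => x _.
  have -> : (linep a b P).[x] = B.@[fun i => if i == ord0 then x else 1].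
    rewrite horner_linep comp_mpoly_meval; apply: meval_eq => i.
    by rewrite tnth_mktuple mevalD !mevalZ !mevalXU /= mulr1.
  rewrite mevalE horner_sum; apply: eq_bigr => m _; rewrite hornerZ hornerXn.
  by rewrite big_ord_recl big_ord1 /= expr1n mulr1.
rewrite lE coef_sum.
pose mj := [multinom [tuple j; (d - j)%N]].
have mj0 : mj ord0 = j by rewrite multinomE (tnth_nth 0%N).
have mj1 : mj ord_max = (d - j)%N by rewrite multinomE (tnth_nth 0%N).
rewrite -/mj.
have big0 : \sum_(m <- msupp B | m != mj) (B@_m *: 'X^(m ord0) : {poly K})`_j = 0.
  rewrite big_seq_cond big1 // => m /andP[mB mm]; rewrite coefZ coefXn.
  case: eqP => [jm|]; rewrite ?mulr0 //; case/eqP: mm; apply/mnmP => i.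
  have := dhomog_mf hB mB; rewrite /= mdegE big_ord_recl big_ord1 -jm => dm.
  have [->|i0] := eqVneq i ord0; first by rewrite mj0 jm.
  have -> : i = ord_max by apply: val_inj; case: i i0 => [[|[|//]]].
  rewrite mj1 -dm addKn; congr (m _); exact: val_inj.
case: (boolP (mj \in msupp B)) => mB.
  rewrite (bigD1_seq mj) ?msupp_uniq //= big0 addr0 coefZ coefXn mj0 eqxx.
  by rewrite mulr1.
rewrite (memN_msupp_eq0 mB); symmetry; apply: etrans big0.
rewrite [RHS]big_mkcond big_seq [RHS]big_seq.
by apply: eq_bigr => m mB'; case: eqP => // mE; rewrite -mE mB' in mB.
Qed.

Lemma linep_size d a b P : P \is d.-homog -> (size (linep a b P) <= d.+1)%N.
Proof.
move=> hP; apply/leq_sizeP => j dj; rewrite -(linep_coef _ _ _ hP).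
have hB : P \mPo plane_tuple a b \is d.-homog.
  by rewrite -[d]muln1; apply: comp_homog => // i; exact: plane_tuple_homog.
rewrite (dhomog_nemf_coeff hB) //= mdegE big_ord_recl big_ord1 !multinomE !(tnth_nth 0%N) /=.
by rewrite neq_ltn (leq_trans dj) ?leq_addr // orbT.
Qed.

End LinePolynomial.

Lemma lin_spanP (K : fieldType) (V : vectType K) (G : set (V -> K)) a F H :
  lin_span G F -> lin_span G H -> lin_span G (fun v => a * F v + H v).
Proof.
move=> [m [c [B [hB ->]]]] [m' [c' [B' [hB' ->]]]].
exists (m + m')%N, (fun i => match fintype.split i with inl j => a * c j | inr j => c' j end),
  (fun i => match fintype.split i with inl j => B j | inr j => B' j end); split.
  by move=> i; case: fintype.split.
apply/funext => v; rewrite big_split_ord /= mulr_sumr; congr (_ + _).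
  apply: eq_bigr => i _; rewrite -[lshift _ _]/(unsplit (inl i)) unsplitK.
  by rewrite mulrA.
by apply: eq_bigr => i _; rewrite -[rshift _ _]/(unsplit (inr i)) unsplitK.
Qed.

Section EFunctions.
Variables (K : numFieldType) (n : nat).
Notation N := (n * n)%N.
Notation W := 'M[K]_n.
Notation SW := (homform K N n).
Notation e := ((2 * n + 1) * (n - 2))%N.
Implicit Types (f : (2 * n + 1).-tuple W) (u v w : W) (P : SW) (g : 'M[K]_N).

Definition coordW w : 'I_N -> K := fun k => mxvec w ord0 k.

Definition actW g w : W := vec_mx ((g *m (mxvec w)^T)^T).

Lemma coord_actW g w k : coordW (actW g w) k = \sum_l g k l * coordW w l.
Proof. by rewrite /coordW vec_mxK !mxE; apply: eq_bigr => l _; rewrite mxE. Qed.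

Lemma dderivE w (p : {mpoly K[N]}) : dderiv w p = dirder (coordW w) p.
Proof. by []. Qed.

Lemma hess_det_homog f (p : {mpoly K[N]}) : p \is n.-homog -> hess_det f p \is e.-homog.
Proof.
move=> hp; apply: rpred_sum => s _; rewrite rpredMsign.
have -> : e = (\sum_(i < 2 * n + 1) (n - 2))%N by rewrite sum_nat_const card_ord.
apply: prod_homog => i; rewrite mxE !dderivE subn2.
by apply: dirder_homog; exact: dirder_homog.
Qed.

Lemma E_funE f u v P : E_fun f u v P =
  residue n e (fun i => (linep (coordW u) (coordW v) (hess_det f P))`_i)
    (fun j => (linep (coordW u) (coordW v) (mpoly_of_dhomog P))`_j).
Proof.
apply: (@eq_residue n e _ (plane_coef e u v (hess_det f P)) (plane_coef n u v P)) => j.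
  by apply: linep_coef; apply: hess_det_homog; exact: dhomog_is_dhomog.
by apply: linep_coef; exact: dhomog_is_dhomog.
Qed.

Lemma hess_det_lin f g (p : {mpoly K[N]}) :
  hess_det f (p \mPo lin_forms g) = hess_det (map_tuple (actW g) f) p \mPo lin_forms g.
Proof.
rewrite /hess_det -det_map_mx; congr (\det _); apply/matrixP => i j; rewrite !mxE /=.
rewrite !dderivE !dirder_lin !tnth_map; congr (_ \mPo _).
have h w : (fun k => \sum_l g k l * coordW w l) = coordW (actW g w).
  by apply/funext => k; rewrite coord_actW.
by rewrite !h.
Qed.

(** Equivariance of the family of equations: the chain rule moves [g] from the form to the vectors.
    This is what makes [V_n] a submodule. *)
Lemma E_fun_precomp f u v g P :
  E_fun f u v (precomp g P) = E_fun (map_tuple (actW g) f) (actW g u) (actW g v) P.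
Proof.
rewrite !E_funE /= hess_det_lin !linep_lin_forms.
have h w : (fun k => \sum_l g k l * coordW w l) = coordW (actW g w).
  by apply/funext => k; rewrite coord_actW.
by rewrite !h.
Qed.

Lemma mxvec_actW g w : mxvec (actW g w) = mxvec w *m g^T.
Proof. by rewrite vec_mxK trmx_mul trmxK. Qed.

Lemma actW_is_linear g : linear (actW g).
Proof.
move=> a w1 w2; apply: (can_inj mxvecK).
by rewrite mxvec_actW linearP /= mulmxDl -scalemxAl -!mxvec_actW -linearP.
Qed.

HB.instance Definition _ g := GRing.isLinear.Build K W W _ (actW g) (actW_is_linear g).

Lemma actW_mul g h w : actW g (actW h w) = actW (g *m h) w.
Proof. by apply: (can_inj mxvecK); rewrite !mxvec_actW trmx_mul mulmxA. Qed.

Lemma actW1 w : actW 1%:M w = w.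
Proof. by apply: (can_inj mxvecK); rewrite mxvec_actW trmx1 mulmx1. Qed.

Lemma actW_inj g : g \in unitmx -> injective (actW g).
Proof. by move=> gu; apply: (can_inj (g := actW (invmx g))) => w;
  rewrite actW_mul mulVmx ?actW1. Qed.

Lemma free_actW m g (X : m.-tuple W) :
  g \in unitmx -> free X -> free (map_tuple (actW g) X).
Proof.
move=> gu /freeP fX; apply/freeP => k hk; apply: fX; apply: (actW_inj gu).
rewrite linear0 linear_sum -[RHS]hk; apply: eq_bigr => i _.
by rewrite linearZ /= (nth_map 0) // size_tuple.
Qed.

Lemma mpoly_of_dhomog_gam :
  gam (@homog_fun K SW) 1 (fun P : SW => mpoly_of_dhomog P).
Proof. by move=> m; exact: mcoeff_homog_fun. Qed.

Lemma dirder_gam (A : nat -> (SW -> K) -> Prop) (gA : graded_alg A) d a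
    (Phi : SW -> {mpoly K[N]}) :
  gam A d Phi -> gam A d (fun x => dirder a (Phi x)).
Proof.
move=> h; apply: gam_sum => // k _; rewrite -[d]add0n.
by apply: gamZ; [|exact: ga_cst|exact: gam_mderiv].
Qed.

Lemma plane_coef_homog u v j :
  @homog_fun K SW 1 (fun P => plane_coef n u v (mpoly_of_dhomog P) j).
Proof.
have gA := @homog_fun_graded K SW.
have := @gam_comp _ _ _ gA N 2 1 0 (fun P : SW => mpoly_of_dhomog P)
  (fun k _ => coordW u k *: 'X_ord0 + coordW v k *: 'X_ord_max) n.
rewrite muln0 addn0 => h; apply: (h _ _ _) => [P||k].
- exact: dhomog_is_dhomog.
- exact: mpoly_of_dhomog_gam.
exact: gam_cst.
Qed.

Lemma hess_coef_homog f u v j :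
  @homog_fun K SW (2 * n + 1) (fun P => plane_coef e u v (hess_det f P) j).
Proof.
have gA := @homog_fun_graded K SW.
have := @gam_comp _ _ _ gA N 2 (2 * n + 1) 0 (fun P : SW => hess_det f P)
  (fun k _ => coordW u k *: 'X_ord0 + coordW v k *: 'X_ord_max) e.
rewrite muln0 addn0 => h; apply: (h _ _ _) => [P||k].
- by apply: hess_det_homog; exact: dhomog_is_dhomog.
- rewrite -[(2 * n + 1)%N]muln1; apply: gam_det => // a b.
  apply: (gam_ext (Phi := fun P : SW => dirder (coordW (tnth f a))
    (dirder (coordW (tnth f b)) (mpoly_of_dhomog P)))) => [P|].
    by rewrite mxE.
  by do 2!apply: dirder_gam => //; exact: mpoly_of_dhomog_gam.
exact: gam_cst.
Qed.

Lemma E_fun_homog f u v : (3 <= n)%N -> @homog_fun K SW (2 * n * (n - 1)) (E_fun f u v).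
Proof.
move=> n3; have gA := @homog_fun_graded K SW.
have hp := plane_coef_homog u v; have hq := hess_coef_homog f u v.
apply: (ga_ext (f := fun P : SW => \sum_(n - 1 <= i < e.+1 | (n - 1 <= i < e.+1)%N)
   \sum_(r < (i - (n - 1)).+1) \sum_(j : {ffun 'I_r -> 'I_n.+1} |
         [forall s, 0 < j s]%N && (\sum_s j s == i - (n - 1))%N)
     (-1) ^+ r * plane_coef e u v (hess_det f P) i *
     (\prod_s plane_coef n u v (mpoly_of_dhomog P) (n - j s)%N) *
     plane_coef n u v (mpoly_of_dhomog P) n ^+ (e - (n - 1) - r))) => [P|].
  by rewrite -big_nat.
apply: ga_sum => // i /andP[ni ie]; apply: ga_sum => // r _; apply: ga_sum => // j _.
(* Degree 2n + 1 comes from the Hessian determinant, r from the product of the p's, and D - r from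
   the power of p_n, with D = e - (n - 1) = 2n^2 - 4n - 1. *)
have -> : (2 * n * (n - 1) = 2 * n + 1 + r + (e - (n - 1) - r) * 1)%N.
  have := ltn_ord r; nia.
apply: (gaM gA); last exact: ga_exp.
apply: (gaM gA); first exact: gaZ.
rewrite -[X in @homog_fun _ _ X](card_ord r) -sum1_card.
exact: ga_prod.
Qed.

Lemma V_n_homog : (3 <= n)%N -> @V_n K n `<=` @homog_fun K SW (2 * n * (n - 1)).
Proof.
move=> n3 F [m [c [B [hB ->]]]]; have gA := @homog_fun_graded K SW.
apply: ga_sum => // i _; apply: gaZ => //.
by have [f [u [v [_ _ ->]]]] := hB i; exact: E_fun_homog.
Qed.

Lemma V_n_submodule : gl_submodule (@V_n K n).
Proof.
split.
- exists 0%N, (fun=> 0), (fun=> cst 0); split=> [[]//|]; apply/funext => v.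
  by rewrite big_ord0.
- by move=> a F G; exact: lin_spanP.
move=> g F gu [m [c [B [hB ->]]]].
exists m, c, (fun i => act_fun g (B i)); split=> //.
move=> i; have [f [u [v [ff fuv ->]]]] := hB i.
exists (map_tuple (actW g) f), (actW g u), (actW g v); split.
- exact: free_actW.
- exact: (@free_actW 2 g [tuple u; v]).
by apply/funext => P; rewrite act_funE E_fun_precomp.
Qed.

End EFunctions.

(** * Vanishing on the orbit of the determinant *)

Section DetPolynomial.
Variables (K : numFieldType) (n : nat).
Notation N := (n * n)%N.
Notation W := 'M[K]_n.
Notation PW := {mpoly K[N]}.

Definition genmx : 'M[PW]_n := \matrix_(i, j) 'X_(mxvec_index i j).

Lemma coordWE (A : W) i j : coordW A (mxvec_index i j) = A i j.
Proof. by rewrite /coordW mxvecE. Qed.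

Lemma eval_genmx (A : W) : map_mx (meval (coordW A)) genmx = A.
Proof. by apply/matrixP => i j; rewrite !mxE mevalXU coordWE. Qed.

Lemma eval_det (A : W) : (det_poly K n).@[coordW A] = \det A.
Proof. by rewrite /det_poly -det_map_mx -/genmx eval_genmx. Qed.

Lemma pt_coordW (w : 'cV[K]_N) : pt w = coordW (vec_mx w^T).
Proof. by apply/funext => k; rewrite /coordW vec_mxK mxE. Qed.

Lemma coordW_lin (a : K) (A B : W) : coordW (a *: A + B) = fun k => a * coordW A k + coordW B k.
Proof. by apply/funext => k; rewrite /coordW linearP /= !mxE. Qed.

Lemma form_extW d (P Q : homform K N d) :
  (forall A : W, (mpoly_of_dhomog P).@[coordW A] = (mpoly_of_dhomog Q).@[coordW A]) -> P = Q.
Proof. by move=> h; apply: form_ext => w; rewrite pt_coordW. Qed.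

Lemma evalW_lin_forms (g : 'M[K]_N) (A : W) (p : PW) :
  (p \mPo lin_forms g).@[coordW A] = p.@[coordW (actW g A)].
Proof.
rewrite comp_mpoly_meval; apply: meval_eq => k; rewrite tnth_mktuple raddf_sum coord_actW.
by apply: eq_bigr => l _ /=; rewrite mevalZ mevalXU.
Qed.

Lemma linep_det (u v : W) x : (linep (coordW u) (coordW v) (det_poly K n)).[x] =
  \det (x *: u + v).
Proof.
rewrite horner_linep -eval_det; apply: meval_eq => k.
by rewrite coordW_lin mulrC.
Qed.

Lemma eval_hess (f : (2 * n + 1).-tuple W) (p : PW) (A : W) :
  (hess_det f p).@[coordW A] = \det (\matrix_(i, j)
    (dirder (coordW (tnth f i)) (dirder (coordW (tnth f j)) p)).@[coordW A]).
Proof.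
rewrite /hess_det -det_map_mx; congr (\det _).
by apply/matrixP => i j; rewrite !mxE.
Qed.

(* If c A = 0 with c_i != 0, then c_i det = sum_j (c X)_j cof_ij exhibits the   *)
(* Hessian of det at A as L Psi^T + Psi L^T, where L has only n columns.        *)
Lemma hess_det_singular (f : (2 * n + 1).-tuple W) (A : W) :
  \det A = 0 -> (hess_det f (det_poly K n)).@[coordW A] = 0.
Proof.
move=> /eqP/det0P[c cn0 cA0]; rewrite eval_hess.
have [i ci] : exists i, c 0 i != 0 by apply/rV0Pn.
pose y j : PW := \sum_k c 0 k *: genmx k j.
have detE : c 0 i *: det_poly K n = \sum_j y j * cofactor genmx i j.
  have h k : (genmx *m \adj genmx) k i = (det_poly K n) *+ (k == i).
    by rewrite mul_mx_adj mxE.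
  transitivity (\sum_k c 0 k *: ((genmx *m \adj genmx) k i)).
    rewrite (bigD1 i) //= h eqxx big1 ?addr0 // => k ki.
    by rewrite h (negPf ki) scaler0.
  under eq_bigr do rewrite mxE scaler_sumr.
  rewrite exchange_big; apply: eq_bigr => j _; rewrite mulr_suml; apply: eq_bigr => k _.
  by rewrite [(\adj _) j i]mxE scalerAl.
have dy B j : dirder (coordW B) (y j) = ((c *m B) 0 j)%:MP.
  rewrite linear_sum mxE rmorph_sum; apply: eq_bigr => k _.
  by rewrite linearZ /= mxE dirderX coordWE -mul_mpolyC -rmorphM.
have ey j : (y j).@[coordW A] = 0.
  rewrite raddf_sum /= -[RHS](_ : (c *m A) 0 j = 0); last by rewrite cA0 mxE.
  rewrite mxE; apply: eq_bigr => k _; by rewrite mevalZ mxE mevalXU coordWE.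
pose L : 'M[K]_(2 * n + 1, n) := \matrix_(a, j) (c *m tnth f a) 0 j.
pose Psi : 'M[K]_(2 * n + 1, n) := \matrix_(a, j)
  (dirder (coordW (tnth f a)) (cofactor genmx i j)).@[coordW A].
set H := \matrix_(_, _) _.
have HE : c 0 i *: H = L *m Psi^T + Psi *m L^T.
  apply/matrixP => a b; rewrite mxE [H a b]mxE -mevalZ -!linearZ detE.
  rewrite (linear_sum (dirder (coordW (tnth f b)))) (linear_sum (dirder (coordW (tnth f a)))).
  rewrite (raddf_sum (meval _)) !mxE -big_split; apply: eq_bigr => j _ /=.
  rewrite [L a j]mxE [L^T j b]mxE [L b j]mxE [Psi a j]mxE [Psi^T j b]mxE [Psi b j]mxE.
  set cf := cofactor genmx i j.
  rewrite dirderM dy linearD /= !dirderM dirderC dy mul0r add0r.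
  rewrite !mevalD !mevalM !mevalC ey mul0r addr0; ring.
have : \rank (c 0 i *: H) != (2 * n + 1)%N.
  rewrite HE -mul_row_col neq_ltn (leq_ltn_trans (mulmx_max_rank _ _)) //.
  by rewrite addn1 ltnS mul2n addnn.
rewrite -[X in _ != X]/(2 * n + 1)%N => hr.
have : (c 0 i *: H) \notin unitmx by rewrite -row_free_unit /row_free.
rewrite unitmxE detZ unitfE negbK mulf_eq0 expf_eq0 (negPf ci) andbF /=.
by move=> /eqP.
Qed.

End DetPolynomial.

Section OrbitEquations.
Variables (C : numClosedFieldType) (n : nat).
Notation N := (n * n)%N.
Notation W := 'M[C]_n.
Notation SW := (homform C N n).
Notation e := ((2 * n + 1) * (n - 2))%N.
Implicit Types (f : (2 * n + 1).-tuple W) (u v w : W).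

(** A root of p is a singular matrix on the line, where [hess_det_singular] applies. The roots being
    simple, p divides q, and [residue_dvd] concludes. *)
Lemma E_det_separable f u v : (3 <= n)%N ->
  let p := linep (coordW u) (coordW v) (det_poly C n) in
  size p = n.+1 -> coprimep p p^`() -> E_fun f u v (det_form C n) = 0.
Proof.
move=> n3 p sp cp; rewrite E_funE /=; set q := linep _ _ (hess_det _ _).
have sq : (size q <= e.+1)%N.
  by apply: linep_size; apply: hess_det_homog; exact: det_poly_homog.
have pn0 : p != 0 by rewrite -size_poly_eq0 sp.
have dvd : p %| q.
  have [rs prs] := closed_field_poly_normal p.
  have lp : lead_coef p != 0 by rewrite lead_coef_eq0.
  rewrite prs dvdpZl //; apply: uniq_roots_dvdp.
    apply/allP => r rr; have : root p r.
      by rewrite prs rootZ // root_prod_XsubC.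
    rewrite /root linep_det => /eqP h; rewrite horner_linep.
    have -> : (fun k => coordW u k * r + coordW v k) = coordW (r *: u + v).
      by rewrite coordW_lin; apply/funext => k; rewrite mulrC.
    by rewrite hess_det_singular.
  rewrite uniq_rootsE -separable_prod_XsubC unlock.
  move: cp; rewrite prs derivZ coprimepZl // coprimepZr //.
rewrite -/p -(divpK dvd) mulrC; have ne : (n <= e)%N by clear -n3; nia.
apply: residue_dvd => //; [by lia|by rewrite sp|].
rewrite size_divp // sp /= leq_subLR; apply: leq_trans sq _; clear -n3; nia.
Qed.

(** At s = 0 the polynomial is det(x + diag(1,..,n)), with simple roots -1, ..., -n. Its leading
    coefficient and its resultant with its derivative are thus nonzero as polynomials in s, and [c]
    is their product. *)
Lemma generic_separable (u1 v1 : W) : (0 < n)%N ->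
  exists2 c : {poly C}, c != 0 & forall s, c.[s] != 0 ->
    let p := linep (coordW (1%:M + s *: u1))
      (coordW ((\matrix_(i, j) (i.+1%:R *+ (i == j))) + s *: v1)) (det_poly C n) in
    size p = n.+1 /\ coprimep p p^`().
Proof.
move=> n0; set v0 := \matrix_(i, j) _.
pose ps s := linep (coordW (1%:M + s *: u1)) (coordW (v0 + s *: v1)) (det_poly C n).
(* The outer variable is x, the inner one is s. *)
pose M : 'M[{poly {poly C}}]_n := \matrix_(i, j)
  ('X * ((1%:M : W) i j)%:P%:P + 'X * (u1 i j *: 'X)%:P + (v0 i j)%:P%:P + (v1 i j *: 'X)%:P).
pose pp := \det M.
have ppE s : map_poly (horner_eval s) pp = ps s.
  apply: poly_fun_eq => x _; rewrite linep_det -det_map_mx.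
  rewrite -/(horner_eval x _) -det_map_mx; congr (\det _); apply/matrixP => i j.
  rewrite !mxE !rmorphD !rmorphM /= !map_polyX !map_polyC /= /horner_eval.
  rewrite !(hornerC, hornerX, hornerZ); ring.
have psize s : (size (ps s) <= n.+1)%N by apply: linep_size; exact: det_poly_homog.
have ps0 : ps 0 = \prod_(i < n) ('X - (- i.+1%:R)%:P).
  apply: poly_fun_eq => x _; rewrite linep_det !scale0r !addr0 horner_prod.
  rewrite det_trig; last first.
    by apply/is_trig_mxP => i j ij; rewrite !mxE -val_eqE (ltn_eqF ij) /= !mulr0 add0r.
  by apply: eq_bigr => i _; rewrite !mxE eqxx mulr1 !hornerE opprK.
have sz0 : size (ps 0) = n.+1.
  by rewrite ps0 size_prod_XsubC /index_enum -enumT size_enum_ord.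
have ln0 : (pp`_n).[0] = 1.
  have := congr1 (fun q : {poly C} => q`_n) (ppE 0); rewrite coef_map /= /horner_eval => ->.
  have : lead_coef (ps 0) = 1 by rewrite ps0 lead_coef_prod_XsubC.
  by rewrite lead_coefE sz0.
have nn0 : pp`_n != 0.
  by apply: contra_eq_neq ln0 => ->; rewrite horner0 eq_sym oner_neq0.
have spp : size pp = n.+1.
  apply/eqP; rewrite eqn_leq; apply/andP; split; last first.
    rewrite ltnNge; apply/negP => /leq_sizeP/(_ n (leqnn n))/eqP.
    by rewrite (negPf nn0).
  apply/leq_sizeP => j nj; apply: poly_fun_eq => s _; rewrite horner0.
  have := congr1 (fun q : {poly C} => q`_j) (ppE s); rewrite coef_map /= /horner_eval => ->.
  by rewrite nth_default // (leq_trans (psize s)).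
have lpp : lead_coef pp = pp`_n by rewrite lead_coefE spp.
have dn : (pp^`())`_n.-1 = pp`_n *+ n by rewrite coef_deriv prednK.
have dnn0 : (pp^`())`_n.-1 != 0.
  rewrite dn -scaler_nat scaler_eq0 negb_or nn0 andbT.
  by rewrite pnatr_eq0 -lt0n.
have sdp : size pp^`() = n.
  apply/eqP; rewrite eqn_leq; apply/andP; split.
    by rewrite -ltnS -spp lt_size_deriv // -size_poly_eq0 spp.
  rewrite -(prednK n0) ltnNge; apply/negP => /leq_sizeP/(_ _ (leqnn _))/eqP.
  by rewrite (negPf dnn0).
have ldp : lead_coef pp^`() = pp`_n *+ n by rewrite lead_coefE sdp dn.
have res s : (pp`_n).[s] != 0 ->
    (resultant pp pp^`()).[s] = resultant (ps s) (ps s)^`().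
  move=> ls; rewrite -ppE deriv_map -map_resultant //=.
    by rewrite /horner_eval lpp.
  by rewrite /horner_eval ldp hornerMn -mulr_natl mulf_neq0 // pnatr_eq0 -lt0n.
exists (pp`_n * resultant pp pp^`()).
  suff : (pp`_n * resultant pp pp^`()).[0] != 0.
    by apply: contraNneq => ->; rewrite horner0.
  rewrite hornerM ln0 mul1r res ?ln0 ?oner_neq0 // resultant_eq0 -leqNgt.
  suff : coprimep (ps 0) (ps 0)^`() by rewrite /coprimep => /eqP ->.
  have sepE (q : {poly C}) : coprimep q q^`() = separable_poly q by rewrite unlock.
  rewrite sepE ps0.
  rewrite -(big_map (fun i : 'I_n => - i.+1%:R) predT (fun x => 'X - x%:P)) /=.
  rewrite separable_prod_XsubC map_inj_uniq ?index_enum_uniq // => i j /oppr_inj/eqP.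
  by rewrite eqr_nat eqSS => /eqP/val_inj.
move=> s; rewrite hornerM mulf_eq0 negb_or => /andP[ls rs]; rewrite -/(ps s); split.
  apply/eqP; rewrite eqn_leq psize ltnNge; apply/negP => /leq_sizeP/(_ n (leqnn n))/eqP.
  by rewrite -ppE coef_map /= /horner_eval (negPf ls).
move: rs; rewrite res // resultant_eq0 -leqNgt /coprimep.
rewrite leq_eqVlt ltnS leqn0 size_poly_eq0 gcdp_eq0 => /orP[//|/andP[/eqP ps00 _]].
by move: ls; have := ppE s; rewrite ps00 => /(congr1 (fun q : {poly C} => q`_n));
   rewrite coef_map /= /horner_eval coef0 => ->; rewrite eqxx.
Qed.

(** A matrix [h] takes u, v to 1 and diag(1,..,n). On the segment from [h] to [g] the equation is a
    polynomial in s with generic value 0, and [g] is reached at s = 1. Singular [g] are included, so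
    the result applies to the whole curve 1 + sX in [dform_tangent]. *)
Lemma E_orbit f u v (g : 'M[C]_N) : (3 <= n)%N -> free [:: u; v] ->
  E_fun f u v (precomp g (det_form C n)) = 0.
Proof.
move=> n3 fuv; pose v0 : W := \matrix_(i, j) (i.+1%:R *+ (i == j)).
have [h hu hv] : exists2 h : 'M[C]_N, actW h u = 1%:M & actW h v = v0.
  pose B := col_mx (mxvec u) (mxvec v).
  have fB : row_free B.
    rewrite -kermx_eq0; apply/rowV0P => c /sub_kermxP.
    rewrite -[c]hsubmxK mul_row_col [lsubmx c]mx11_scalar [rsubmx c]mx11_scalar.
    rewrite !mul_scalar_mx => hc.
    have /freeP := fuv.
    move=> /(_ (fun i : 'I_2 => if i == ord0 then lsubmx c 0 0 else rsubmx c 0 0)).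
    rewrite big_ord_recl big_ord1 /= => hf.
    have /hf{hf} hf : lsubmx c 0 0 *: u + rsubmx c 0 0 *: v = 0.
      by apply: (can_inj mxvecK); rewrite linear0 linearD !linearZ.
    have := hf ord0; have := hf ord_max; rewrite /= => -> ->.
    by rewrite !raddf0 row_mx0.
  exists (pinvmx B *m col_mx (mxvec 1%:M) (mxvec v0))^T.
    apply: (can_inj mxvecK); rewrite mxvec_actW trmxK mulmxA.
    have : B *m pinvmx B *m col_mx (mxvec 1%:M) (mxvec v0) = col_mx (mxvec 1%:M) (mxvec v0).
      by rewrite mulmxVp // mul1mx.
    by rewrite !mul_col_mx => /eq_col_mx[].
  apply: (can_inj mxvecK); rewrite mxvec_actW trmxK mulmxA.
  have : B *m pinvmx B *m col_mx (mxvec 1%:M) (mxvec v0) = col_mx (mxvec 1%:M) (mxvec v0).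
    by rewrite mulmxVp // mul1mx.
  by rewrite !mul_col_mx => /eq_col_mx[].
have [r _ hr] := homog_fun_precomp_curve h (g - h) (det_form C n) (E_fun_homog f u v n3).
suff r0 : r = 0.
  by have := hr 1; rewrite r0 horner0 scale1r addrC subrK.
have [|c cn0 hc] := @generic_separable (actW (g - h) u) (actW (g - h) v); first by lia.
apply: (poly_generic_eq0 cn0) => s _ /hc[sp cp].
have actWD (w : W) : actW (h + s *: (g - h)) w = actW h w + s *: actW (g - h) w.
  apply: (can_inj mxvecK); rewrite mxvec_actW [RHS]linearD /= linearZ /= !mxvec_actW.
  by rewrite [(h + _)^T]linearD /= [(s *: _)^T]linearZ /= mulmxDr -scalemxAr.
by rewrite -hr E_fun_precomp !actWD hu hv; apply: E_det_separable.
Qed.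

End OrbitEquations.

(** * The Fischer inner product *)

Section HermitianProjection.
Variable C : numClosedFieldType.

Definition adjmx m n (A : 'M[C]_(m, n)) : 'M[C]_(n, m) := (map_mx Num.conj A)^T.

Lemma adjmxM m n p (A : 'M[C]_(m, n)) (B : 'M[C]_(n, p)) :
  adjmx (A *m B) = adjmx B *m adjmx A.
Proof. by rewrite /adjmx map_mxM trmx_mul. Qed.

Lemma adjmxK m n (A : 'M[C]_(m, n)) : adjmx (adjmx A) = A.
Proof. by apply/matrixP => i j; rewrite !mxE conjCK. Qed.

Lemma adjmx_unit n (A : 'M[C]_n) : (adjmx A \in unitmx) = (A \in unitmx).
Proof. by rewrite unitmx_tr map_unitmx. Qed.

Lemma adjmx_trig n (A : 'M[C]_n) : is_trig_mx A -> is_trig_mx (adjmx A)^T.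
Proof.
move=> /is_trig_mxP h; apply/is_trig_mxP => i j ij.
by rewrite trmxK mxE h // rmorph0.
Qed.

Definition hdot m (x y : 'rV[C]_m) : C := (x *m adjmx y) 0 0.

Lemma hdotE m (x y : 'rV[C]_m) : hdot x y = \sum_i x 0 i * (y 0 i)^*.
Proof. by rewrite /hdot mxE; apply: eq_bigr => i _; rewrite !mxE. Qed.

Lemma hdot_eq0 m (x : 'rV[C]_m) : hdot x x = 0 -> x = 0.
Proof.
rewrite hdotE => /eqP; rewrite psumr_eq0 => [/allP h|i _]; last exact: mul_conjC_ge0.
apply/rowP => i; rewrite mxE; apply/eqP.
by have := h i (mem_index_enum i); rewrite mul_conjC_eq0.
Qed.

Lemma hdot_deltal m i (y : 'rV[C]_m) : hdot (delta_mx 0 i) y = (y 0 i)^*.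
Proof.
rewrite hdotE (bigD1 i) //= mxE !eqxx mul1r big1 ?addr0 // => k /negPf ki.
by rewrite mxE ki andbF mul0r.
Qed.

Lemma hdot_deltar m i (x : 'rV[C]_m) : hdot x (delta_mx 0 i) = x 0 i.
Proof.
rewrite hdotE (bigD1 i) //= mxE !eqxx rmorph1 mulr1 big1 ?addr0 // => k /negPf ki.
by rewrite mxE ki andbF rmorph0 mulr0.
Qed.

Lemma subspace_matrix (K : fieldType) m (U : 'rV[K]_m -> Prop) :
  U 0 -> (forall a x y, U x -> U y -> U (a *: x + y)) ->
  exists A : 'M[K]_m, forall v, U v <-> (v <= A)%MS.
Proof.
move=> U0 UP.
pose Q r := `[< exists A : 'M[K]_m, \rank A = r /\ forall v, (v <= A)%MS -> U v >].
have exQ : exists r, Q r.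
  exists 0%N; apply/asboolP; exists 0; rewrite mxrank0; split=> // v.
  by rewrite submx0 => /eqP ->.
have ubQ r : Q r -> (r <= m)%N by move=> /asboolP[A [<- _]]; exact: rank_leq_row.
case: (ex_maxnP exQ ubQ) => r /asboolP[A [rA hA]] rmax; exists A => v; split=> [Uv|];
  last exact: hA.
apply: contrapT => /negP vA.
have : Q (\rank (A + v)%MS).
  apply/asboolP; exists (A + v)%MS; split=> // w /sub_addsmxP[[x y] /= ->].
  rewrite [y]mx11_scalar mul_scalar_mx addrC; apply: UP => //.
  by apply: hA; exact: submxMl.
move=> /rmax; rewrite -rA leqNgt => /negP; apply.
have : (A < A + v)%MS.
  rewrite ltmxE addsmxSl /=; apply: contra vA => h.
  by apply: submx_trans h; exact: addsmxSr.
exact: rank_ltmx.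
Qed.

Lemma hermitian_projection m (U : 'rV[C]_m -> Prop) v :
  U 0 -> (forall a x y, U x -> U y -> U (a *: x + y)) ->
  exists x y, [/\ v = x + y, U x & forall z, U z -> hdot y z = 0].
Proof.
move=> U0 UP; have [A hA] := subspace_matrix U0 UP.
(* Orthogonal projection by normal equations; the Gram matrix is invertible because the product is
   definite. *)
pose B := row_base A; pose G := B *m adjmx B.
have uG : G \in unitmx.
  rewrite -row_free_unit -kermx_eq0; apply/rowV0P => c /sub_kermxP hc.
  have : hdot (c *m B) (c *m B) = 0.
    by rewrite /hdot adjmxM mulmxA -[c *m B *m _]mulmxA hc mul0mx mxE.
  move=> /hdot_eq0 cB; have := row_base_free A; rewrite -/B => /row_free_inj.
  by move=> /(_ _ c 0); rewrite mul0mx => ->.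
pose x := v *m adjmx B *m invmx G *m B.
have eqAB : (A :=: B)%MS by apply: eqmx_sym; exact: eq_row_base.
exists x, (v - x); split; first by rewrite addrC subrK.
  by apply/hA; rewrite eqAB submxMl.
move=> z /hA; rewrite eqAB => /submxP[c ->].
rewrite /hdot adjmxM mulmxA mulmxBl /x -[_ *m B *m adjmx B]mulmxA -/G.
by rewrite mulmxKV // subrr mul0mx mxE.
Qed.

End HermitianProjection.

Section Fischer.
Variables (C : numClosedFieldType) (N : nat).
Implicit Types (p q : {mpoly C[N]}) (A : 'M[C]_N).

Definition mfact (m : 'X_{1..N}) : nat := (\prod_i (m i)`!)%N.

(** The factorial weights make multiplication by X_i adjoint to the derivative with respect to X_i,
    which in turn makes substitution of A adjoint to substitution of its conjugate transpose. *)
Definition fischer d p q : C :=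
  \sum_(m : 'X_{1..N < d.+1}) p@_m * (q@_m)^* * (mfact m)%:R.

Lemma fischerPl d a p p' q :
  fischer d (a *: p + p') q = a * fischer d p q + fischer d p' q.
Proof.
rewrite /fischer mulr_sumr -big_split; apply: eq_bigr => m _ /=.
by rewrite mcoeffD mcoeffZ; ring.
Qed.

Lemma fischerPr d a p q q' :
  fischer d p (a *: q + q') = a^* * fischer d p q + fischer d p q'.
Proof.
rewrite /fischer mulr_sumr -big_split; apply: eq_bigr => m _ /=.
by rewrite mcoeffD mcoeffZ rmorphD rmorphM /=; ring.
Qed.

Lemma fischer_suml d (I : Type) (r : seq I) (c : I -> C) (F : I -> {mpoly C[N]}) q :
  fischer d (\sum_(i <- r) c i *: F i) q = \sum_(i <- r) c i * fischer d (F i) q.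
Proof.
elim: r => [|i r IH]; last by rewrite !big_cons fischerPl IH.
by rewrite !big_nil /fischer big1 // => m _; rewrite mcoeff0 !mul0r.
Qed.

Lemma fischer_sumr d (I : Type) (r : seq I) (c : I -> C) (F : I -> {mpoly C[N]}) p :
  fischer d p (\sum_(i <- r) c i *: F i) = \sum_(i <- r) (c i)^* * fischer d p (F i).
Proof.
elim: r => [|i r IH]; last by rewrite !big_cons fischerPr IH.
by rewrite !big_nil /fischer big1 // => m _; rewrite mcoeff0 rmorph0 mulr0 mul0r.
Qed.

Lemma fischerX d m q : mdeg m = d -> fischer d 'X_[m] q = (q@_m)^* * (mfact m)%:R.
Proof.
move=> md; have lm : (mdeg m < d.+1)%N by rewrite md.
rewrite /fischer (bigD1 (BMultinom lm)) //= mcoeffX eqxx mul1r big1 ?addr0 // => k km.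
rewrite mcoeffX; case: eqP => [mk|]; rewrite ?mul0r //.
by case/eqP: km; apply: val_inj.
Qed.

Lemma mfactU i m : mfact (m + U_(i)) = ((m i).+1 * mfact m)%N.
Proof.
rewrite /mfact (bigD1 i) //= [in RHS](bigD1 i) //= mnmDE mnm1E eqxx addn1 factS mulnA.
congr (_ * _)%N; apply: eq_bigr => j ji.
by rewrite mnmDE mnm1E eq_sym (negPf ji) addn0.
Qed.

Lemma fischer_mulX d i p q : p \is d.-homog ->
  fischer d.+1 ('X_i * p) q = fischer d p q^`M(i).
Proof.
move=> hp; rewrite [p]mpolyE mulr_sumr.
under eq_bigr do rewrite -scalerAr -mpolyXD.
rewrite !fischer_suml !big_seq; apply: eq_bigr => m mp; congr (_ * _).
have md : mdeg m = d by exact: dhomog_mf hp _ mp.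
rewrite !fischerX // ?mdegD ?mdeg1 ?md ?add1n // addmC mfactU mcoeff_mderiv natrM.
by rewrite -[q@_(m + U_(i))%MM *+ _]mulr_natr rmorphM /= rmorph_nat mulrA.
Qed.

Lemma mderiv_dirder i p : p^`M(i) = dirder (fun k => (k == i)%:R) p.
Proof.
rewrite /dirder (bigD1 i) //= eqxx scale1r big1 ?addr0 // => k /negPf ->.
by rewrite scale0r.
Qed.

Lemma lin_forms_tnth_homog A i : tnth (lin_forms A) i \is 1.-homog.
Proof.
rewrite tnth_mktuple; apply: rpred_sum => l _; apply: rpredZ.
by rewrite dhomogX; apply/eqP; exact: mdeg1.
Qed.

(** Induction on the degree: a linear form split off on the left crosses over as derivatives, and
    the chain rule [dirder_lin] recombines them into the derivative of the substituted form. *)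
Lemma fischer_adjX d A m q : mdeg m = d -> q \is d.-homog ->
  fischer d ('X_[m] \mPo lin_forms A) q = fischer d 'X_[m] (q \mPo lin_forms (adjmx A)).
Proof.
elim: d m q => [|d IH] m q md hq.
  move/eqP: md; rewrite mdeg_eq0 => /eqP ->; rewrite mpolyX0 comp_mpoly1.
  have -> : q = (q@_0%MM)%:MP.
    apply/mpolyP => k; rewrite mcoeffC; case: eqP => [->|/eqP k0]; rewrite ?mulr1 // mulr0.
    by rewrite (dhomog_nemf_coeff hq) //= mdeg_eq0.
  by rewrite comp_mpolyC.
have [i mi] : exists i, m i != 0%N.
  apply: contrapT => h; move: md; rewrite mdegE big1 // => i _.
  by apply: contrapT => /eqP mi; apply: h; exists i.
have em : m = (U_(i) + (m - U_(i)))%MM by rewrite addmC submK // lep1mP.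
move: (m - U_(i))%MM em => b em; rewrite em mdegD mdeg1 add1n in md.
case: md => md.
rewrite em mpolyXD rmorphM /= comp_mpolyXU -tnth_nth tnth_mktuple mulr_suml.
under eq_bigr do rewrite -scalerAl.
have hb : 'X_[b] \mPo lin_forms A \is d.-homog.
  rewrite -[d]muln1; apply: comp_homog => [|j]; last exact: lin_forms_tnth_homog.
  by rewrite dhomogX; apply/eqP.
rewrite fischer_suml fischer_mulX; last by rewrite dhomogX; apply/eqP.
rewrite mderiv_dirder dirder_lin.
under eq_bigr do rewrite fischer_mulX // IH //= ?(homog_mderiv _ hq) //.
rewrite /dirder raddf_sum /=.
under [in RHS]eq_bigr do rewrite comp_mpolyZ.
rewrite fischer_sumr; apply: eq_bigr => j _; congr (_ * _).
rewrite (bigD1 i) //= eqxx mulr1 big1 ?addr0 => [|l /negPf ->]; last by rewrite mulr0.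
by rewrite !mxE conjCK.
Qed.

Lemma fischer_adj d A p q : p \is d.-homog -> q \is d.-homog ->
  fischer d (p \mPo lin_forms A) q = fischer d p (q \mPo lin_forms (adjmx A)).
Proof.
move=> hp hq; rewrite [p]mpolyE raddf_sum /=.
under eq_bigr do rewrite comp_mpolyZ.
rewrite !fischer_suml !big_seq; apply: eq_bigr => m mp; congr (_ * _).
by apply: fischer_adjX => //; exact: dhomog_mf hp _ mp.
Qed.

End Fischer.

Section OrthonormalCoordinates.
Variables (C : numClosedFieldType) (N d : nat).
Notation S := (homform C N d).
Notation B := (#|{: monom N d}|).
Implicit Types (P Q : S).

Definition nmon (i : 'I_B) : 'X_{1..N} := bmnm (val (enum_val i)).

(** Scaling by these square roots turns the Fischer product of forms into the standard Hermitian
    product of coordinates. The matrix of substitution of [adjmx g] is then the conjugate transpose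
    of that of g, which allows a second use of the Fischer product, on polynomials in these
    coordinates. *)
Definition wt (i : 'I_B) : C := sqrtC (mfact (nmon i))%:R.

Lemma wt_neq0 i : wt i != 0.
Proof.
rewrite sqrtC_eq0 pnatr_eq0 -lt0n prodn_gt0 // => j; exact: fact_gt0.
Qed.

Definition ycoord P : 'rV[C]_B := \row_i (wt i * form_coefs P 0 i).

Definition yform (r : 'rV[C]_B) : S := form_of_coefs (\row_i ((wt i)^-1 * r 0 i)).

Lemma ycoordK : cancel ycoord yform.
Proof.
move=> P; rewrite /yform -[RHS]form_coefsK; congr form_of_coefs; apply/rowP => i.
by rewrite mxE mxE mulKf ?wt_neq0.
Qed.

Lemma yformK : cancel yform ycoord.
Proof.
by move=> r; apply/rowP => i; rewrite mxE form_of_coefsK mxE mulVKf ?wt_neq0.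
Qed.

Lemma ycoord_is_linear : linear ycoord.
Proof.
move=> a P Q; apply/rowP => i; rewrite mxE form_coefs_linear !mxE; ring.
Qed.

HB.instance Definition _ := GRing.isLinear.Build C S 'rV[C]_B _ ycoord ycoord_is_linear.

Lemma yformP a r s : yform (a *: r + s) = a *: yform r + yform s.
Proof. by apply: (can_inj ycoordK); rewrite yformK ycoord_is_linear !yformK. Qed.

Definition fdot P Q : C := fischer d (mpoly_of_dhomog P) (mpoly_of_dhomog Q).

Lemma fdotE P Q : fdot P Q = hdot (ycoord P) (ycoord Q).
Proof.
have PE (R : S) : mpoly_of_dhomog R = \sum_i form_coefs R 0 i *: 'X_[nmon i].
  by rewrite -{1}[R]form_coefsK.
rewrite hdotE /fdot PE fischer_suml; apply: eq_bigr => i _.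
have mi : mdeg (nmon i) = d by apply/eqP; exact: valP (enum_val i).
rewrite fischerX // !mxE rmorphM /=.
have wt0 : 0 <= wt i by rewrite sqrtC_ge0 ler0n.
have -> : (mfact (nmon i))%:R = wt i * (wt i)^* by rewrite (geC0_conj wt0) -expr2 sqrtCK.
ring.
Qed.

Lemma fdot_eq0 P : fdot P P = 0 -> P = 0.
Proof. by rewrite fdotE => /hdot_eq0 h; apply: (can_inj ycoordK); rewrite h linear0. Qed.

Lemma fdotPl a P Q R : fdot (a *: P + Q) R = a * fdot P R + fdot Q R.
Proof. by rewrite /fdot homform_valP fischerPl. Qed.

Lemma fdotPr a P Q R : fdot R (a *: P + Q) = a^* * fdot R P + fdot R Q.
Proof. by rewrite /fdot homform_valP fischerPr. Qed.

Lemma fdotC P Q : fdot Q P = (fdot P Q)^*.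
Proof.
rewrite !fdotE !hdotE rmorph_sum; apply: eq_bigr => i _.
by rewrite rmorphM /= conjCK mulrC.
Qed.

Lemma fdot_precomp (A : 'M[C]_N) P Q :
  fdot (precomp A P) Q = fdot P (precomp (adjmx A) Q).
Proof. by apply: fischer_adj; exact: dhomog_is_dhomog. Qed.

Lemma form_projection (U : S -> Prop) P :
  U 0 -> (forall a Q R, U Q -> U R -> U (a *: Q + R)) ->
  exists P1 P2, [/\ P = P1 + P2, U P1 & forall Q, U Q -> fdot P2 Q = 0].
Proof.
move=> U0 UP; have yf0 : yform 0 = 0 by apply: (can_inj ycoordK); rewrite yformK linear0.
have [||x [y [Pxy Ux hy]]] := @hermitian_projection C B (fun r => U (yform r)) (ycoord P).
- by rewrite yf0.
- by move=> a r s hr hs; rewrite yformP; exact: UP.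
exists (yform x), (yform y); split=> //.
  by have := yformP 1 x y; rewrite !scale1r -Pxy ycoordK.
by move=> Q UQ; rewrite fdotE yformK; apply: hy; rewrite ycoordK.
Qed.

(* Locked, since unification diverges when it unfolds the substitution. *)
Definition precomp_mx (g : 'M[C]_N) : 'M[C]_B :=
  locked (lin1_mx (fun r => ycoord (precomp g (yform r)))).

Lemma precomp_mxE g P : ycoord (precomp g P) = ycoord P *m precomp_mx g.
Proof.
have lin : linear (fun r => ycoord (precomp g (yform r))).
  by move=> a r s; rewrite yformP !linearP.
pose f : {linear 'rV[C]_B -> 'rV[C]_B} := HB.pack (fun r => ycoord (precomp g (yform r)))
  (GRing.isLinear.Build _ _ _ _ _ lin).
by rewrite /precomp_mx -lock -[lin1_mx _]/(lin1_mx f) mul_rV_lin1 /= ycoordK.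
Qed.

Lemma precomp_mx_adj g : precomp_mx (adjmx g) = adjmx (precomp_mx g).
Proof.
apply/matrixP => i j.
have h (x y : 'rV[C]_B) : hdot (x *m precomp_mx g) y = hdot x (y *m precomp_mx (adjmx g)).
  by rewrite -[x]yformK -[y]yformK -!precomp_mxE -!fdotE fdot_precomp.
move: (precomp_mx g) (precomp_mx (adjmx g)) h => M M' h.
have := h (delta_mx 0 j) (delta_mx 0 i).
by rewrite hdot_deltar hdot_deltal -!rowE !mxE => ->; rewrite conjCK.
Qed.

End OrthonormalCoordinates.

(** * The Fischer product on polynomial functions of forms *)

Section PolynomialFunctions.
Variables (C : numClosedFieldType) (N d k : nat).
Notation S := (homform C N d).
Notation B := (#|{: monom N d}|).
Notation T := (homform C B k).

Definition fun_of (p : T) : S -> C := fun P => (mpoly_of_dhomog p).@[pt (ycoord P)^T].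

Lemma fun_of_inj : injective fun_of.
Proof.
move=> p q e; apply: form_ext => w.
by have := congr1 (fun F => F (yform w^T)) e; rewrite /fun_of yformK trmxK.
Qed.

Lemma fun_ofP a p q : fun_of (a *: p + q) = fun P => a * fun_of p P + fun_of q P.
Proof. by apply/funext => P; rewrite /fun_of homform_valP mevalD mevalZ. Qed.

Lemma fun_of_act g p : act_fun g (fun_of p) = fun_of (precomp (precomp_mx d g)^T p).
Proof.
apply/funext => P; rewrite act_funE /fun_of precomp_eval; congr (meval (pt _) _).
by rewrite precomp_mxE trmx_mul.
Qed.

Lemma fun_of_surj (F : S -> C) : @homog_fun C S k F -> exists p, F = fun_of p.
Proof.
move=> [p hp hF].
have /choice[c hc] : forall i : 'I_(\dim {:S}), exists c : 'I_B -> C, forall P : S,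
    coords P i = \sum_j c j * ycoord P 0 j.
  move=> i; have [|c hc] := @form_expand C N d (fun P => coords P i).
    by move=> a u v; rewrite /coords linearP.
  exists (fun j => c j / @wt C N d j) => P; rewrite hc; apply: eq_bigr => j _.
  by rewrite !mxE mulrA mulfVK ?wt_neq0.
pose w := [tuple \sum_j c i j *: 'X_j | i < \dim {:S}] : (\dim {:S}).-tuple {mpoly C[B]}.
have hq : p \mPo w \is k.-homog.
  rewrite -[k]muln1; apply: comp_homog => // i; rewrite tnth_mktuple.
  by apply: rpred_sum => l _; apply: rpredZ; rewrite dhomogX; apply/eqP; exact: mdeg1.
exists (DHomog hq); apply/funext => P; rewrite hF /fun_of /= comp_mpoly_meval.
apply: meval_eq => i; rewrite hc tnth_mktuple raddf_sum; apply: eq_bigr => j _ /=.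
by rewrite mevalZ mevalXU /pt [(ycoord P)^T j 0]mxE.
Qed.

Lemma fun_of_adj g (p q : T) :
  fdot (precomp (precomp_mx d g)^T p) q = fdot p (precomp (precomp_mx d (adjmx g))^T q).
Proof.
rewrite fdot_precomp precomp_mx_adj; congr (fdot p (precomp _ q)).
by apply/matrixP => i j; rewrite !mxE.
Qed.

End PolynomialFunctions.

(** * Modules generated by a highest weight vector *)

Section GenericLU.
Variable K : fieldType.

Lemma det_shift_poly n (A : 'M[K]_n) :
  exists2 c : {poly K}, c != 0 & forall s, c.[s] = \det (A + s%:M).
Proof.
exists (char_poly (- A)); first exact/monic_neq0/char_poly_monic.
move=> s; rewrite /char_poly -[_.[s]]/(horner_eval s _) -det_map_mx; congr (\det _).
apply/matrixP => i j; rewrite !mxE /= /horner_eval hornerD hornerN hornerC opprK addrC.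
by congr (_ + _); rewrite hornerMn hornerX.
Qed.

(** The factorization exists when the trailing principal minors of A + s are nonzero; these are
    monic polynomials in s, and [c] is their product. *)
Lemma generic_UL n (A : 'M[K]_n) : exists2 c : {poly K}, c != 0 & forall s, c.[s] != 0 ->
  exists U L : 'M[K]_n, [/\ U \in unitmx, L \in unitmx, is_trig_mx U^T, is_trig_mx L &
    A + s%:M = U *m L].
Proof.
elim: n A => [|n IH] A.
  exists 1; first exact: oner_neq0.
  move=> s _; exists 1%:M, 1%:M; rewrite unitmx1 trmx1; split=> //; try exact: scalar_mx_is_trig.
  by apply/matrixP; case.
pose A' : 'M[K]_(1 + n) := A.
have [c1 c1n h1] := IH (drsubmx A'); have [c2 c2n h2] := det_shift_poly A.
exists (c1 * c2); first exact: mulf_neq0.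
move=> s; rewrite hornerM mulf_eq0 negb_or => /andP[/h1[U [L [uU uL tU tL e]]]].
rewrite h2 => ds.
pose z := invmx U *m dlsubmx A'; pose y := ursubmx A' *m invmx L.
(* Schur complement of the trailing block. *)
pose x := ulsubmx A' + s%:M - y *m z.
pose U1 : 'M[K]_(1 + n) := block_mx x y 0 U.
pose L1 : 'M[K]_(1 + n) := block_mx 1%:M 0 z L.
have e1 : A + s%:M = U1 *m L1.
  rewrite /U1 /L1 mulmx_block !mulmx1 !mulmx0 !add0r -e.
  rewrite /x subrK /y mulmxKV // /z mulmxA mulmxV // mul1mx.
  transitivity (block_mx (ulsubmx A') (ursubmx A') (dlsubmx A') (drsubmx A') +
    block_mx s%:M 0 0 s%:M); first by rewrite submxK -scalar_mx_block.
  by rewrite add_block_mx !addr0.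
have := ds; rewrite e1 det_mulmx mulf_eq0 negb_or => /andP[dU dL].
have tU1 : is_trig_mx U1^T.
  by rewrite /U1 tr_block_mx trmx0 is_trig_block_mx // tU andbT eqxx mx11_is_trig.
have tL1 : is_trig_mx L1.
  by rewrite /L1 is_trig_block_mx // tL eqxx andbT mx11_is_trig.
by exists U1, L1; split=> //; rewrite unitmxE unitfE.
Qed.

(** Reversing the order of the basis exchanges upper and lower triangular matrices. *)
Lemma generic_LU n (A : 'M[K]_n) : exists2 c : {poly K}, c != 0 & forall s, c.[s] != 0 ->
  exists L U : 'M[K]_n, [/\ L \in unitmx, U \in unitmx, is_trig_mx L, is_trig_mx U^T &
    A + s%:M = L *m U].
Proof.
pose rv (B : 'M[K]_n) : 'M[K]_n := \matrix_(i, j) B (rev_ord i) (rev_ord j).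
have rvK B : rv (rv B) = B by apply/matrixP => i j; rewrite !mxE !rev_ordK.
have rvM B D : rv (B *m D) = rv B *m rv D.
  apply/matrixP => i j; rewrite !mxE (reindex_inj rev_ord_inj); apply: eq_bigr => k _.
  by rewrite !mxE.
have rv1 s : rv s%:M = s%:M by apply/matrixP => i j; rewrite !mxE (inj_eq rev_ord_inj).
have rvu B : B \in unitmx -> rv B \in unitmx.
  move=> uB; suff /mulmx1_unit[] : rv B *m rv (invmx B) = 1%:M by [].
  by rewrite -rvM mulmxV // rv1.
have rvt B : is_trig_mx B -> is_trig_mx (rv B)^T.
  move=> /is_trig_mxP h; apply/is_trig_mxP => i j ij; rewrite !mxE h //=.
  by have := ltn_ord j; clear -ij; lia.
have [c cn h] := generic_UL (rv A); exists c => // s /h[U [L [uU uL tU tL e]]].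
exists (rv U), (rv L); split; rewrite ?rvu // ?rvt //.
  have := rvt _ tU; congr is_trig_mx; apply/matrixP => i j; by rewrite !mxE.
by rewrite -rvM -e; apply/matrixP => i j; rewrite !mxE !rev_ordK (inj_eq rev_ord_inj).
Qed.

Lemma trig_diag_unit n (A : 'M[K]_n) i : is_trig_mx A -> A \in unitmx -> A i i != 0.
Proof.
move=> tA; rewrite unitmxE det_trig // unitfE => /prodf_neq0; exact.
Qed.

End GenericLU.

Section HighestWeightModule.
Variables (C : numClosedFieldType) (N d k : nat).
Notation S := (homform C N d).
Variables (lambda : {ffun 'I_N -> int}) (F0 : S -> C).
Hypotheses (homF0 : @homog_fun C S k F0) (hwF0 : highest_weight_vector lambda F0).

Definition gl_span : set (S -> C) :=
  [set F | exists m (c : 'I_m -> C) (g : 'I_m -> 'M[C]_N),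
     (forall i, g i \in unitmx) /\ F = fun P => \sum_(i < m) c i * act_fun (g i) F0 P].

Lemma act_fun_comp (g h : 'M[C]_N) (F : S -> C) :
  act_fun g (act_fun h F) = act_fun (g *m h) F.
Proof. by apply/funext => P; rewrite !act_funE precomp_comp. Qed.

Lemma act_fun1 (F : S -> C) : act_fun 1%:M F = F.
Proof. by apply/funext => P; rewrite act_funE precomp1. Qed.

Lemma gl_span_sub (M : set (S -> C)) : gl_submodule M -> M F0 -> gl_span `<=` M.
Proof.
move=> [M0 MD Mg] MF0 F [m [c [g [gu ->]]]].
elim: m c g gu => [|m IH] c g gu.
  rewrite (_ : (fun P => _) = cst 0) //; apply/funext => P; by rewrite big_ord0.
rewrite (_ : (fun P => _) = fun P => c ord0 * act_fun (g ord0) F0 P +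
   \sum_(i < m) c (lift ord0 i) * act_fun (g (lift ord0 i)) F0 P).
  by apply: MD; [exact: Mg|exact: IH].
by apply/funext => P; rewrite big_ord_recl.
Qed.

Lemma gl_span_submodule : gl_submodule gl_span.
Proof.
split.
- exists 0%N, (fun=> 0), (fun=> 1%:M); split=> [[]//|]; apply/funext => P.
  by rewrite big_ord0.
- move=> a F G [m [c [g [gu ->]]]] [m' [c' [g' [gu' ->]]]].
  exists (m + m')%N, (fun i => match fintype.split i with inl j => a * c j | inr j => c' j end),
    (fun i => match fintype.split i with inl j => g j | inr j => g' j end); split.
    by move=> i; case: fintype.split.
  apply/funext => v; rewrite big_split_ord /= mulr_sumr; congr (_ + _).
    apply: eq_bigr => i _; rewrite -[lshift _ _]/(unsplit (inl i)) unsplitK.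
    by rewrite mulrA.
  by apply: eq_bigr => i _; rewrite -[rshift _ _]/(unsplit (inr i)) unsplitK.
move=> g F gu [m [c [h [hu ->]]]].
exists m, c, (fun i => g *m h i); split=> [i|]; first by rewrite unitmx_mul gu hu.
by apply/funext => P; rewrite act_funE; apply: eq_bigr => i _; rewrite !act_funE precomp_comp.
Qed.

Lemma gl_span_gen : gl_span F0.
Proof.
exists 1%N, (fun=> 1), (fun=> 1%:M); split=> [i|]; first exact: unitmx1.
by apply/funext => P; rewrite big_ord1 mul1r act_fun1.
Qed.

(* Density of the big cell, by interpolation along g + s. *)
Lemma big_cell_span (g : 'M[C]_N) : exists m (w : 'I_m -> C) (L U : 'I_m -> 'M[C]_N),
  (forall i, [/\ L i \in unitmx, U i \in unitmx, is_trig_mx (L i) & is_trig_mx (U i)^T]) /\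
  act_fun g F0 = fun P => \sum_i w i * act_fun (L i *m U i) F0 P.
Proof.
have [c cn hc] := generic_LU g.
have [t [w [ht hw]]] := @interpolation C c (k * d) 0 cn.
have /choice[LU hLU] : forall i, exists LU : 'M[C]_N * 'M[C]_N,
    [/\ LU.1 \in unitmx, LU.2 \in unitmx, is_trig_mx LU.1, is_trig_mx LU.2^T &
      g + (t i)%:M = LU.1 *m LU.2].
  by move=> i; have [L [U h]] := hc _ (ht i).2; exists (L, U).
exists (k * d).+1, w, (fun i => (LU i).1), (fun i => (LU i).2); split.
  by move=> i; have [] := hLU i.
apply/funext => P; have [r rs hr] := homog_fun_precomp_curve g 1%:M P homF0.
have -> : act_fun g F0 P = r`_0.
  by rewrite -horner_coef0 -hr scale0r addr0 act_funE.
rewrite hw //; apply: eq_bigr => i _; rewrite act_funE -hr.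
by have [_ _ _ _ <-] := hLU i; rewrite scalemx1.
Qed.

Notation T := (homform C #|{: monom N d}| k).

Theorem gl_span_irreducible : gl_irreducible gl_span.
Proof.
have [p0 F0E] := fun_of_surj homF0; have [F0n hw] := hwF0.
split; [exact: gl_span_submodule|by exists F0; [exact: gl_span_gen|]|].
move=> M' [M'0 M'D M'g] M'M.
pose chi (b : 'M[C]_N) := \prod_(j < N) b j j ^ lambda j.
(* ac is kept abstract: unfolding it makes unification diverge *)
have [ac [acE acP acadj]] : exists ac : 'M[C]_N -> T -> T,
    [/\ forall g p, act_fun g (fun_of p) = fun_of (ac g p),
       forall g a p q, ac g (a *: p + q) = a *: ac g p + ac g q &
       forall g p q, fdot (ac g p) q = fdot p (ac (adjmx g) q)].
  exists (fun g => precomp (precomp_mx d g)^T); split=> [g p|g a p q|g p q].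
  - exact: fun_of_act.
  - exact: linearP.
  exact: fun_of_adj.
have fun0 : fun_of (0 : T) = cst 0.
  by apply/funext => P; rewrite /fun_of meval0.
have funZ a (p : T) : fun_of (a *: p) = fun P => a * fun_of p P.
  by rewrite -[a *: p]addr0 fun_ofP fun0; apply/funext => P; rewrite addr0.
have actF g : fun_of (ac g p0) = act_fun g F0 by rewrite F0E acE.
have hwp b : b \in unitmx -> is_trig_mx b^T -> ac b p0 = chi b *: p0.
  by move=> bu bt; apply: fun_of_inj; rewrite actF hw // funZ -F0E.
have actM g h (p : T) : ac g (ac h p) = ac (g *m h) p.
  by apply: fun_of_inj; rewrite -!acE act_fun_comp.
have ac0 g : ac g 0 = 0.
  by have := acP g (-1) 0 0; rewrite scaler0 addr0 scaleN1r addNr.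
have acZ g a p : ac g (a *: p) = a *: ac g p.
  by rewrite -[a *: p]addr0 acP ac0 addr0.
have fdot0r (q : T) : fdot q 0 = 0.
  by have := fdotPr (-1) 0 0 q; rewrite scaler0 addr0 rmorphN1 mulN1r addNr.
have fdot0l (q : T) : fdot 0 q = 0.
  by have := fdotPl (-1) 0 0 q; rewrite scaler0 addr0 mulN1r addNr.
have fdotZl a (p q : T) : fdot (a *: p) q = a * fdot p q.
  by rewrite -[a *: p]addr0 fdotPl fdot0l addr0.
have fdotZr a (p q : T) : fdot p (a *: q) = a^* * fdot p q.
  by rewrite -[a *: q]addr0 fdotPr fdot0r addr0.
have fun_of_sum m (w : 'I_m -> C) (q : 'I_m -> T) :
    fun_of (\sum_i w i *: q i) = fun P => \sum_i w i * fun_of (q i) P.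
  apply/funext => P; rewrite /fun_of.
  have -> : mpoly_of_dhomog (\sum_i w i *: q i) = \sum_i w i *: mpoly_of_dhomog (q i).
    elim/big_ind2: _ => // x1 x2 y1 y2 h1 h2.
    by have := homform_valP 1 x2 y2; rewrite !scale1r h1 h2.
  by rewrite raddf_sum; apply: eq_bigr => i _ /=; rewrite mevalZ.
have fdot_sumr m (w : 'I_m -> C) (q : 'I_m -> T) p :
    fdot p (\sum_i w i *: q i) = \sum_i (w i)^* * fdot p (q i).
  elim: m w q => [|m IH] w q; first by rewrite !big_ord0.
  by rewrite !big_ord_recl fdotPr IH.
(* An element of the span orthogonal to all generators is orthogonal to itself. *)
have perp_eq0 q : gl_span (fun_of q) ->
    (forall g, g \in unitmx -> fdot q (ac g p0) = 0) -> q = 0.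
  move=> [m [c [g [gu e]]]] hq; apply: fdot_eq0.
  have qE : q = \sum_i c i *: ac (g i) p0.
    apply: fun_of_inj; rewrite [RHS]fun_of_sum e; apply/funext => P.
    by apply: eq_bigr => i _; rewrite actF.
  rewrite {2}qE fdot_sumr big1 // => i _; by rewrite hq // mulr0.
(* In the pairing of q with L U p0, U acts on p0 by a scalar, while L crosses over as the upper
   triangular [adjmx L] and acts on q by a scalar. Only a multiple of the pairing of q with p0 is
   left. *)
have hw_uniq q : gl_span (fun_of q) ->
    (forall b, b \in unitmx -> is_trig_mx b^T -> ac b q = chi b *: q) ->
    fdot q p0 = 0 -> q = 0.
  move=> Mq hq qp; apply: perp_eq0 => // g _.
  have [m [w [L [U [hLU e]]]]] := big_cell_span g.
  have -> : ac g p0 = \sum_i w i *: ac (L i *m U i) p0.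
    apply: fun_of_inj; rewrite [LHS]actF [RHS]fun_of_sum e; apply/funext => P.
    by apply: eq_bigr => i _; rewrite actF.
  rewrite fdot_sumr big1 // => i _; have [uL uU tL tU] := hLU i.
  rewrite -actM hwp // acZ fdotZr -[L i]adjmxK -acadj hq ?adjmx_unit ?adjmx_trig //.
  by rewrite fdotZl qp !mulr0.
have [||p1 [p2 [p12 Up1 Pp2]]] := @form_projection C _ k (fun p : T => M' (fun_of p)) p0.
- by rewrite fun0.
- by move=> a p q hp hq; rewrite fun_ofP; exact: M'D.
have p1D : p2 = (-1) *: p1 + p0 by rewrite p12 scaleN1r addKr.
(* The defect [dl] lies in M' and is also, up to sign, the defect of [p2], hence orthogonal to M',
   whose complement is stable. So the projection of p0 to M' has the same weight as p0. *)
have hp1 b : b \in unitmx -> is_trig_mx b^T -> ac b p1 = chi b *: p1.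
  move=> bu bt; pose dl := (- chi b) *: p1 + ac b p1.
  have Udl : M' (fun_of dl).
    by rewrite fun_ofP; apply: M'D => //; rewrite -acE; exact: M'g.
  have dlE : dl = (- 1) *: ((- chi b) *: p2 + ac b p2).
    rewrite p1D acP hwp // /dl !scalerDr !scalerA.
    rewrite !mulN1r !opprK !mulrN1 scale1r [RHS]addrACA -scalerDl subrr.
    by rewrite !scaleNr scale0r addr0.
  have dl0 : fdot dl dl = 0.
    rewrite {1}dlE fdotZl fdotPl Pp2 // mulr0 add0r acadj Pp2 ?mulr0 // -acE.
    by apply: M'g => //; rewrite adjmx_unit.
  have /eqP := fdot_eq0 dl0; rewrite /dl scaleNr addrC subr_eq0 => /eqP.
  by [].
have n00 : fdot p0 p0 != 0.
  apply/eqP => /fdot_eq0 p00; apply: F0n; by rewrite F0E p00 fun0.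
pose c := fdot p1 p0 / fdot p0 p0.
have gl_span0 : gl_submodule gl_span := gl_span_submodule.
have [_ glD glg] := gl_span0.
have p1E : p1 = c *: p0.
  have : (- c) *: p0 + p1 = 0.
    apply: hw_uniq.
    - by rewrite fun_ofP; apply: glD; [rewrite -F0E; exact: gl_span_gen|exact: M'M].
    - move=> b bu bt; rewrite acP hwp // hp1 // scalerDr !scalerA; congr (_ *: _ + _).
      by rewrite mulrC.
    by rewrite fdotPl mulNr /c mulfVK // addNr.
  by move=> /eqP; rewrite scaleNr addrC subr_eq0 => /eqP.
(* If the projection of p0 is 0, M' is orthogonal to all g p0 and vanishes; otherwise M' contains F0
   and everything it generates. *)
have [c0|cn0] := eqVneq c 0; [left|right].
  rewrite c0 scale0r in p1E.
  apply/seteqP; split=> [F MF|F ->]; last exact: M'0.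
  have [q qE] : exists q : T, F = fun_of q.
    have [m [w [g [_ ->]]]] := M'M _ MF; exists (\sum_i w i *: ac (g i) p0).
    rewrite fun_of_sum; apply/funext => P; apply: eq_bigr => i _.
    by rewrite actF.
  rewrite qE in MF *; rewrite (_ : q = 0) //; apply: perp_eq0; first exact: M'M.
  move=> g gu; rewrite -[g]adjmxK -acadj fdotC p12 p1E add0r Pp2 ?rmorph0 //.
  by rewrite -acE; apply: M'g => //; rewrite adjmx_unit.
apply/seteqP; split=> //; apply: gl_span_sub; first by split.
have -> : F0 = fun P => c^-1 * fun_of p1 P + cst 0 P.
  apply/funext => P; rewrite addr0 F0E p1E.
  have := congr1 (fun G => G P) (fun_ofP c p0 0); rewrite addr0 => ->.
  by rewrite fun0 /= addr0 mulKf.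
exact: M'D.
Qed.

End HighestWeightModule.

(** * A highest weight vector among the equations *)

Section LinePolynomialScaling.
Variables (K : numFieldType) (N : nat).
Implicit Types (a b : 'I_N -> K) (P : {mpoly K[N]}).

Lemma meval_homogZ d P c (w : 'I_N -> K) : P \is d.-homog ->
  P.@[fun k => c * w k] = c ^+ d * P.@[w].
Proof.
move=> hP; rewrite !mevalE big_distrr /= big_seq [RHS]big_seq; apply: eq_bigr => m mP.
rewrite mulrCA; congr (_ * _); rewrite -(dhomog_mf hP mP) /= mdegE.
by rewrite -prodrXr -big_split; apply: eq_bigr => i _ /=; rewrite exprMn.
Qed.

Lemma linep_rev d a b P j : P \is d.-homog -> (j <= d)%N ->
  (linep b a P)`_(d - j) = (linep a b P)`_j.
Proof.
move=> hP jd.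
have -> : linep b a P = \poly_(i < d.+1) (linep a b P)`_(d - i).
  apply: poly_fun_eq => s s0; rewrite horner_poly horner_linep.
  rewrite (_ : (fun k => _) = fun k => s * (a k * s^-1 + b k)); last first.
    by apply/funext => k; field.
  rewrite (meval_homogZ _ _ hP) -horner_linep (horner_coef_wide _ (linep_size a b hP)).
  rewrite mulr_sumr (reindex_inj rev_ord_inj) /=; apply: eq_bigr => i _.
  have id : (i <= d)%N by rewrite -ltnS.
  rewrite subSS mulrCA; congr (_ * _).
  by rewrite exprVn -{1}(subKn id) -exprB ?unitfE // subKn ?leq_subr // subKn.
by rewrite coef_poly ltnS leq_subr subKn.
Qed.

Lemma linep_top d a b P : P \is d.-homog -> (linep a b P)`_d = P.@[a].
Proof.
move=> hP; rewrite -(linep_rev a b hP (leqnn d)) subnn -horner_coef0 horner_linep.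
by apply: meval_eq => k; rewrite mulr0 add0r.
Qed.

Lemma linep_scale d a b P (al be : K) j : P \is d.-homog -> be != 0 -> (j <= d)%N ->
  (linep (fun k => al * a k) (fun k => be * b k) P)`_j =
  al ^+ j * be ^+ (d - j) * (linep a b P)`_j.
Proof.
move=> hP be0 jd.
have -> : linep (fun k => al * a k) (fun k => be * b k) P =
    \poly_(i < d.+1) (al ^+ i * be ^+ (d - i) * (linep a b P)`_i).
  apply: poly_fun_eq => s s0; rewrite horner_poly horner_linep.
  rewrite (_ : (fun k => _) = fun k => be * (a k * (al * s / be) + b k)); last first.
    by apply/funext => k; field.
  rewrite (meval_homogZ _ _ hP) -horner_linep (horner_coef_wide _ (linep_size a b hP)).
  rewrite mulr_sumr; apply: eq_bigr => i _.
  have id : (i <= d)%N by rewrite -ltnS.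
  have -> : be ^+ d = be ^+ (d - i) * be ^+ i by rewrite -exprD subnK.
  rewrite !exprMn exprVn; field.
  by rewrite expf_neq0.
by rewrite coef_poly ltnS jd.
Qed.

Lemma linep_shift a b P c :
  linep a (fun k => c * a k + b k) P = linep a b P \Po ('X + c%:P).
Proof.
apply: poly_fun_eq => s _; rewrite horner_comp !horner_linep; apply: meval_eq => k.
rewrite hornerD hornerX hornerC. ring.
Qed.

Lemma dirder_vec_lin a b c (P : {mpoly K[N]}) :
  dirder (fun k => c * a k + b k) P = c *: dirder a P + dirder b P.
Proof.
rewrite /dirder scaler_sumr -big_split; apply: eq_bigr => k _ /=.
by rewrite scalerDl scalerA.
Qed.

Lemma dirder_vec_sum (I : finType) (F : I -> 'I_N -> K) (c : I -> K) (P : {mpoly K[N]}) :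
  dirder (fun k => \sum_i c i * F i k) P = \sum_i c i *: dirder (F i) P.
Proof.
under eq_bigr do rewrite scaler_sumr; rewrite exchange_big; apply: eq_bigr => k _ /=.
by rewrite scaler_suml; apply: eq_bigr => i _; rewrite scalerA.
Qed.

Lemma dirderXn a P m : dirder a (P ^+ m) = (P ^+ m.-1 * dirder a P) *+ m.
Proof.
elim: m => [|m IH]; first by rewrite expr0 mulr0n -mpolyC1 dirderC.
rewrite exprS dirderM IH mulrS mulrC; congr (_ + _).
case: m {IH} => [|m]; first by rewrite !mulr0n mulr0.
by rewrite mulrnAr mulrA -exprS.
Qed.

End LinePolynomialScaling.

Lemma residueZ (R : comNzRingType) n e (q p : nat -> R) c :
  residue n e (fun i => c * q i) p = c * residue n e q p.
Proof.
by rewrite !residueE mulr_sumr; apply: eq_bigr => i _; rewrite mulrA.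
Qed.

Section HighestWeightVector.
Variables (K : numFieldType) (n : nat).
Hypothesis n3 : (3 <= n)%N.
Notation N := (n * n)%N.
Notation W := 'M[K]_n.
Notation SW := (homform K N n).
Notation e := ((2 * n + 1) * (n - 2))%N.
Let D := (e - (n - 1))%N.

Definition unitW (k : 'I_N) : W := vec_mx (delta_mx 0 k).

Lemma coord_unitW k l : coordW (unitW k) l = (l == k)%:R.
Proof. by rewrite /coordW vec_mxK mxE eqxx. Qed.

Lemma flag_le : (2 * n + 1 <= N)%N.
Proof. by clear -n3; nia. Qed.

Lemma ltN i : (i < 2 * n + 1)%N -> (i < N)%N.
Proof. by move=> h; apply: leq_trans h flag_le. Qed.

Definition flag_idx (i : 'I_(2 * n + 1)) : 'I_N := Ordinal (ltN (ltn_ord i)).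

Fact flag0_lt : (0 < 2 * n + 1)%N. Proof. by rewrite addn1. Qed.
Fact flag1_lt : (1 < 2 * n + 1)%N. Proof. by clear -n3; lia. Qed.
Let j0 : 'I_(2 * n + 1) := Ordinal flag0_lt.
Let j1 : 'I_(2 * n + 1) := Ordinal flag1_lt.

Definition flag : (2 * n + 1).-tuple W := [tuple unitW (flag_idx i) | i < 2 * n + 1].

Definition hw_fun : SW -> K := E_fun flag (unitW (flag_idx j0)) (unitW (flag_idx j1)).

Lemma free_units m (h : 'I_m -> 'I_N) : injective h ->
  free [tuple unitW (h i) | i < m].
Proof.
move=> hi; apply/freeP => c hc i.
have := congr1 (fun w : W => coordW w (h i)) hc.
rewrite /coordW linear0 mxE linear_sum summxE /= (bigD1 i) //= big1 ?addr0.
  rewrite linearZ mxE (nth_map i) ?size_enum_ord // nth_ord_enum.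
  by rewrite -[mxvec _ _ _]/(coordW _ _) coord_unitW eqxx mulr1.
move=> k ki; rewrite linearZ mxE (nth_map i) ?size_enum_ord // nth_ord_enum.
rewrite -[mxvec _ _ _]/(coordW _ _) coord_unitW (inj_eq hi) eq_sym (negPf ki).
by rewrite mulr0.
Qed.

Lemma flag_idx_inj : injective flag_idx.
Proof. by move=> i j /(congr1 val) /= h; exact: val_inj. Qed.

Lemma hw_fun_in_V : @V_n K n hw_fun.
Proof.
exists 1%N, (fun=> 1), (fun=> hw_fun); split=> [_|]; last first.
  by apply/funext => P; rewrite big_ord1 mul1r.
exists flag, (unitW (flag_idx j0)), (unitW (flag_idx j1)); split=> //.
  by apply: free_units; exact: flag_idx_inj.
pose h (i : 'I_2) := if i == ord0 then flag_idx j0 else flag_idx j1.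
have hi : injective h.
  move=> i j; rewrite /h; case: (eqVneq i ord0) => [->|i0]; case: (eqVneq j ord0) => [->|j0'] //.
  have o2 (i' : 'I_2) : i' != ord0 -> i' = ord_max.
    by move=> i0'; apply: val_inj; case: i' i0' => [[|[|//]]].
  by move=> _; rewrite (o2 i) // (o2 j).
have := free_units hi; congr (is_true (free _)).
by rewrite /= !enum_ordSl enum_ord0.
Qed.

(** An upper triangular b acts on the flag by a triangular block B, which multiplies the Hessian
    determinant by det(B)^2. It scales u by [al] and sends v to [be] v plus a multiple of u: the
    multiple is absorbed by [residue_shift], and the scalings are counted by [residue_scale]. *)
Lemma hw_fun_weight (b : 'M[K]_N) (P : SW) : b \in unitmx -> is_trig_mx b^T ->
  act_fun b hw_fun P = (\prod_(i < 2 * n + 1) b (flag_idx i) (flag_idx i)) ^+ 2 *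
    (b (flag_idx j0) (flag_idx j0) ^+ (n * D + (n - 1)) *
     b (flag_idx j1) (flag_idx j1) ^+ D) * hw_fun P.
Proof.
move=> bu bt; have bt0 (k l : 'I_N) : (l < k)%N -> b k l = 0.
  by move=> lk; have /is_trig_mxP := bt => /(_ l k lk); rewrite mxE.
have bd k : b k k != 0.
  by have := @trig_diag_unit _ _ _ k bt; rewrite unitmx_tr mxE; exact.
have cb k l : coordW (actW b (unitW k)) l = b l k.
  rewrite coord_actW (bigD1 k) //= coord_unitW eqxx mulr1 big1 ?addr0 // => m mk.
  by rewrite coord_unitW (negPf mk) mulr0.
have cbE (i : 'I_(2 * n + 1)) : coordW (actW b (unitW (flag_idx i))) =
    fun l => \sum_(j < 2 * n + 1) b (flag_idx j) (flag_idx i) * coordW (unitW (flag_idx j)) l.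
  apply/funext => l; rewrite cb; have [lf|lf] := ltnP l (2 * n + 1).
    rewrite (bigD1 (Ordinal lf)) //= coord_unitW.
    have -> : flag_idx (Ordinal lf) = l by apply: val_inj.
    rewrite eqxx mulr1 big1 ?addr0 // => j jl; rewrite coord_unitW.
    case: eqP => [lj|]; rewrite ?mulr0 //; case/eqP: jl; apply: val_inj => /=.
    by rewrite lj.
  rewrite bt0 ?(leq_trans (ltn_ord i)) // big1 // => j _; rewrite coord_unitW.
  case: eqP => [lj|]; rewrite ?mulr0 //; move: lf; rewrite lj leqNgt.
  by rewrite [X in (X < _)%N]/= ltn_ord.
rewrite act_funE /hw_fun E_fun_precomp !E_funE.
set q := linep (coordW (unitW _)) (coordW (unitW _)) (hess_det flag _).
set p := linep (coordW (unitW _)) (coordW (unitW _)) (mpoly_of_dhomog P).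
pose al := b (flag_idx j0) (flag_idx j0); pose be := b (flag_idx j1) (flag_idx j1).
pose ga := b (flag_idx j0) (flag_idx j1).
pose B : 'M[K]_(2 * n + 1) := \matrix_(i, j) b (flag_idx i) (flag_idx j).
have detB : \det B = \prod_(i < 2 * n + 1) b (flag_idx i) (flag_idx i).
  rewrite -det_tr det_trig; last first.
    by apply/is_trig_mxP => i j ij; rewrite !mxE bt0.
  by apply: eq_bigr => i _; rewrite !mxE.
have hessE : hess_det (map_tuple (actW b) flag) (mpoly_of_dhomog P) =
    (\det B ^+ 2)%:MP * hess_det flag (mpoly_of_dhomog P).
  rewrite /hess_det; set H := \matrix_(i, j) dderiv (tnth flag i) _.
  have -> : \matrix_(i, j) dderiv (tnth (map_tuple (actW b) flag) i)
      (dderiv (tnth (map_tuple (actW b) flag) j) (mpoly_of_dhomog P)) =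
      map_mx (@mpolyC N K) B^T *m H *m map_mx (@mpolyC N K) B.
    apply/matrixP => i j; rewrite !mxE !dderivE !tnth_map !tnth_ord_tuple !cbE.
    rewrite !dirder_vec_sum.
    under eq_bigr do rewrite (linear_sum (dirder _)) scaler_sumr.
    rewrite exchange_big; apply: eq_bigr => m _.
    rewrite !mxE mulr_suml; apply: eq_bigr => l _.
    by rewrite linearZ /= !mxE !dderivE !tnth_map !tnth_ord_tuple -!mul_mpolyC; ring.
  by rewrite !det_mulmx !det_map_mx det_tr expr2 rmorphM /=; ring.
pose v0 := coordW (unitW (flag_idx j1)); pose u0 := coordW (unitW (flag_idx j0)).
have uE : coordW (actW b (unitW (flag_idx j0))) = fun k => al * u0 k.
  apply/funext => l; rewrite cb /u0 coord_unitW; case: eqP => [->|/eqP l0].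
    by rewrite mulr1.
  by rewrite mulr0 bt0 // lt0n.
(* The component along u is written as a multiple of the new vector [al] u, the shape required by
   [linep_shift]. *)
have vE : coordW (actW b (unitW (flag_idx j1))) =
    fun k => ga / al * (al * u0 k) + be * v0 k.
  apply/funext => l; rewrite cb /u0 /v0 !coord_unitW mulrA mulfVK ?bd //.
  case: eqP => [->|/eqP l0]; first by rewrite mulr1 (_ : _ == _ = false) ?mulr0 ?addr0.
  rewrite mulr0 add0r; case: eqP => [->|/eqP l1]; first by rewrite mulr1.
  rewrite mulr0 bt0 // ltnNge; apply/negP => h.
  have : (l != 0 :> nat)%N by [].
  have : (l != 1 :> nat)%N by [].
  by move: h; rewrite /=; clear; lia.
have ne : (n <= e)%N by clear -n3; nia.
have n0 : (0 < n)%N by clear -n3; lia.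
have hP : mpoly_of_dhomog P \is n.-homog by exact: dhomog_is_dhomog.
have hQ : hess_det flag (mpoly_of_dhomog P) \is e.-homog by exact: hess_det_homog.
have hQ' : (\det B ^+ 2)%:MP * hess_det flag (mpoly_of_dhomog P) \is e.-homog.
  by rewrite mul_mpolyC; exact: rpredZ.
rewrite uE vE hessE !linep_shift residue_shift ?linep_size //.
rewrite (@residue_scale _ _ n0 ne _ al be (fun i => \det B ^+ 2 * q`_i)
  (fun i => p`_i)); last first.
- by move=> i ie; rewrite (@linep_scale K N n _ _ _ al be i hP (bd _)).
- move=> i ie; rewrite (@linep_scale K N e _ _ _ al be i hQ' (bd _)) //; congr (_ * _).
  by rewrite rmorphM /= [linep _ _ _%:MP]mmapC coefCM.
by rewrite residueZ // detB mulrA [_ * (_ ^+ 2)]mulrC.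
Qed.

Lemma hw_fun_neq0 : hw_fun <> cst 0.
Proof.
have ne : (n <= e)%N by clear -n3; nia.
have n0 : (0 < n)%N by clear -n3; lia.
pose X (i : 'I_(2 * n + 1)) : {mpoly K[N]} := 'X_(flag_idx i).
have X1 i : X i \is 1.-homog by rewrite dhomogX; apply/eqP; exact: mdeg1.
pose Sq := \sum_(i < 2 * n + 1 | (1 < i)%N) X i ^+ 2.
(* On the plane of u, v this form is x^(n-1) y, so p_n = 0 and by [residue_pn0] the value is, up to
   sign, the Hessian determinant at u. There the Hessian consists of a hyperbolic block with entries
   n - 1 and of 2's on the rest of the diagonal. *)
pose p := X j0 ^+ (n - 1) * X j1 + X j0 ^+ (n - 2) * Sq.
have XnH i m : X i ^+ m \is m.-homog by have := dhomogMn m (X1 i); rewrite mul1n.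
have hp : p \is n.-homog.
  apply: rpredD; first by have := dhomogM (XnH j0 (n - 1)%N) (X1 j1); rewrite subnK.
  have n2 : (2 <= n)%N by clear -n3; lia.
  have hS : Sq \is 2.-homog by apply: rpred_sum => i _; exact: XnH.
  by have := dhomogM (XnH j0 (n - 2)%N) hS; rewrite subnK.
pose P : SW := DHomog hp.
move=> h0; have {h0} := congr1 (fun F => F P) h0.
rewrite /hw_fun E_funE /=.
pose u0 := coordW (unitW (flag_idx j0)); pose v0 := coordW (unitW (flag_idx j1)).
have evX i k : (X i).@[coordW (unitW (flag_idx k))] = (i == k)%:R.
  by rewrite mevalXU coord_unitW (inj_eq flag_idx_inj).
have lin : linep u0 v0 p = 'X^(n - 1).
  apply: poly_fun_eq => s _; rewrite horner_linep hornerXn.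
  have evs i : (X i).@[fun k => u0 k * s + v0 k] = (i == j0)%:R * s + (i == j1)%:R.
    by rewrite mevalXU /u0 /v0 !coord_unitW !(inj_eq flag_idx_inj).
  have S0 : Sq.@[fun k => u0 k * s + v0 k] = 0.
    rewrite raddf_sum big1 //= => i i1; rewrite rmorphXn /= evs.
    rewrite -!val_eqE /= !gtn_eqF // ?mul0r ?addr0 ?expr0n //.
    exact: leq_trans i1.
  rewrite mevalD !mevalM !rmorphXn /= !evs S0 mulr0 addr0 eqxx mul1r.
  by rewrite -!val_eqE /= mul0r add0r addr0 mulr1.
rewrite residue_pn0 //; last by rewrite -/u0 -/v0 lin coefXn; case: eqP => //; clear -n3; lia.
rewrite -/u0 -/v0 lin coefXn eqxx expr1n mulr1.
have hQ : hess_det flag p \is e.-homog by exact: hess_det_homog.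
rewrite (linep_top _ _ hQ) eval_hess.
pose d (i : 'I_(2 * n + 1)) := coordW (unitW (flag_idx i)).
have dX a i : dirder (d a) (X i) = ((i == a)%:R)%:MP.
  by rewrite dirderX /d coord_unitW (inj_eq flag_idx_inj).
have dS b : dirder (d b) Sq = \sum_(i < 2 * n + 1 | (1 < i)%N) (X i * ((i == b)%:R)%:MP) *+ 2.
  by rewrite (linear_sum (dirder _)); apply: eq_bigr => i _; rewrite /= dirderXn dX expr1.
have dS0 b : (dirder (d b) Sq).@[u0] = 0.
  rewrite dS raddf_sum big1 //= => i i1; rewrite mevalMn mevalM evX -val_eqE /=.
  by rewrite gtn_eqF ?mul0r ?mul0rn // (leq_trans _ i1).
have S0 : Sq.@[u0] = 0.
  rewrite raddf_sum big1 //= => i i1; rewrite rmorphXn /= evX -val_eqE /=.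
  by rewrite gtn_eqF ?expr0n // (leq_trans _ i1).
have ddS a b : (dirder (d a) (dirder (d b) Sq)).@[u0] = ((1 < a)%N && (a == b))%:R *+ 2.
  rewrite dS (linear_sum (dirder _)) (raddf_sum (meval _)) /=.
  under eq_bigr do rewrite (raddfMn (dirder _)) /=
    dirderM dX dirderC mulr0 addr0 mevalMn mevalM !mevalC.
  rewrite sumrMnl; congr (_ *+ 2); case: ltnP => a1 /=.
    rewrite (bigD1 a) //= eqxx mul1r big1 ?addr0 // => i /andP[_ /negPf ->].
    by rewrite mul0r.
  rewrite big1 // => i i1; case: eqP => [ia|]; rewrite ?mul0r //.
  by move: i1; rewrite ia ltnNge a1.
have jn : (j1 == j0) = false by [].
have dd a b : (dirder (d a) (dirder (d b) p)).@[u0] =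
    ((n - 1)%:R * ((b == j0) && (a == j1) || (a == j0) && (b == j1))%:R +
     ((1 < a)%N && (a == b))%:R *+ 2).
  rewrite /p !(linearD (dirder _)) /= !dirderM !(linearD (dirder _)) /= !dirderM.
  rewrite !dX !dirderC mulr0 addr0 !mevalD !mevalM ddS !dS0 S0 !mulr0 !addr0 !mevalC.
  rewrite !evX jn !mulr0 !add0r !dirderXn !dX !mevalMn !mevalM !rmorphXn /= !mevalC.
  rewrite !evX eqxx !expr1n !mul1r.
  rewrite [j0 == a]eq_sym [j0 == b]eq_sym [j1 == a]eq_sym [j1 == b]eq_sym.
  have [->|a0] := eqVneq a j0; have [->|b0] := eqVneq b j0;
    rewrite ?eqxx ?jn ?andbF ?andbT ?mulr0 ?mul0rn ?mul0r ?add0r ?mulr1 ?mul1r ?addr0 //=;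
    rewrite ?(eq_sym j0) ?jn ?mulr0 ?mul0rn ?mul0r ?add0r ?addr0 ?orbF //.
set H := \matrix_(i, j) _.
have HE a b : H a b = ((n - 1)%:R * ((b == j0) && (a == j1) || (a == j0) && (b == j1))%:R +
     ((1 < a)%N && (a == b))%:R *+ 2).
  by rewrite mxE !tnth_map !tnth_ord_tuple; exact: dd.
have dH : \det H != 0.
  apply/det0P => -[c cn0 cH].
  have n1 : (n - 1)%:R != 0 :> K by rewrite pnatr_eq0; clear -n3; lia.
  case/eqP: cn0; apply/rowP => b; rewrite mxE.
  have cHE a : \sum_k c 0 k * H k a = 0.
    by have := congr1 (fun r : 'rV_(2 * n + 1) => r 0 a) cH; rewrite !mxE.
  have [b0|b0] := eqVneq b j0.
    have := cHE j1; rewrite (bigD1 j0) //= HE eqxx /=; rewrite mulr1 mul0rn addr0 big1 ?addr0.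
      by rewrite b0 => /eqP; rewrite mulf_eq0 (negPf n1) orbF => /eqP.
    move=> k kj; rewrite HE jn (negPf kj) /= mulr0 add0r.
    by case: eqP => [->|]; rewrite ?andbF ?mul0rn ?mulr0.
  have [b1|b1] := eqVneq b j1.
    have := cHE j0; rewrite (bigD1 j1) //= HE eqxx /=; rewrite mulr1 mul0rn addr0 big1 ?addr0.
      by rewrite b1 => /eqP; rewrite mulf_eq0 (negPf n1) orbF => /eqP.
    move=> k kj; rewrite HE (negPf kj) eqxx /= [j0 == j1]eq_sym jn andbF mulr0 add0r.
    by case: eqP => [->|]; rewrite ?andbF ?mul0rn ?mulr0.
  have b2 : (1 < b)%N.
    by move: b0 b1; rewrite -!val_eqE /=; case: (b : nat) => [|[|]].
  have := cHE b; rewrite (bigD1 b) //= HE (negPf b0) (negPf b1) !andbF mulr0 add0r.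
  rewrite b2 eqxx /= big1 ?addr0 => [/eqP|k kb].
    by rewrite -mulr_natr mul1r mulf_eq0 pnatr_eq0 orbF => /eqP.
  by rewrite HE (negPf b0) (negPf b1) !andbF mulr0 add0r (negPf kb) andbF mul0rn mulr0.
by move=> /eqP; rewrite mulf_eq0 signr_eq0 /= (negPf dH).
Qed.

End HighestWeightVector.

Lemma hw_fun_highest_weight (C : numClosedFieldType) n (n3 : (3 <= n)%N) :
  highest_weight_vector
    (fund_weight (n * n) 1 *+ (2 * n * (n - 1) * (n - 2))
     + fund_weight (n * n) 2 *+ (2 * n ^ 2 - 4 * n - 1)
     + fund_weight (n * n) (2 * n + 1) *+ 2) (@hw_fun C n n3).
Proof.
split; first exact: hw_fun_neq0.
move=> b bu bt; apply/funext => P; rewrite hw_fun_weight //; congr (_ * _).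
have bd k : b k k != 0.
  by have := @trig_diag_unit _ _ _ k bt; rewrite unitmx_tr mxE; exact.
have fw i m : \prod_(k < n * n) b k k ^ ((@fund_weight (n * n) i k) *+ m) =
    (\prod_(k < n * n | (k < i)%N) b k k) ^+ m.
  rewrite -prodrXl [RHS]big_mkcond; apply: eq_bigr => k _; rewrite ffunE.
  by case: ifP => _; rewrite ?mul0rn ?expr0z // natz -exprnP.
have -> : \prod_(k < n * n) b k k ^ ((fund_weight (n * n) 1 *+ (2 * n * (n - 1) * (n - 2))
     + fund_weight (n * n) 2 *+ (2 * n ^ 2 - 4 * n - 1)
     + fund_weight (n * n) (2 * n + 1) *+ 2) k) =
   (\prod_(k < n * n | (k < 1)%N) b k k) ^+ (2 * n * (n - 1) * (n - 2)) *
   (\prod_(k < n * n | (k < 2)%N) b k k) ^+ (2 * n ^ 2 - 4 * n - 1) *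
   (\prod_(k < n * n | (k < 2 * n + 1)%N) b k k) ^+ 2.
  rewrite -!fw -!big_split; apply: eq_bigr => k _ /=.
  have fD (f g : {ffun 'I_(n * n) -> int}) : (f + g) k = f k + g k by rewrite ffunE.
  by rewrite !fD !ffunMnE !expfzDr.
have h21 : (2 * n + 1 <= n * n)%N := flag_le n3.
have h20 : (0 < 2 * n + 1)%N by rewrite addn1.
have h22 : (1 < 2 * n + 1)%N by clear -n3; lia.
have e3 : \prod_(k < n * n | (k < 2 * n + 1)%N) b k k =
    \prod_(i < 2 * n + 1) b (flag_idx n3 i) (flag_idx n3 i).
  rewrite (big_ord_narrow h21); apply: eq_bigr => i _.
  by have -> : widen_ord h21 i = flag_idx n3 i by apply: val_inj.
have e1 : \prod_(k < n * n | (k < 1)%N) b k k =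
    b (flag_idx n3 (Ordinal h20)) (flag_idx n3 (Ordinal h20)).
  rewrite (big_ord_narrow (leq_trans h20 h21)) big_ord1; congr (b _ _); exact: val_inj.
have e2 : \prod_(k < n * n | (k < 2)%N) b k k =
    b (flag_idx n3 (Ordinal h20)) (flag_idx n3 (Ordinal h20)) *
    b (flag_idx n3 (Ordinal h22)) (flag_idx n3 (Ordinal h22)).
  rewrite (big_ord_narrow (leq_trans h22 h21)) big_ord_recl big_ord1.
  by congr (b _ _ * b _ _); exact: val_inj.
rewrite e1 e2 e3.
have -> : Ordinal (flag0_lt n) = Ordinal h20 by apply: val_inj.
have -> : Ordinal (flag1_lt n3) = Ordinal h22 by apply: val_inj.
have -> : ((2 * n + 1) * (n - 2) - (n - 1) = 2 * n ^ 2 - 4 * n - 1)%N by clear -n3; nia.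
(* The first diagonal entry occurs in both fundamental weights 1 and 2, so its exponent is split
   accordingly; the second occurs only in weight 2. The common factor from det(B)^2 is the weight of
   index 2n + 1. *)
have -> : (n * (2 * n ^ 2 - 4 * n - 1) + (n - 1) =
   2 * n * (n - 1) * (n - 2) + (2 * n ^ 2 - 4 * n - 1))%N by clear -n3; nia.
move: (b _ _) (b _ _) (\prod_i _) => x y z.
move: (2 * n * (n - 1) * (n - 2))%N (2 * n ^ 2 - 4 * n - 1)%N => r s.
by rewrite exprD (exprMn s y x); ring.
Qed.

(** * The Hessian of the determinant *)

Section PolynomialCurves.
Variable K : numFieldType.

Lemma deriv_mmap N (h : 'I_N -> {poly K}) (p : {mpoly K[N]}) :
  (mmap polyC h p)^`() = \sum_k mmap polyC h p^`M(k) * (h k)^`().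
Proof.
pose ev := mmap (@polyC K) h.
pose Q p := (ev p)^`() = \sum_k ev p^`M(k) * (h k)^`().
have Q0 c : Q c%:MP.
  rewrite /Q /ev mmapC derivC big1 // => k _; by rewrite mderivC mmap0 mul0r.
have QD p1 q1 : Q p1 -> Q q1 -> Q (p1 + q1).
  rewrite /Q /ev => h1 h2; rewrite mmapD derivD h1 h2 -big_split; apply: eq_bigr => k _ /=.
  by rewrite mderivD mmapD mulrDl.
have QM p1 q1 : Q p1 -> Q q1 -> Q (p1 * q1).
  rewrite /Q /ev => h1 h2; rewrite (rmorphM (mmap _ h)) derivM /= h1 h2 mulr_suml mulr_sumr.
  rewrite -big_split; apply: eq_bigr => k _ /=.
  by rewrite mderivM mmapD !(rmorphM (mmap _ h)) /=; ring.
have QX i : Q 'X_i.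
  rewrite /Q /ev mmapX mmap1U (bigD1 i) //= big1 ?addr0 => [|k ki].
    rewrite mderivX mnm1E eqxx scale1r.
    have -> : (U_(i) - U_(i))%MM = 0%MM by apply/mnmP => j; rewrite mnmBE subnn mnm0E.
    by rewrite mpolyX0 rmorph1 mul1r.
  by rewrite mderivX mnm1E eq_sym (negPf ki) scale0r mmap0 mul0r.
rewrite -/(Q p); elim/mpolyind: p => [|c m p _ _ hp]; first by rewrite -mpolyC0.
apply: (QD) => //; rewrite -mul_mpolyC; apply: (QM) => //.
rewrite mpolyXE_id; apply: (big_ind Q); [by rewrite -mpolyC1; exact: Q0|exact: QM|].
move=> i _; move: (m i) => k; elim: k => [|k IH]; first by rewrite expr0 -mpolyC1; exact: Q0.
by rewrite exprS; exact: QM.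
Qed.

Lemma horner_mmap N (h : 'I_N -> {poly K}) (p : {mpoly K[N]}) x :
  (mmap polyC h p).[x] = p.@[fun k => (h k).[x]].
Proof.
rewrite /mmap horner_sum mevalE; apply: eq_bigr => m _.
rewrite hornerM hornerC; congr (_ * _); rewrite /mmap1 horner_prod.
by apply: eq_bigr => i _; rewrite horner_exp.
Qed.

Lemma mmap_coef1 N (h : 'I_N -> {poly K}) (p : {mpoly K[N]}) :
  (mmap polyC h p)`_1 = (dirder (fun k => (h k)`_1) p).@[fun k => (h k)`_0].
Proof.
have d1 (q : {poly K}) : q`_1 = (q^`()).[0] by rewrite horner_coef0 coef_deriv mulr1n.
rewrite d1 deriv_mmap horner_sum raddf_sum; apply: eq_bigr => k _ /=.
rewrite hornerM horner_mmap mevalZ mulrC -d1; congr (_ * _).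
by apply: meval_eq => i; rewrite horner_coef0.
Qed.

Section Forms.
Variables (N d : nat).
Notation S := (homform K N d).

Lemma curve_decomp e (Phi : K -> S) :
  gam (@polfun K) e (fun s => mpoly_of_dhomog (Phi s)) ->
  exists v : 'I_e.+1 -> S, forall s, Phi s = \sum_(i < e.+1) s ^+ i *: v i.
Proof.
move=> hP; pose nm (i : 'I_#|{: monom N d}|) : 'X_{1..N} := bmnm (val (enum_val i)).
have /choice[b hb] : forall i, exists r : {poly K}, (size r <= e.+1)%N /\
    forall s, (mpoly_of_dhomog (Phi s))@_(nm i) = r.[s].
  by move=> i; have [r rs hr] := hP (nm i); exists r.
exists (fun k => form_of_coefs (\row_i (b i)`_k)) => s; apply: form_coefs_inj.
have -> : form_coefs (\sum_(k < e.+1) s ^+ k *: form_of_coefs (\row_i (b i)`_k)) =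
    \sum_(k < e.+1) s ^+ k *: \row_i (b i)`_k.
  have fl a P Q := @form_coefs_linear K N d a P Q.
  have f0 : form_coefs (0 : S) = 0 by apply/rowP => j; rewrite !mxE /= mcoeff0.
  have fD : {morph (@form_coefs K N d) : P Q / P + Q}.
    by move=> P Q; rewrite -[P]scale1r fl !scale1r.
  rewrite (big_morph _ fD f0); apply: eq_bigr => k _.
  by rewrite -[_ *: form_of_coefs _]addr0 fl f0 addr0 form_of_coefsK.
apply/rowP => i; rewrite mxE summxE; have [bs ->] := hb i.
rewrite (horner_coef_wide _ bs); apply: eq_bigr => k _; by rewrite !mxE mulrC.
Qed.

Lemma subspace_sum (U : S -> Prop) m (w : 'I_m -> K) (v : 'I_m -> S) :
  U 0 -> (forall a P Q, U P -> U Q -> U (a *: P + Q)) ->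
  (forall i, U (v i)) -> U (\sum_i w i *: v i).
Proof.
move=> U0 UP hv; elim: m w v hv => [|m IH] w v hv; first by rewrite big_ord0.
by rewrite big_ord_recl; apply: UP => //; exact: IH.
Qed.

Lemma curve_coef e (v : 'I_e.+1 -> S) (h : 'I_e.+1) :
  exists (t w : 'I_e.+1 -> K), (forall i, t i != 0) /\
    v h = \sum_j w j *: \sum_(i < e.+1) t j ^+ i *: v i.
Proof.
have [t [w [ht hw]]] := @interpolation K 1 e h (oner_neq0 _).
exists t, w; split=> [i|]; first by case: (ht i).
under eq_bigr do rewrite scaler_sumr; rewrite exchange_big /=.
rewrite (bigD1 h) //= [X in _ + X]big1 ?addr0 => [|i ih].
  under eq_bigr do rewrite scalerA; rewrite -scaler_suml.
  have := hw 'X^h; rewrite size_polyXn ltn_ord => /(_ isT); rewrite coefXn eqxx.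
  by under eq_bigr do rewrite hornerXn; move=> <-; rewrite scale1r.
under eq_bigr do rewrite scalerA; rewrite -scaler_suml.
have := hw 'X^i; rewrite size_polyXn ltn_ord => /(_ isT); rewrite coefXn.
rewrite -val_eqE eq_sym in ih; rewrite (negPf ih).
by under eq_bigr do rewrite hornerXn; move=> <-; rewrite scale0r.
Qed.

(** By interpolation, coefficients of a curve are combinations of its values at nonzero parameters.
    Torus components thus stay in any stable subspace. *)
Lemma subspace_curve (U : S -> Prop) e (v : 'I_e.+1 -> S) :
  U 0 -> (forall a P Q, U P -> U Q -> U (a *: P + Q)) ->
  (forall s, s != 0 -> U (\sum_(i < e.+1) s ^+ i *: v i)) -> forall i, U (v i).
Proof.
move=> U0 UP hv i; have [t [w [ht ->]]] := curve_coef v i.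
by apply: subspace_sum => // j; exact: hv.
Qed.

Lemma curve_eq e (v w : 'I_e.+1 -> S) :
  (forall s, s != 0 -> \sum_(i < e.+1) s ^+ i *: v i = \sum_(i < e.+1) s ^+ i *: w i) -> v =1 w.
Proof.
move=> h i; apply/eqP; rewrite -subr_eq0; apply/eqP.
apply: (@subspace_curve (fun P => P = 0) e (fun i => v i - w i)) => //.
  by move=> a P Q -> ->; rewrite scaler0 addr0.
move=> s s0; under eq_bigr do rewrite scalerBr; by rewrite sumrB h // subrr.
Qed.

Lemma precomp_poly_curve A (G : K -> 'M[K]_N) (P : S) :
  (forall k l, polfun A (fun s => G s k l)) ->
  gam (@polfun K) (d * A) (fun s => mpoly_of_dhomog (precomp (G s) P)).
Proof.
move=> hG; have := @gam_comp _ _ _ (polfun_graded K) N N 0 A (fun=> mpoly_of_dhomog P)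
  (fun k s => \sum_(l < N) G s k l *: 'X_l) d.
rewrite add0n; apply; [by move=> s; exact: (dhomog_is_dhomog P)|exact: (gam_cst
  (polfun_graded K))|].
move=> i; apply: gam_sum => [|l _]; first exact: polfun_graded.
rewrite -[A]addn0; apply: gamZ; [exact: polfun_graded|exact: hG|].
exact: (gam_cst (polfun_graded K)).
Qed.

Definition has_deriv (F : S -> K) (P Q : S) (c : K) : Prop :=
  exists2 r : {poly K}, (forall s, F (P + s *: Q) = r.[s]) & r`_1 = c.

Definition grad (p : {mpoly K[\dim {:S}]}) (P Q : S) : K :=
  (dirder (coords Q) p).@[coords P].

Lemma gradP p P a Q R : grad p P (a *: Q + R) = a * grad p P Q + grad p P R.
Proof.
rewrite /grad -mevalZ -mevalD -dirder_vec_lin; congr (meval _ (dirder _ _)).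
by apply/funext => i; rewrite /coords linearP.
Qed.

Lemma has_deriv_grad (F : S -> K) p P Q c : (forall v, F v = p.@[coords v]) ->
  has_deriv F P Q c <-> grad p P Q = c.
Proof.
move=> hF; pose h i : {poly K} := (coords P i)%:P + coords Q i *: 'X.
have hE s : F (P + s *: Q) = (mmap polyC h p).[s].
  rewrite hF horner_mmap; apply: meval_eq => i.
  by rewrite /h !hornerE /coords linearD linearZ /= mulrC.
have gE : (mmap polyC h p)`_1 = grad p P Q.
  rewrite mmap_coef1 /grad; congr (meval _ (dirder _ _)); apply/funext => i.
    by rewrite /h coefD coefC coefZ coefX mulr0 addr0.
  by rewrite /h coefD coefC coefZ coefX add0r mulr1.
split=> [[r hr rc]|gc]; last by exists (mmap polyC h p); rewrite // gE.
rewrite -rc -gE; suff -> : r = mmap polyC h p by [].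
by apply: poly_fun_eq => s _; rewrite -hE hr.
Qed.

Lemma grad_curve (F : S -> K) p e (v : 'I_e.+2 -> S) : (forall v, F v = p.@[coords v]) ->
  exists2 r : {poly K}, (forall s, F (\sum_(i < e.+2) s ^+ i *: v i) = r.[s]) &
    r`_1 = grad p (v ord0) (v (lift ord0 ord0)).
Proof.
move=> hF; pose h j : {poly K} := \poly_(i < e.+2) coords (v (inord i)) j.
exists (mmap polyC h p).
  move=> s; rewrite hF horner_mmap; apply: meval_eq => j.
  rewrite /h horner_poly /coords linear_sum; apply: eq_bigr => i _.
  by rewrite linearZ /= inord_val mulrC.
rewrite mmap_coef1 /grad; congr (meval _ (dirder _ _)); apply/funext => j;
  rewrite /h coef_poly /=; congr (coords (v _) j); apply: val_inj; rewrite /= inordK //.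
Qed.

End Forms.
End PolynomialCurves.

Section DetHessian.
Variables (K : numFieldType) (n : nat).
Notation N := (n * n)%N.
Notation W := 'M[K]_n.
Notation PW := {mpoly K[N]}.

Lemma dirder_prod (a : 'I_N -> K) m (F : 'I_m -> PW) :
  dirder a (\prod_i F i) = \sum_i dirder a (F i) * \prod_(k | i != k) F k.
Proof.
have gen (r : seq 'I_m) : uniq r -> dirder a (\prod_(i <- r) F i) =
    \sum_(i <- r) dirder a (F i) * \prod_(k <- r | i != k) F k.
  elim: r => [|i r IH] /=; first by rewrite !big_nil -mpolyC1 dirderC.
  move=> /andP[ir ur]; rewrite !big_cons dirderM IH // eqxx /=; congr (_ + _).
    congr (_ * _); rewrite [RHS]big_seq_cond [LHS]big_seq; apply: eq_bigl => k.
    by case kr: (k \in r) => //=; case: eqP => // ik; rewrite ik kr in ir.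
  rewrite mulr_sumr big_seq [RHS]big_seq; apply: eq_bigr => k kr.
  rewrite big_cons; have -> : (k != i) by apply: contraNneq ir => <-.
  by rewrite mulrCA.
exact: gen (index_enum_uniq _).
Qed.

Lemma dirder_det (a : 'I_N -> K) m (M : 'M[PW]_m) :
  dirder a (\det M) = \sum_i \sum_j dirder a (M i j) * cofactor M i j.
Proof.
have sgn (b : bool) (x : PW) : dirder a ((-1) ^+ b * x) = (-1) ^+ b * dirder a x.
  by case: b; rewrite ?expr1 ?expr0 ?mul1r // !mulN1r linearN.
rewrite (linear_sum (dirder a)).
transitivity (\sum_(s : 'S_m) \sum_i (-1) ^+ s * (dirder a (M i (s i)) *
    \prod_(k | i != k) M k (s k))).
  by apply: eq_bigr => s _; rewrite /= sgn dirder_prod mulr_sumr.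
rewrite exchange_big; apply: eq_bigr => i _.
under [RHS]eq_bigr do rewrite expand_cofactor mulr_sumr.
rewrite (partition_big (fun s : 'S_m => s i) predT) //=; apply: eq_bigr => j _.
apply: eq_bigr => s /eqP <-; by rewrite mulrCA.
Qed.

(** The first derivative is the expansion by cofactors. The derivative of the adjugate then comes
    from differentiating X adj(X) = det(X) and multiplying by the inverse of w. *)
Lemma hess_det_formula (B D w : W) : w \in unitmx ->
  (dirder (coordW B) (dirder (coordW D) (det_poly K n))).@[coordW w] =
  \det w * (\tr (invmx w *m B) * \tr (invmx w *m D)
    - \tr (invmx w *m B *m invmx w *m D)).
Proof.
move=> wu.
have dgen (X : W) i j : dirder (coordW X) (genmx K n i j) = (X i j)%:MP.
  by rewrite mxE dirderX coordWE.
have ddet (X : W) : dirder (coordW X) (det_poly K n) =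
    \sum_i \sum_j (X i j)%:MP * (\adj (genmx K n)) j i.
  rewrite dirder_det; apply: eq_bigr => i _; apply: eq_bigr => j _.
  by rewrite dgen [(\adj _) j i]mxE.
pose ev (M : 'M[PW]_n) : W := map_mx (meval (coordW w)) M.
have evadj : ev (\adj (genmx K n)) = \det w *: invmx w.
  rewrite /ev map_mx_adj /= eval_genmx.
  have : w *m \adj w = (\det w)%:M by exact: mul_mx_adj.
  move=> /(congr1 (mulmx (invmx w))); rewrite mulKmx // => ->.
  by rewrite mul_mx_scalar.
have evddet (X : W) : (dirder (coordW X) (det_poly K n)).@[coordW w] =
    \det w * \tr (invmx w *m X).
  rewrite ddet raddf_sum mxtrace_mulC /mxtrace mulr_sumr; apply: eq_bigr => i _.
  rewrite /= raddf_sum mxE mulr_sumr; apply: eq_bigr => j _ /=.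
  rewrite mevalM mevalC.
  have -> : ((\adj (genmx K n)) j i).@[coordW w] = ev (\adj (genmx K n)) j i by rewrite [RHS]mxE.
  by rewrite evadj mxE; ring.
pose dA : 'M[K]_n := \matrix_(j, i) (dirder (coordW B) ((\adj (genmx K n)) j i)).@[coordW w].
(* The differentiated identity X adj(X) = det(X) at w in the direction B. *)
have dAE : w *m dA = (\det w * \tr (invmx w *m B))%:M - B *m (\det w *: invmx w).
  apply/matrixP => i k.
  have : (dirder (coordW B) ((genmx K n *m \adj (genmx K n)) i k)).@[coordW w] =
      ((\det w * \tr (invmx w *m B))%:M : W) i k.
    rewrite mul_mx_adj mxE mxE (raddfMn (dirder _)) mevalMn; by rewrite evddet.
  rewrite [(_ *m _) i k]mxE (linear_sum (dirder _)) (raddf_sum (meval _)) /= => h.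
  rewrite [RHS]mxE -h [X in _ = _ + X]mxE [LHS]mxE [X in _ = _ - X]mxE.
  rewrite -[LHS](addrK (\sum_j B i j * (\det w *: invmx w) j k)); congr (_ - _).
  rewrite -big_split; apply: eq_bigr => j _ /=.
  rewrite dirderM mevalD !mevalM dgen mevalC -evadj [dA j k]mxE [ev _ j k]mxE addrC.
  by rewrite [genmx K n i j]mxE mevalXU coordWE.
have dAE' : dA = invmx w *m ((\det w * \tr (invmx w *m B))%:M - B *m (\det w *: invmx w)).
  by rewrite -dAE mulKmx.
rewrite ddet (linear_sum (dirder _)) (raddf_sum (meval _)) /=.
transitivity (\tr (D *m dA)).
  apply: eq_bigr => i _; rewrite (linear_sum (dirder _)) (raddf_sum (meval _)) mxE /=.
  apply: eq_bigr => j _; rewrite dirderM dirderC mul0r add0r mevalM mevalC.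
  by rewrite [dA j i]mxE.
rewrite dAE' mxtrace_mulC mulmxBr mul_mx_scalar -!scalemxAr !mulmxA mulmxBl -!scalemxAl.
by rewrite linearB !linearZ /=; ring.
Qed.

End DetHessian.

(** * Linearized equations at the determinant *)

Section MonomialMatrices.
Variable R : comNzRingType.

Definition monomial_mx m (s : 'S_m) (d : 'I_m -> R) : 'M[R]_m :=
  \matrix_(i, j) (d i *+ (s i == j)).

Lemma det_monomial_mx m (s : 'S_m) d :
  \det (monomial_mx s d) = (-1) ^+ s * \prod_i d i.
Proof.
have -> : monomial_mx s d = diag_mx (\row_i d i) *m perm_mx s.
  apply/matrixP => i j; rewrite mul_diag_mx !mxE.
  by case: eqP; rewrite ?mulr1 ?mulr0.
rewrite det_mulmx det_diag det_perm mulrC; congr (_ * _).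
by apply: eq_bigr => i _; rewrite mxE.
Qed.

Lemma cofactor_row_indep m (A B : 'M[R]_m) i j :
  (forall k, k != i -> row k A = row k B) -> cofactor A i j = cofactor B i j.
Proof.
move=> h; rewrite /cofactor; congr (_ * \det _).
apply/matrixP => a b; rewrite !mxE.
have := h (lift i a) _; rewrite eq_sym neq_lift => /(_ isT)/rowP/(_ (lift j b)).
by rewrite !mxE.
Qed.

(** Row and column r of the monomial matrix are zero. In the expansion along row r each entry is
    already of first order, so the cofactors count at order 0 only, and all but the one at (r, r)
    vanish there. *)
Lemma det_monomial_deriv m (s : 'S_m) (d : 'I_m -> R) (H : 'M[R]_m) r :
  s r = r -> d r = 0 ->
  (\det (map_mx polyC (monomial_mx s d) + 'X *: map_mx polyC H))`_1 =
  (-1) ^+ s * (\prod_(i | i != r) d i) * H r r.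
Proof.
move=> sr dr; set M := _ + _.
have Mr b : M r b = (H r b)%:P * 'X.
  by rewrite !mxE dr mul0rn add0r mulrC.
have coef1 c (x : {poly R}) : (c%:P * 'X * x)`_1 = c * x`_0.
  by rewrite -mulrA coefCM coefXM.
rewrite (expand_det_row M r) coef_sum.
have cof0 b : (cofactor M r b)`_0 = cofactor (monomial_mx s d) r b.
  rewrite -horner_coef0 -/(horner_eval 0 _) -cofactor_map_mx; congr (cofactor _ r b).
  by apply/matrixP => i j; rewrite !mxE /= /horner_eval !hornerE.
have cofb b : b != r -> cofactor (monomial_mx s d) r b = 0.
  move=> br; pose A : 'M[R]_m := \matrix_(i, j)
    (if i == r then (j == b)%:R else monomial_mx s d i j).
  have -> : cofactor (monomial_mx s d) r b = cofactor A r b.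
    by apply: cofactor_row_indep => k kr; apply/rowP => j; rewrite !mxE (negPf kr).
  have <- : \det A = cofactor A r b.
    rewrite (expand_det_row A r) (bigD1 b) //= mxE !eqxx mul1r big1 ?addr0 // => j jb.
    by rewrite mxE eqxx (negPf jb) mul0r.
  rewrite (expand_det_col A r) big1 // => i _; rewrite mxE.
  case: eqP => [_|/eqP ir]; first by rewrite eq_sym (negPf br) mul0r.
  rewrite mxE (_ : s i == r = false) ?mul0r //.
  by rewrite -[X in _ == X]sr (inj_eq perm_inj) (negPf ir).
have cofr : cofactor (monomial_mx s d) r r = (-1) ^+ s * \prod_(i | i != r) d i.
  pose d1 i := if i == r then 1 else d i.
  have -> : cofactor (monomial_mx s d) r r = cofactor (monomial_mx s d1) r r.
    by apply: cofactor_row_indep => k kr; apply/rowP => j; rewrite !mxE /d1 (negPf kr).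
  have <- : \det (monomial_mx s d1) = cofactor (monomial_mx s d1) r r.
    rewrite (expand_det_row _ r) (bigD1 r) //= mxE sr eqxx /d1 eqxx mulr1n mul1r.
    rewrite big1 ?addr0 // => j jr.
    by rewrite mxE sr eq_sym (negPf jr) mulr0n mul0r.
  rewrite det_monomial_mx (bigD1 r) //= {1}/d1 eqxx mul1r; congr (_ * _).
  by apply: eq_bigr => i ir; rewrite /d1 (negPf ir).
rewrite (bigD1 r) //= big1 ?addr0 => [|b br].
  by rewrite Mr coef1 cof0 cofr mulrC.
by rewrite Mr coef1 cof0 cofb // mulr0.
Qed.

End MonomialMatrices.

Lemma dirderZ (K : fieldType) N (a : 'I_N -> K) c p : dirder a (c *: p) = c *: dirder a p.
Proof. exact: linearZ. Qed.

(** * The line through diag(1,..,1,0) and the linearized equation there *)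

Section CorankOne.
Variables (K : numFieldType) (n : nat).
Hypothesis n3 : (3 <= n)%N.
Notation N := (n * n)%N.
Notation W := 'M[K]_n.
Notation SW := (homform K N n).
Notation e := ((2 * n + 1) * (n - 2))%N.

Fact first_lt : (0 < n)%N. Proof. exact: leq_trans n3. Qed.
Fact last_lt : (n.-1 < n)%N. Proof. by rewrite prednK // first_lt. Qed.
Definition fst_idx : 'I_n := Ordinal first_lt.
Definition lst_idx : 'I_n := Ordinal last_lt.
Notation o := fst_idx.
Notation l := lst_idx.

Lemma fst_lst : (o == l) = false.
Proof. by rewrite -val_eqE /=; case: eqP => //; move: n3; clear; lia. Qed.

Definition corank1 : W := \matrix_(i, j) ((i == j) && (i != l))%:R.

Variable j : 'I_n.
Hypotheses (j_gt0 : j != o) (j_lt : j != l).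

Definition kvec : W := delta_mx o j + delta_mx j o.

(* A frame adapted to the Hessian of det at diag(1,..,1,0): [inl a] and [inr a] *)
(* are dual to each other up to sign, and [None] spans a line of the kernel.    *)
Definition frame (x : option ('I_n + 'I_n)) : W :=
  match x with
  | Some (inl a) => delta_mx l a
  | Some (inr b) => if b == l then delta_mx o o else delta_mx b l
  | None => kvec
  end.

Definition pairing (x : option ('I_n + 'I_n)) : option ('I_n + 'I_n) :=
  match x with
  | Some (inl a) => Some (inr a)
  | Some (inr b) => Some (inl b)
  | None => None
  end.

Lemma pairingK : involutive pairing.
Proof. by case=> [[]|]. Qed.

Definition sgl (a : 'I_n) : K := if a == l then 1 else -1.

(** By [hess_det_formula], this is the Hessian of det at a diagonal matrix divided by its
    determinant, [dl] being the diagonal of the inverse. *)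
Definition bform (dl : 'I_n -> K) (B D : W) : K :=
  (\sum_i dl i * B i i) * (\sum_i dl i * D i i) -
  \sum_i \sum_k dl i * B i k * (dl k * D k i).

Lemma bform_delta dl (a b c d : 'I_n) :
  bform dl (delta_mx a b) (delta_mx c d) =
  dl a * dl c * ((a == b) && (c == d))%:R - dl a * dl b * ((b == c) && (a == d))%:R.
Proof.
have tr a' b' : \sum_i dl i * (delta_mx a' b' : W) i i = dl a' * (a' == b')%:R.
  rewrite (bigD1 a') //= mxE eqxx /= big1 ?addr0 // => i ia.
  by rewrite mxE (negPf ia) mulr0.
rewrite /bform !tr; congr (_ - _).
  by case: (a == b); case: (c == d); rewrite ?mulr1 ?mulr0 ?mul0r.
rewrite (bigD1 a) //= (bigD1 b) //= !mxE !eqxx /= mulr1.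
rewrite [X in _ + X + _]big1 ?addr0; last first.
  by move=> k kb; rewrite !mxE (negPf kb) andbF mulr0 mul0r.
rewrite big1 ?addr0; last first.
  by move=> i ia; rewrite big1 // => k _; rewrite !mxE (negPf ia) mulr0 mul0r.
by rewrite mulrA.
Qed.

Lemma bformDl dl B B' D : bform dl (B + B') D = bform dl B D + bform dl B' D.
Proof.
rewrite /bform.
have -> : \sum_i dl i * (B + B') i i = \sum_i dl i * B i i + \sum_i dl i * B' i i.
  by rewrite -big_split; apply: eq_bigr => i _; rewrite mxE mulrDr.
have -> : \sum_i \sum_k dl i * (B + B') i k * (dl k * D k i) =
   \sum_i \sum_k dl i * B i k * (dl k * D k i) + \sum_i \sum_k dl i * B' i k * (dl k * D k i).
  rewrite -big_split; apply: eq_bigr => i _; rewrite -big_split; apply: eq_bigr => k _ /=.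
  by rewrite mxE; ring.
ring.
Qed.

Lemma bformC dl B D : bform dl B D = bform dl D B.
Proof.
rewrite /bform mulrC; congr (_ - _); rewrite exchange_big; apply: eq_bigr => i _.
by apply: eq_bigr => k _; rewrite mulrC.
Qed.

Lemma bformDr dl B D D' : bform dl B (D + D') = bform dl B D + bform dl B D'.
Proof. by rewrite bformC bformDl !(bformC _ B). Qed.

(** Here y = 1/s at the point s diag(1,..,1,0) + E_nn. The frame is chosen so that the Gram matrix
    is monomial on the whole line, not just at one point. *)
Lemma bform_frame (y : K) x x' :
  bform (fun i => if i == l then 1 else y) (frame x) (frame x') =
  (match x with
   | Some (inl a) => sgl a * y
   | Some (inr a) => sgl a * y
   | None => - 2%:R * y ^+ 2
   end) *+ (pairing x == x').
Proof.
have jo := negPf j_gt0; have jl := negPf j_lt.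
have oj : (o == j) = false by rewrite eq_sym.
have lj : (l == j) = false by rewrite eq_sym.
have ol := fst_lst; have lo : (l == o) = false by rewrite eq_sym.
set dl := fun i => _.
have dl0 : dl o = y by rewrite /dl ol.
have dlj : dl j = y by rewrite /dl jl.
have dll : dl l = 1 by rewrite /dl eqxx.
have inlinl a a' : bform dl (frame (Some (inl a))) (frame (Some (inl a'))) = 0.
  rewrite /= bform_delta dll; have [<-|la] := eqVneq l a.
    by rewrite dll ?eqxx /= subrr.
  by rewrite /= !mulr0 subrr.
have inlinr a b : bform dl (frame (Some (inl a))) (frame (Some (inr b))) =
    (sgl a * y) *+ (a == b).
  rewrite /= /sgl; have [bl|bl] := eqVneq b l.
    rewrite bform_delta bl dll dl0 eqxx andbT lo andbF mulr0 subr0 mul1r [a == l]eq_sym.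
    by case: eqP; rewrite ?mul1r ?mulr1 ?mulr0.
  rewrite bform_delta (negPf bl) andbF mulr0 add0r dll eqxx andbT mul1r /dl.
  have [->|ab] := eqVneq a b; last by rewrite mulr0 oppr0.
  by rewrite (negPf bl) mulr1 mulN1r.
have inrinr b b' : bform dl (frame (Some (inr b))) (frame (Some (inr b'))) = 0.
  rewrite /=; have [bl|bl] := eqVneq b l; have [bl'|bl'] := eqVneq b' l; rewrite bform_delta.
  - by rewrite !eqxx subrr.
  - by rewrite (negPf bl') ol !andbF !mulr0 subrr.
  - by rewrite (negPf bl) lo /= !mulr0 subrr.
  by rewrite (negPf bl) [l == b']eq_sym (negPf bl') /= !mulr0 subrr.
have inlk a : bform dl (frame (Some (inl a))) (frame None) = 0.
  by rewrite /= bformDr !bform_delta oj jo lj lo !andbF !mulr0 !subrr addr0.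
have inrk b : bform dl (frame (Some (inr b))) (frame None) = 0.
  rewrite /=; case: ifP => bl; rewrite bformDr !bform_delta ?oj ?jo ?lo ?lj ?eqxx ?andbF /=;
    rewrite ?mulr0 ?subrr ?addr0 //.
have kk : bform dl (frame None) (frame None) = - 2%:R * y ^+ 2.
  rewrite /= bformDl !bformDr !bform_delta oj jo !eqxx /= !mulr0 !mulr1 dl0 dlj; ring.
case: x => [[a|b]|]; case: x' => [[a'|b']|].
- by rewrite inlinl.
- by rewrite inlinr.
- by rewrite inlk.
- rewrite bformC inlinr.
  have -> : (pairing (Some (inr b)) == Some (inl a')) = (a' == b) by rewrite eq_sym.
  by case: eqP => [->|].
- by rewrite inrinr.
- by rewrite inrk.
- by rewrite bformC inlk.
- by rewrite bformC inrk.
by rewrite kk.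
Qed.

Lemma card_frame : #|{: option ('I_n + 'I_n)}| = (2 * n + 1)%N.
Proof. by rewrite card_option card_sum card_ord addn1 mul2n addnn. Qed.

Definition frame_idx (i : 'I_(2 * n + 1)) : option ('I_n + 'I_n) :=
  enum_val (cast_ord (esym card_frame) i).

Definition frame_rank (x : option ('I_n + 'I_n)) : 'I_(2 * n + 1) :=
  cast_ord card_frame (enum_rank x).

Lemma frame_idxK : cancel frame_idx frame_rank.
Proof. by move=> i; rewrite /frame_rank enum_valK cast_ordKV. Qed.

Lemma frame_rankK : cancel frame_rank frame_idx.
Proof. by move=> x; rewrite /frame_idx cast_ordK enum_rankK. Qed.

Lemma pairing_perm_inj : injective (fun i => frame_rank (pairing (frame_idx i))).
Proof.
move=> i k /(can_inj frame_rankK)/(can_inj pairingK); exact: (can_inj frame_idxK).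
Qed.

Definition pairing_perm : 'S_(2 * n + 1) := perm pairing_perm_inj.

Lemma pairing_permE i k : (pairing_perm i == k) = (pairing (frame_idx i) == frame_idx k).
Proof. by rewrite permE -(inj_eq (can_inj frame_idxK)) frame_rankK. Qed.

Definition frame_tuple : (2 * n + 1).-tuple W := [tuple frame (frame_idx i) | i < 2 * n + 1].

Definition last_unit : W := delta_mx l l.

(** The factor det = x^(n-1) times y or y^2, with y = 1/x. The kernel direction loses one degree,
    which makes the Hessian determinant a multiple of x^(e-1), so that q_e = 0. *)
Definition hess_entry (x : option ('I_n + 'I_n)) : {poly K} :=
  match x with
  | Some (inl a) => sgl a *: 'X^(n - 2)
  | Some (inr a) => sgl a *: 'X^(n - 2)
  | None => (- 2%:R) *: 'X^(n - 3)
  end.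

Lemma shift_diag s : s *: corank1 + last_unit = diag_mx (\row_i (if i == l then 1 else s)).
Proof.
apply/matrixP => i k; rewrite !mxE; have [->|ik] := eqVneq i k.
  by case: (eqVneq k l) => kl; rewrite ?mulr0 ?mulr1 ?add0r ?addr0.
rewrite /= mulr0 add0r; case: (eqVneq i l) => // il; case: (eqVneq k l) => // kl.
by rewrite il kl eqxx in ik.
Qed.

Lemma prod_diag (s : K) : \prod_(i < n) (if i == l then 1 else s) = s ^+ (n - 1).
Proof.
rewrite (bigD1 l) //= eqxx mul1r.
rewrite (eq_bigr (fun=> s)); last by move=> i /negPf ->.
rewrite prodr_const; congr (_ ^+ _).
by rewrite cardC1 card_ord subn1.
Qed.

Lemma linep_corank1_det :
  linep (coordW corank1) (coordW last_unit) (det_poly K n) = 'X^(n - 1).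
Proof.
apply: poly_fun_eq => s _; rewrite linep_det shift_diag det_diag hornerXn -prod_diag.
by apply: eq_bigr => i _; rewrite mxE.
Qed.

Lemma linep_hess_entry x x' : linep (coordW corank1) (coordW last_unit)
    (dirder (coordW (frame x)) (dirder (coordW (frame x')) (det_poly K n))) =
  hess_entry x *+ (pairing x == x').
Proof.
apply: poly_fun_eq => s s0; rewrite horner_linep.
have -> : (fun k => coordW corank1 k * s + coordW last_unit k) =
    coordW (diag_mx (\row_i (if i == l then 1 else s))).
  by rewrite -shift_diag coordW_lin; apply/funext => k; rewrite mulrC.
set w := diag_mx _; pose dl (i : 'I_n) := if i == l then 1 else s^-1.
have ww : diag_mx (\row_i dl i) *m w = 1%:M.
  rewrite mulmx_diag; apply/matrixP => i k; rewrite !mxE /dl.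
  by case: (i == l); rewrite ?mulr1 // mulVf.
have wu : w \in unitmx by case: (mulmx1_unit ww).
have wV : invmx w = diag_mx (\row_i dl i).
  by rewrite -[LHS]mul1mx -ww mulmxK.
have tr1 (B : W) : \tr (invmx w *m B) = \sum_i dl i * B i i.
  by rewrite wV mul_diag_mx; apply: eq_bigr => i _; rewrite !mxE.
have tr2 (B D : W) : \tr (invmx w *m B *m invmx w *m D) =
    \sum_i \sum_k dl i * B i k * (dl k * D k i).
  rewrite -mulmxA wV !mul_diag_mx; apply: eq_bigr => i _; rewrite mxE; apply: eq_bigr => k _.
  by rewrite !mxE.
have dw : \det w = s ^+ (n - 1).
  by rewrite det_diag -prod_diag; apply: eq_bigr => i _; rewrite mxE.
rewrite hess_det_formula // !tr1 tr2 -/(bform dl _ _) bform_frame dw hornerMn mulrnAr.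
case: eqP => _; rewrite ?mulr0n // !mulr1n.
have e2 : s ^+ (n - 1) = s ^+ (n - 2) * s.
  by rewrite -exprSr; congr (_ ^+ _); move: n3; clear; lia.
have e3 : s ^+ (n - 2) = s ^+ (n - 3) * s.
  by rewrite -exprSr; congr (_ ^+ _); move: n3; clear; lia.
case: x => [[a|a]|] /=; rewrite hornerZ hornerXn e2; first by field.
  by field.
by rewrite e3; field.
Qed.

Definition top_entry (x : option ('I_n + 'I_n)) : K :=
  match x with Some (inl a) => sgl a | Some (inr a) => sgl a | None => 0 end.

Lemma prod_frame (F : option ('I_n + 'I_n) -> {poly K}) :
  \prod_(i < 2 * n + 1) F (frame_idx i) =
  F None * (\prod_a (F (Some (inl a)) * F (Some (inr a)))).
Proof.
rewrite (reindex frame_rank); last first.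
  by exists frame_idx => x _; [exact: frame_rankK|exact: frame_idxK].
under eq_bigr do rewrite frame_rankK.
rewrite (bigD1 None) //=; congr (_ * _).
rewrite (reindex_omap Some id) /=; last by case.
rewrite (eq_bigl predT) => [|x]; last by rewrite eqxx.
by rewrite big_sumType /= big_split.
Qed.

Lemma sgl_sq a : sgl a * sgl a = 1.
Proof. by rewrite /sgl; case: ifP; rewrite ?mulr1 // mulrNN mulr1. Qed.

Lemma linep_hess_det :
  linep (coordW corank1) (coordW last_unit) (hess_det frame_tuple (det_poly K n)) =
  ((-1) ^+ pairing_perm * - 2%:R) *: 'X^(e - 1).
Proof.
rewrite /hess_det -det_map_mx.
have -> : map_mx (linep (coordW corank1) (coordW last_unit)) (\matrix_(i, k)
    dderiv (tnth frame_tuple i) (dderiv (tnth frame_tuple k) (det_poly K n))) =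
    monomial_mx pairing_perm (fun i => hess_entry (frame_idx i)).
  apply/matrixP => i k; rewrite !mxE /= !dderivE !tnth_map !tnth_ord_tuple.
  by rewrite linep_hess_entry pairing_permE.
rewrite det_monomial_mx prod_frame /=.
rewrite (eq_bigr (fun=> 'X^((n - 2) + (n - 2)))) => [|a _]; last first.
  by rewrite -scalerAl -scalerAr scalerA sgl_sq scale1r -exprD.
rewrite prodr_const card_ord -exprM -scalerAl -exprD.
have -> : (n - 3 + (n - 2 + (n - 2)) * n = e - 1)%N by move: n3; clear; nia.
by rewrite -scalerA; case: (odd_perm _); rewrite ?expr1 ?expr0 ?mul1r ?scale1r // mulN1r scaleN1r.
Qed.

Lemma eval_frame_hess x x' :
  (dirder (coordW (frame x)) (dirder (coordW (frame x')) (det_poly K n))).@[coordW corank1] =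
  top_entry x *+ (pairing x == x').
Proof.
have h : dirder (coordW (frame x)) (dirder (coordW (frame x')) (det_poly K n)) \is (n - 2).-homog.
  by rewrite subn2; do 2!apply: dirder_homog; exact: det_poly_homog.
rewrite -(linep_top _ (coordW last_unit) h) linep_hess_entry coefMn; congr (_ *+ _).
case: x {h} => [[a|a]|] /=; rewrite coefZ coefXn ?eqxx ?mulr1 //.
by case: eqP => [|_]; rewrite ?mulr0 //; move: n3; clear; lia.
Qed.

(** A linear relation is paired with the dual frame vector through the Hessian on the line; at x = 1
    the entry does not vanish. *)
Lemma free_frame : free frame_tuple.
Proof.
apply/freeP => c hc i; pose k := pairing_perm i.
pose x := fun i => frame_idx i.
have hcoord : (fun m => \sum_(i < 2 * n + 1) c i * coordW (frame (frame_idx i)) m) = fun=> 0.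
  apply/funext => m; have := congr1 (fun w : W => coordW w m) hc.
  rewrite /coordW linear0 mxE linear_sum summxE => h0; apply: etrans h0; apply: eq_bigr => i' _.
  by rewrite linearZ mxE (nth_map i') ?size_enum_ord // nth_ord_enum.
have : linep (coordW corank1) (coordW last_unit)
    (dirder (fun m => \sum_(i < 2 * n + 1) c i * coordW (frame (frame_idx i)) m)
      (dirder (coordW (frame (frame_idx k))) (det_poly K n))) = 0.
  rewrite hcoord (_ : dirder _ _ = 0) ?raddf0 // /dirder big1 // => m _; by rewrite scale0r.
rewrite dirder_vec_sum raddf_sum (bigD1 i) //= big1 ?addr0 => [|i' i'i].
  rewrite -mul_mpolyC rmorphM /= [linep _ _ _%:MP]mmapC linep_hess_entry -pairing_permE eqxx
    mulr1n.
  move=> /(congr1 (fun p : {poly K} => p.[1])).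
  rewrite hornerM hornerC horner0 => /eqP; rewrite mulf_eq0 => /orP[/eqP//|].
  have sg a : sgl a != 0.
    by apply/eqP => h; have := sgl_sq a; rewrite h mul0r => /esym/eqP; rewrite oner_eq0.
  case: (frame_idx i) => [[a|a]|] /=; rewrite hornerZ hornerXn expr1n mulr1.
  - by rewrite (negPf (sg a)).
  - by rewrite (negPf (sg a)).
  by rewrite oppr_eq0 pnatr_eq0.
rewrite -mul_mpolyC rmorphM /= linep_hess_entry -pairing_permE.
by rewrite (inj_eq perm_inj) (negPf i'i) mulr0n mulr0.
Qed.

Lemma free_corank1 : free [:: corank1; last_unit].
Proof.
apply/(@freeP _ _ 2 [tuple corank1; last_unit]) => c.
rewrite big_ord_recl big_ord1 /= => hc.
have c0 : c ord0 = 0.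
  have := congr1 (fun w : W => w o o) hc.
  by rewrite !mxE eqxx fst_lst /= mulr1 mulr0 addr0.
have c1 : c (lift ord0 ord0) = 0.
  have := congr1 (fun w : W => w l l) hc.
  by rewrite !mxE !eqxx /= mulr0 add0r mulr1.
by move=> i; case: (unliftP ord0 i) => [i' ->|->] //; rewrite ord1.
Qed.

(** The Zariski tangent space at det of the scheme cut out by the equations. *)
Definition tangent (P : SW) : Prop :=
  forall (f : (2 * n + 1).-tuple W) (u v : W), free f -> free [:: u; v] ->
    has_deriv (E_fun f u v) (det_form K n) P 0.

(** On this line [residue_deriv] says that the variation of q_e is z times that of p_n. The latter
    is the value of P at diag(1,..,1,0); by [det_monomial_deriv] the former is the sign of the
    pairing times the Hessian of P in the direction [kvec]; and z is the same sign times -2. *)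
Theorem tangent_hess (P : SW) : tangent P ->
  (dirder (coordW kvec) (dirder (coordW kvec) (mpoly_of_dhomog P))).@[coordW corank1] =
  - 2%:R * (mpoly_of_dhomog P).@[coordW corank1].
Proof.
move=> /(_ _ _ _ free_frame free_corank1)[r hr r1].
have n0 : (0 < n)%N by exact: first_lt.
have n1 : (1 < n)%N by move: n3; clear; lia.
have ne : (n <= e)%N by move: n3; clear; nia.
pose u := coordW corank1; pose v := coordW last_unit.
pose Ps s := det_form K n + s *: P.
have PsE s : mpoly_of_dhomog (Ps s) = det_poly K n + s *: mpoly_of_dhomog P.
  by rewrite /Ps addrC homform_valP addrC.
have hP : mpoly_of_dhomog P \is n.-homog by exact: dhomog_is_dhomog.
pose p i : {poly K} := ((linep u v (det_poly K n))`_i)%:P +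
  (linep u v (mpoly_of_dhomog P))`_i *: 'X.
have pE s i : (p i).[s] = (linep u v (mpoly_of_dhomog (Ps s)))`_i.
  rewrite PsE raddfD /= coefD /p !hornerE -mul_mpolyC rmorphM /= [linep _ _ _%:MP]mmapC.
  by rewrite coefCM mulrC.
(* The coefficients along the line of the deformed Hessian determinant, as polynomials in the
   deformation parameter s. *)
have /choice[q hq] : forall i, exists q : {poly K},
    forall s, q.[s] = (linep u v (hess_det frame_tuple (mpoly_of_dhomog (Ps s))))`_i.
  move=> i.
  have hh : gam (@polfun K) 1 (fun s => mpoly_of_dhomog (Ps s)).
    move=> m; apply: (ga_ext _ (polfun_affine (det_poly K n)@_m (mpoly_of_dhomog P)@_m)) => s.
    by rewrite PsE mcoeffD mcoeffZ mulrC.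
  have [q _ hq] := ga_homog_fun (polfun_graded K)
    (hess_coef_homog frame_tuple corank1 last_unit i) hh.
  exists q => s; rewrite -hq; apply: linep_coef.
  by apply: hess_det_homog; exact: dhomog_is_dhomog.
have rE : r = residue n e q p.
  apply: poly_fun_eq => s _; rewrite -hr E_funE -/(Ps s) -[RHS]/(horner_eval s _).
  rewrite residue_rmorph; apply: eq_residue => i; rewrite /= /horner_eval.
    by rewrite hq.
  by rewrite pE.
pose z : K := (-1) ^+ pairing_perm * - 2%:R.
have hp0 i : (i <= n)%N -> (p i)`_0 = (i == (n - 1)%N)%:R.
  by move=> _; rewrite -horner_coef0 pE PsE scale0r addr0 linep_corank1_det coefXn.
have hq0 i : (i <= e)%N -> (q i)`_0 = if i == (e - 1)%N then z else 0.
  move=> _; rewrite -horner_coef0 hq PsE scale0r addr0 linep_hess_det coefZ coefXn.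
  by case: eqP; rewrite ?mulr1 ?mulr0.
have := residue_deriv n0 ne n1 hp0 hq0; rewrite -rE r1 => /esym/eqP.
rewrite mulf_eq0 signr_eq0 /= => /eqP.
have -> : (p n)`_1 = (mpoly_of_dhomog P).@[u].
  by rewrite /p coefD coefC coefZ coefX add0r mulr1 (linep_top _ _ hP).
pose rN := frame_rank None.
pose H1 : 'M[K]_(2 * n + 1) := \matrix_(i, k) (dirder (coordW (frame (frame_idx i)))
   (dirder (coordW (frame (frame_idx k))) (mpoly_of_dhomog P))).@[u].
pose d0 i := top_entry (frame_idx i).
have qe : q e = \det (map_mx polyC (monomial_mx pairing_perm d0) + 'X *: map_mx polyC H1).
  apply: poly_fun_eq => s _; rewrite hq.
  have hQ : hess_det frame_tuple (mpoly_of_dhomog (Ps s)) \is e.-homog.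
    by apply: hess_det_homog; exact: dhomog_is_dhomog.
  rewrite (linep_top _ _ hQ) eval_hess -[RHS]/(horner_eval s _) -det_map_mx.
  congr (\det _); apply/matrixP => i k; rewrite !mxE !tnth_map !tnth_ord_tuple PsE.
  rewrite /= /horner_eval !hornerE -mulr_natr.
  rewrite !(linearD (dirder _)) /= !dirderZ mevalD mevalZ eval_frame_hess.
  by rewrite pairing_permE /d0 mulr_natr.
have sr : pairing_perm rN = rN by rewrite permE frame_rankK.
have dr : d0 rN = 0 by rewrite /d0 frame_rankK.
rewrite qe (det_monomial_deriv _ sr dr).
have -> : H1 rN rN = (dirder (coordW kvec) (dirder (coordW kvec) (mpoly_of_dhomog P))).@[u].
  by rewrite mxE !frame_rankK.
have -> : \prod_(i | i != rN) d0 i = 1.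
  pose F x : {poly K} := if x == None then 1 else (top_entry x)%:P.
  have : \prod_(i < 2 * n + 1) F (frame_idx i) = 1.
    rewrite prod_frame /F /= mul1r big1 // => a _.
    by rewrite -polyCM sgl_sq.
  move=> /(congr1 (fun g : {poly K} => g.[0])); rewrite horner_prod hornerC => h1;
    apply: etrans h1.
  rewrite [RHS](bigD1 rN) //= /F frame_rankK eqxx hornerC mul1r; apply: eq_bigr => i ir.
  by rewrite -[None]frame_rankK (inj_eq (can_inj frame_idxK)) (negPf ir) hornerC.
rewrite mulr1 /z -mulrA -mulrBr => /eqP; rewrite mulf_eq0 signr_eq0 /= subr_eq0 => /eqP.
by [].
Qed.

End CorankOne.

(** * The tangent space of the orbit *)

Lemma coef1_deriv (R : nzRingType) (p : {poly R}) : p`_1 = (p^`()).[0].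
Proof. by rewrite horner_coef0 coef_deriv mulr1n. Qed.

Section TwoSidedAction.
Variables (K : numFieldType) (n : nat).
Notation N := (n * n)%N.
Notation W := 'M[K]_n.

(* [lin_mx] acts on row vectors, hence the transpose: this is X |-> g X h. *)
Definition rho (g h : W) : 'M[K]_N := (lin_mx (mulmxr h \o mulmx g))^T.

Lemma actW_rho g h X : actW (rho g h) X = g *m X *m h.
Proof. by apply: (can_inj mxvecK); rewrite mxvec_actW trmxK mul_vec_lin. Qed.

Lemma actW_ext (A B : 'M[K]_N) : (forall X : W, actW A X = actW B X) -> A = B.
Proof.
move=> h; apply: trmx_inj; apply/row_matrixP => i; rewrite !rowE.
by have := congr1 mxvec (h (vec_mx (delta_mx 0 i))); rewrite !mxvec_actW !vec_mxK.
Qed.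

Lemma rhoM g h g' h' : rho g h *m rho g' h' = rho (g *m g') (h' *m h).
Proof. by apply: actW_ext => X; rewrite -actW_mul !actW_rho !mulmxA. Qed.

Lemma rho1 : rho 1%:M 1%:M = 1%:M.
Proof. by apply: actW_ext => X; rewrite actW_rho actW1 mul1mx mulmx1. Qed.

Lemma rho_unit g h : g \in unitmx -> h \in unitmx -> rho g h \in unitmx.
Proof.
move=> gu hu; have : rho g h *m rho (invmx g) (invmx h) = 1%:M.
  by rewrite rhoM mulmxV // mulVmx // rho1.
by case/mulmx1_unit.
Qed.

Lemma rho_entry g h i j k l :
  rho g h (mxvec_index i j) (mxvec_index k l) = g i k * h l j.
Proof.
have -> : rho g h (mxvec_index i j) (mxvec_index k l) =
    coordW (actW (rho g h) (delta_mx k l)) (mxvec_index i j).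
  rewrite coord_actW (bigD1 (mxvec_index k l)) //=
    coordWE [delta_mx _ _ _ _]mxE !eqxx mulr1 big1 ?addr0 // => m.
  case/mxvec_indexP: m => a b; case: (eqVneq (a, b) (k, l)) => [[-> ->]|ab _];
    first by rewrite eqxx.
  rewrite coordWE [delta_mx _ _ _ _]mxE; case: eqP => [ak|]; case: eqP => [bl|];
    rewrite ?mulr0 //.
  by rewrite ak bl eqxx in ab.
rewrite actW_rho coordWE mxE (bigD1 l) //= big1 ?addr0 => [|m ml].
  rewrite mxE (bigD1 k) //= mxE !eqxx mulr1 big1 ?addr0 // => m mk.
  by rewrite mxE (negPf mk) mulr0.
by rewrite mxE big1 ?mul0r // => a _; rewrite mxE (negPf ml) andbF mulr0.
Qed.

End TwoSidedAction.

Lemma rho_adj (C : numClosedFieldType) n (g h : 'M[C]_n) :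
  adjmx (rho g h) = rho (adjmx g) (adjmx h).
Proof.
apply/matrixP => a b; case/mxvec_indexP: a => i j; case/mxvec_indexP: b => k l.
rewrite rho_entry [adjmx (rho g h) _ _]mxE [map_mx _ (rho g h) _ _]mxE rho_entry.
by rewrite !mxE rmorphM.
Qed.

Section OrbitTangent.
Variables (K : numFieldType) (n : nat).
Hypothesis n3 : (3 <= n)%N.
Notation N := (n * n)%N.
Notation W := 'M[K]_n.
Notation SW := (homform K N n).
Implicit Types (P Q : SW).

Lemma det_rho (g h : W) :
  precomp (rho g h) (det_form K n) = (\det g * \det h) *: det_form K n.
Proof.
apply: form_extW => A; rewrite evalW_lin_forms homform_valZ mevalZ /= !eval_det actW_rho.
by rewrite !det_mulmx; ring.
Qed.

Lemma dform_homog (X : 'M[K]_N) P :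
  \sum_k tnth (lin_forms X) k * (mpoly_of_dhomog P)^`M(k) \is n.-homog.
Proof.
apply: rpred_sum => k _.
have h1 : tnth (lin_forms X) k \is 1.-homog.
  rewrite tnth_mktuple; apply: rpred_sum => l _; apply: rpredZ.
  by rewrite dhomogX; apply/eqP; exact: mdeg1.
have := dhomogM h1 (homog_mderiv k (dhomog_is_dhomog P)).
by rewrite add1n (prednK (first_lt n3)).
Qed.

(** The infinitesimal action of X, that is the derivative at s = 0 of P((1 + sX)w). At P = det these
    forms make up the tangent space of the orbit. *)
Definition dform X P : SW := DHomog (dform_homog X P).

Lemma dform_eval X P (A : W) : (mpoly_of_dhomog (dform X P)).@[coordW A] =
  (dirder (coordW (actW X A)) (mpoly_of_dhomog P)).@[coordW A].
Proof.
rewrite /= (raddf_sum (meval _)) /dirder (raddf_sum (meval _)); apply: eq_bigr => k _ /=.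
rewrite mevalM mevalZ; congr (_ * _).
rewrite tnth_mktuple (raddf_sum (meval _)) coord_actW /=.
by apply: eq_bigr => i _; rewrite mevalZ mevalXU.
Qed.

Lemma dform_lin a X Y P : dform (a *: X + Y) P = a *: dform X P + dform Y P.
Proof.
apply: form_extW => A; rewrite homform_valP mevalD mevalZ !dform_eval.
have -> : coordW (actW (a *: X + Y) A) =
    fun k => a * coordW (actW X A) k + coordW (actW Y A) k.
  apply: functional_extensionality_dep => k; rewrite !coord_actW big_distrr -big_split /=.
  by apply: eq_bigr => i _; rewrite !mxE; ring.
by rewrite dirder_vec_lin mevalD mevalZ.
Qed.

Lemma dform0 P : dform 0 P = 0.
Proof. by have := dform_lin (-1) 0 0 P; rewrite scaler0 addr0 scaleN1r addNr. Qed.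

Lemma dform_precomp (R X : 'M[K]_N) P : R \in unitmx ->
  precomp R (dform X P) = dform (invmx R *m X *m R) (precomp R P).
Proof.
move=> Ru; apply: form_extW => A.
rewrite evalW_lin_forms !dform_eval dirder_lin evalW_lin_forms.
congr (_.@[_]); congr (dirder _ _); apply: functional_extensionality_dep => k.
by rewrite -coord_actW !actW_mul !mulmxA mulmxV // mul1mx.
Qed.

Lemma dform_det_lin a X P : dform X (a *: P) = a *: dform X P.
Proof.
apply: form_extW => A; rewrite homform_valZ mevalZ !dform_eval homform_valZ.
by rewrite dirderZ mevalZ.
Qed.

End OrbitTangent.

Section Tangent.
Variables (K : numFieldType) (n : nat).
Hypothesis n3 : (3 <= n)%N.
Notation N := (n * n)%N.
Notation W := 'M[K]_n.
Notation SW := (homform K N n).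
Implicit Types (P Q : SW).

(** The number of coefficients is n + 1, written [n.-1.+2] so that the indices 0 and 1 exist by
    construction. *)
Lemma precomp_jet (X : 'M[K]_N) P : exists v : 'I_n.-1.+2 -> SW,
  [/\ forall s, precomp (1%:M + s *: X) P = \sum_(i < n.-1.+2) s ^+ i *: v i,
      v ord0 = P & v (lift ord0 ord0) = dform n3 X P].
Proof.
have G : gam (@polfun K) n.-1.+1 (fun s => mpoly_of_dhomog (precomp (1%:M + s *: X) P)).
  by move=> m; apply: polfun_le (precomp_curve _ _ _ m); rewrite (prednK (first_lt n3)).
have [v vE] := curve_decomp G; exists v.
have evE (A : W) : linep (coordW (actW X A)) (coordW A) (mpoly_of_dhomog P) =
    \sum_(i < n.-1.+2) (mpoly_of_dhomog (v i)).@[coordW A] *: 'X^i.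
  apply: poly_fun_eq => s _; rewrite horner_linep horner_sum.
  transitivity (mpoly_of_dhomog (precomp (1%:M + s *: X) P)).@[coordW A].
    rewrite evalW_lin_forms; congr (_.@[_]); apply: functional_extensionality_dep => k.
    have -> : coordW A k = \sum_l (1%:M : 'M[K]_N) k l * coordW A l by rewrite -coord_actW actW1.
    rewrite !coord_actW mulr_suml -big_split /=.
    by apply: eq_bigr => i _; rewrite !mxE; ring.
  rewrite vE; transitivity (\sum_(i < n.-1.+2) s ^+ i * (mpoly_of_dhomog (v i)).@[coordW A]).
    elim/big_rec2: _ => [|i x Q _ <-]; first by rewrite meval0.
    by rewrite homform_valP mevalD mevalZ.
  by apply: eq_bigr => i _; rewrite hornerZ hornerXn mulrC.
split => //; apply: form_extW => A.
  have := congr1 (fun p : {poly K} => p`_0) (evE A).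
  rewrite -horner_coef0 horner_linep big_ord_recl coefD coefZ coefXn mulr1.
  rewrite coef_sum big1 ?addr0 => [<-|i _]; last by rewrite coefZ coefXn mulr0.
  by congr (_.@[_]); apply: functional_extensionality_dep => k; rewrite mulr0 add0r.
have := congr1 (fun p : {poly K} => p`_1) (evE A).
rewrite mmap_coef1 !big_ord_recl !coefD !coefZ !coefXn mulr0 mulr1 add0r.
rewrite coef_sum big1 ?addr0 => [<-|i _]; last by rewrite coefZ coefXn mulr0.
rewrite dform_eval; congr ((dirder _ _).@[_]); apply: functional_extensionality_dep => k.
  by rewrite coefD coefZ coefX coefC /= ?mulr0 ?mulr1 ?addr0 ?add0r.
by rewrite coefD coefZ coefX coefC /= ?mulr0 ?mulr1 ?addr0 ?add0r.
Qed.

Lemma tangent_lin a P Q : tangent P -> tangent Q -> tangent (a *: P + Q).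
Proof.
move=> tP tQ f u v ff fuv; have [p _ pE] := E_fun_homog f u v n3.
apply/(has_deriv_grad _ _ _ pE); rewrite gradP.
have /(has_deriv_grad _ _ _ pE) -> := tP f u v ff fuv.
have /(has_deriv_grad _ _ _ pE) -> := tQ f u v ff fuv.
by rewrite mulr0 addr0.
Qed.

Lemma tangent0 : tangent (0 : SW).
Proof.
move=> f u v ff fuv; exists (E_fun f u v (det_form K n))%:P; last by rewrite coefC.
by move=> s; rewrite scaler0 addr0 hornerC.
Qed.

(** The substitution R = [rho g h] multiplies det by c = det g det h, so det + s (P o R) is 1/c
    times (det + csP) o R. The equations are homogeneous and equivariant. *)
Lemma tangent_rho (g h : W) P : g \in unitmx -> h \in unitmx ->
  tangent P -> tangent (precomp (rho g h) P).
Proof.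
move=> gu hu tP f u v ff fuv; pose R := rho g h.
have Ru : R \in unitmx by exact: rho_unit.
pose c := \det g * \det h.
have c0 : c != 0 by rewrite mulf_neq0 // -unitfE -unitmxE.
have ff' := free_actW Ru ff; have fuv' := @free_actW K n 2 R [tuple u; v] Ru fuv.
have [r rE r1] := tP _ _ _ ff' fuv'.
exists ((c^-1 ^+ (2 * n * (n - 1))) *: (r \Po (c *: 'X))).
  move=> s; rewrite hornerZ horner_comp hornerZ hornerX -rE -E_fun_precomp.
  rewrite -(homog_funZ _ _ (E_fun_homog f u v n3)) [det_form K n + (c * s) *: P]addrC
    (linearP (precomp R)) /= det_rho -/c.
  by congr (E_fun f u v _); rewrite addrC scalerDr !scalerA mulVf // scale1r mulrA mulVf // mul1r.
rewrite coefZ coef1_deriv deriv_comp hornerM horner_comp hornerZ hornerX mulr0.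
by rewrite -coef1_deriv r1 mul0r mulr0.
Qed.

End Tangent.

(** Each equation vanishes along the whole curve of substitutions 1 + sX in det, hence so does its
    derivative. *)
Lemma dform_tangent (C : numClosedFieldType) n (n3 : (3 <= n)%N) (X : 'M[C]_(n * n)) :
  tangent (dform n3 X (det_form C n)).
Proof.
move=> f u v ff fuv; have [p _ pE] := E_fun_homog f u v n3.
apply/(has_deriv_grad _ _ _ pE).
have [w [wE w0 w1]] := precomp_jet n3 X (det_form C n).
have [r rE r1] := grad_curve w pE.
rewrite -w1 -{1}w0 -r1 (_ : r = 0) ?coef0 //.
by apply: poly_fun_eq => s _; rewrite horner0 -rE -wE E_orbit.
Qed.

Section Density.
Variables (K : numFieldType) (n : nat).
Notation W := 'M[K]_n.
Notation SW := (homform K (n * n) n).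

Lemma form_extLU (P Q : SW) :
  (forall L U : W, L \in unitmx -> U \in unitmx -> is_trig_mx L -> is_trig_mx U^T ->
     (mpoly_of_dhomog P).@[coordW (L *m U)] = (mpoly_of_dhomog Q).@[coordW (L *m U)]) ->
  P = Q.
Proof.
move=> h; apply: form_extW => A; have [c c0 cP] := generic_LU A.
have lE s R : (linep (coordW 1%:M) (coordW A) R).[s] = R.@[coordW (A + s%:M)].
  rewrite horner_linep [A + _]addrC -[s%:M]scalemx1 coordW_lin; congr (_.@[_]).
  by apply: functional_extensionality_dep => k; rewrite mulrC.
have /(congr1 (fun p => p.[0])) :
    linep (coordW 1%:M) (coordW A) (mpoly_of_dhomog P - mpoly_of_dhomog Q) = 0.
  apply: (poly_generic_eq0 c0) => s _ /cP[L [U [Lu Uu Lt Ut E]]].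
  by rewrite lE E mevalB h // subrr.
by rewrite lE horner0 raddf0 addr0 mevalB => /eqP; rewrite subr_eq0 => /eqP.
Qed.

End Density.

(** * Weight vectors for X |-> t X t *)

Section Torus.
Variables (K : numFieldType) (n : nat).
Hypothesis n3 : (3 <= n)%N.
Notation N := (n * n)%N.
Notation W := 'M[K]_n.
Notation SW := (homform K N n).
Implicit Types (P Q : SW).

(* With base n + 1, the exponents of a monomial of degree n on the diagonal are
   the digits of its weight. *)
Definition height (i : 'I_n) : nat := (n.+1 ^ (n.-1 - i))%N.

Lemma height_anti (i j : 'I_n) : (i <= j)%N -> (height j <= height i)%N.
Proof. by move=> ij; rewrite leq_pexp2l // leq_sub2l. Qed.

Lemma height_lt (i j : 'I_n) : (i < j)%N -> (height j < height i)%N.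
Proof. by move=> ij; rewrite ltn_exp2l ?(leq_trans _ n3) //; move: (ltn_ord j); lia. Qed.

Definition torus (t : K) : W := diag_mx (\row_i t ^+ height i).

Lemma torusM s t : torus s *m torus t = torus (s * t).
Proof.
by rewrite /torus mulmx_diag; congr diag_mx; apply/rowP => i; rewrite !mxE exprMn.
Qed.

Lemma torus1 : torus 1 = 1%:M.
Proof.
apply/matrixP => i j; rewrite !mxE expr1n.
by case: eqP => //= <-.
Qed.

Lemma torus_unit t : t != 0 -> torus t \in unitmx.
Proof.
move=> t0; rewrite unitmxE det_diag unitfE; apply/prodf_neq0 => i _.
by rewrite mxE expf_neq0.
Qed.

Definition rtorus t : 'M[K]_N := rho (torus t) (torus t).

Lemma rtorusM s t : rtorus s *m rtorus t = rtorus (s * t).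
Proof. by rewrite /rtorus rhoM !torusM [t * s]mulrC. Qed.

Notation bound := (n * (2 * n.+1 ^ n))%N.

Lemma rtorus_curve P : gam (@polfun K) bound (fun t => mpoly_of_dhomog (precomp (rtorus t) P)).
Proof.
apply: precomp_poly_curve => a b; case/mxvec_indexP: a => i j; case/mxvec_indexP: b => k l.
have pT (x y : 'I_n) : polfun (n.+1 ^ n) (fun t => torus t x y).
  apply: (@ga_ext _ _ _ _ (fun t => (x == y)%:R * t ^+ height x)).
    move=> t; rewrite !mxE; by case: eqP; rewrite ?mul1r ?mul0r ?mulr1n ?mulr0n.
  apply: polfun_le (gaZ (@polfun_graded K) _ (ga_exp (@polfun_graded K) (height x)
    (@polfun_id K))).
  by rewrite muln1 leq_pexp2l // -subn1 -subnDA leq_subr.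
apply: (@ga_ext _ _ _ _ (fun t => torus t i k * torus t l j)).
  by move=> t; rewrite rho_entry.
by rewrite mul2n -addnn; apply: (gaM (@polfun_graded K)).
Qed.

Definition weight_vector h P := forall t, t != 0 -> precomp (rtorus t) P = t ^+ h *: P.

(** The components are the coefficients of the curve t |-> [rtorus t] P. The multiplicativity of
    [rtorus], compared coefficient by coefficient in s, gives their weights. *)
Lemma weight_decomp P : exists v : 'I_bound.+1 -> SW,
  (forall t, precomp (rtorus t) P = \sum_(i < bound.+1) t ^+ i *: v i) /\
  forall i : 'I_bound.+1, weight_vector i (v i).
Proof.
have [v vE] := curve_decomp (rtorus_curve P); exists v; split => // i t _.
pose w (j : 'I_bound.+1) : SW := precomp (rtorus t) (v j).
pose w' (j : 'I_bound.+1) : SW := t ^+ j *: v j.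
apply: (@curve_eq _ _ _ _ w w') => s _.
transitivity (precomp (rtorus t) (precomp (rtorus s) P)).
  rewrite vE (linear_sum (precomp (rtorus t))); apply: eq_bigr => j _.
  by rewrite (linearZ_LR (precomp (rtorus t))).
rewrite precomp_comp rtorusM vE; apply: eq_bigr => j _.
by rewrite exprMn -scalerA.
Qed.

Section ExtremalVector.
Variable (T : SW -> Prop).
Hypothesis (T0 : T 0) (Tlin : forall a P Q, T P -> T Q -> T (a *: P + Q)).
Hypothesis Trho : forall (g h : W) P, g \in unitmx -> h \in unitmx -> T P ->
  T (precomp (rho g h) P).

Lemma weight_decomp_sub P : T P -> exists v : 'I_bound.+1 -> SW,
  [/\ forall t, precomp (rtorus t) P = \sum_(i < bound.+1) t ^+ i *: v i,
      forall i : 'I_bound.+1, weight_vector i (v i) & forall i, T (v i)].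
Proof.
move=> tP; have [v [vE vw]] := weight_decomp P; exists v; split => //.
apply: (subspace_curve T0 Tlin) => s s0; rewrite -vE.
by apply: Trho => //; exact: torus_unit.
Qed.

Lemma highest_vector P : T P -> P != 0 -> exists h pi,
  [/\ T pi, pi != 0, weight_vector h pi &
    forall i Q, (h < i <= bound)%N -> T Q -> weight_vector i Q -> Q = 0].
Proof.
move=> tP P0.
pose isw h := `[< (h <= bound)%N /\ exists pi, [/\ T pi, pi != 0 & weight_vector h pi] >].
have ex : exists h, isw h.
  have [v [vE vw vT]] := weight_decomp_sub tP.
  have [i vi] : exists i, v i != 0.
    apply/not_existsP => v0; case/negP: P0; rewrite -[P]precomp1 -rho1 -torus1.
    rewrite -/(rtorus 1) vE; apply/eqP; rewrite big1 // => i _.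
    by have /negP := v0 i; rewrite negbK => /eqP ->; rewrite scaler0.
  by exists i; apply/asboolP; split; [rewrite -ltnS | exists (v i)].
have bd h : isw h -> (h <= bound)%N by move=> /asboolP[].
case: (ex_maxnP ex bd) => h /asboolP[_ [pi [pT p0 pw]]] hmax.
exists h, pi; split => // i Q /andP[hi ib] tQ Qw; apply/eqP/negPn/negP => Q0.
have : isw i by apply/asboolP; split=> //; exists Q.
by move/hmax; rewrite leqNgt hi.
Qed.

(* Conjugation by the torus contracts L and U to their diagonals, and the value
   of pi along this path is polynomial in t, and in t^-1 because the weight is
   maximal; hence it is constant. *)
Lemma highest_vector_trig h pi (L U : W) : T pi -> weight_vector h pi ->
  (forall i Q, (h < i <= bound)%N -> T Q -> weight_vector i Q -> Q = 0) ->
  L \in unitmx -> U \in unitmx -> is_trig_mx L -> is_trig_mx U^T ->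
  (mpoly_of_dhomog pi).@[coordW (L *m U)] =
  (mpoly_of_dhomog pi).@[coordW (diag_mx (\row_i (L i i * U i i)))].
Proof.
move=> pT pw hmax Lu Uu Lt Ut.
(* Conjugates of L and U by the torus. Heights decrease with the index, so only nonnegative powers
   of t occur on the triangular entries, with exponent 0 exactly on the diagonal. *)
pose Lp : 'M[{poly K}]_n := \matrix_(i, j) (L i j *: 'X^(height j - height i)).
pose Up : 'M[{poly K}]_n := \matrix_(i, j) (U i j *: 'X^(height i - height j)).
pose q := mmap polyC (fun k => mxvec (Lp *m Up) 0 k) (mpoly_of_dhomog pi).
pose Ls t : W := \matrix_(i, j) (L i j * t ^+ (height j - height i)).
pose Us t : W := \matrix_(i, j) (U i j * t ^+ (height i - height j)).
have qE t : q.[t] = (mpoly_of_dhomog pi).@[coordW (Ls t *m Us t)].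
  rewrite horner_mmap; congr (_.@[_]); apply: functional_extensionality_dep => k.
  case/mxvec_indexP: k => i j; rewrite mxvecE coordWE !mxE horner_sum.
  by apply: eq_bigr => k _; rewrite !mxE hornerM !hornerZ !hornerXn.
have LsE t : torus t *m Ls t = L *m torus t.
  apply/matrixP => i j; rewrite mul_diag_mx mul_mx_diag !mxE.
  have [ij|ij] := ltnP i j; first by rewrite (is_trig_mxP Lt) // !mul0r mulr0.
  by rewrite mulrCA -exprD subnKC // height_anti.
have UsE t : Us t *m torus t = torus t *m U.
  apply/matrixP => i j; rewrite mul_diag_mx mul_mx_diag !mxE.
  have [ij|ij] := ltnP j i.
    by have := is_trig_mxP Ut j i ij; rewrite mxE => ->; rewrite !mul0r mulr0.
  by rewrite -mulrA -exprD subnK ?height_anti // mulrC.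
have [v [vE vw vT]] := weight_decomp_sub (Trho Lu Uu pT).
(* With T = [torus t], T Ls Us T = L T T U. The left side evaluates to t^h q(t), and the right side
   expands into weight components of pi o [rho L U], those of weight above h being 0; so q is
   constant. *)
have key : 'X^h * q = \sum_(i < bound.+1) (mpoly_of_dhomog (v i)).@[coordW 1%:M] *: 'X^i.
  apply: poly_fun_eq => t t0; rewrite hornerM hornerXn qE horner_sum.
  transitivity (mpoly_of_dhomog (precomp (rtorus t) pi)).@[coordW (Ls t *m Us t)].
    by rewrite pw // homform_valZ mevalZ.
  transitivity (mpoly_of_dhomog (precomp (rtorus t) (precomp (rho L U) pi))).@[coordW 1%:M].
    rewrite !evalW_lin_forms !actW_rho mulmx1; congr (_.@[coordW _]).
    by rewrite mulmxA LsE -!mulmxA UsE.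
  rewrite vE; transitivity (\sum_(i < bound.+1) t ^+ i * (mpoly_of_dhomog (v i)).@[coordW 1%:M]).
    elim/big_rec2: _ => [|i x Q _ <-]; first by rewrite meval0.
    by rewrite homform_valP mevalD mevalZ.
  by apply: eq_bigr => i _; rewrite hornerZ hornerXn mulrC.
have sq : (size q <= 1)%N.
  apply/leq_sizeP => j j1; have := congr1 (fun p : {poly K} => p`_(h + j)) key.
  rewrite coefXnM ltnNge leq_addr /= addKn => ->.
  rewrite coef_sum big1 // => i _; rewrite coefZ coefXn.
  case: eqP => [E|]; last by rewrite mulr0.
  rewrite (hmax i (v i)) ?meval0 ?mul0r //.
  by rewrite -E -addn1 leq_add2l j1 /= E -ltnS.
have q10 : q.[1] = q.[0] by rewrite (size1_polyC sq) !hornerC.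
move: q10; rewrite !qE; have -> : Ls 1 = L by apply/matrixP => i j; rewrite mxE expr1n mulr1.
have -> : Us 1 = U by apply/matrixP => i j; rewrite mxE expr1n mulr1.
move=> ->; congr (_.@[coordW _]).
have Ls0 : Ls 0 = diag_mx (\row_i L i i).
  apply/matrixP => i j; rewrite !mxE; case: eqP => [<-|/eqP ij];
    first by rewrite subnn expr0 mulr1n mulr1.
  have [lij|] := ltnP i j; first by rewrite (is_trig_mxP Lt) // mul0r.
  rewrite leq_eqVlt eq_sym val_eqE (negPf ij) /= => ji.
  by rewrite expr0n subn_eq0 leqNgt height_lt // mulr0.
have Us0 : Us 0 = diag_mx (\row_i U i i).
  apply/matrixP => i j; rewrite !mxE; case: eqP => [<-|/eqP ij];
    first by rewrite subnn expr0 mulr1n mulr1.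
  have [lij|] := ltnP j i; first by have := is_trig_mxP Ut j i lij; rewrite mxE => ->;
    rewrite mul0r.
  rewrite leq_eqVlt val_eqE (negPf ij) /= => ji.
  by rewrite expr0n subn_eq0 leqNgt height_lt // mulr0.
rewrite Ls0 Us0 mulmx_diag; congr diag_mx; by apply/rowP => i; rewrite !mxE.
Qed.

End ExtremalVector.

End Torus.

(** * Forms whose value at L U is a monomial in the diagonal entries *)

Section ExtremalForms.
Variables (K : numFieldType) (n : nat).
Hypothesis n3 : (3 <= n)%N.
Notation N := (n * n)%N.
Notation W := 'M[K]_n.
Notation SW := (homform K N n).
Notation o := (fst_idx n3).
Notation l := (lst_idx n3).
Implicit Types (P Q : SW).

Lemma eval_poly_mx (P : {mpoly K[N]}) (M : 'M[{poly K}]_n) s :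
  (mmap polyC (fun k => mxvec M 0 k) P).[s] = P.@[coordW (map_mx (horner_eval s) M)].
Proof.
rewrite horner_mmap; congr (_.@[_]); apply: functional_extensionality_dep => k.
by case/mxvec_indexP: k => i j; rewrite mxvecE coordWE mxE.
Qed.

Lemma trig_shift (R : nzRingType) (A : 'M[R]_n) (s : R) : is_trig_mx A -> is_trig_mx (A + s%:M).
Proof.
move=> At; apply/is_trig_mxP => i j ij; rewrite !mxE (is_trig_mxP At) // add0r.
by case: eqP ij => // ->; rewrite ltnn.
Qed.

Lemma eval_trig (P : {mpoly K[N]}) :
  (forall L U : W, L \in unitmx -> U \in unitmx -> is_trig_mx L -> is_trig_mx U^T ->
    P.@[coordW (L *m U)] = P.@[coordW (diag_mx (\row_i (L i i * U i i)))]) ->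
  forall L U : W, is_trig_mx L -> is_trig_mx U^T ->
    P.@[coordW (L *m U)] = P.@[coordW (diag_mx (\row_i (L i i * U i i)))].
Proof.
move=> h L U Lt Ut.
pose Lp := map_mx polyC L + 'X%:M; pose Up := map_mx polyC U + 'X%:M.
have Ls s : map_mx (horner_eval s) Lp = L + s%:M.
  by apply/matrixP => i j; rewrite !mxE /horner_eval hornerD hornerC hornerMn hornerX.
have Us s : map_mx (horner_eval s) Up = U + s%:M.
  by apply/matrixP => i j; rewrite !mxE /horner_eval hornerD hornerC hornerMn hornerX.
pose p1 := mmap polyC (fun k => mxvec (Lp *m Up) 0 k) P.
pose p2 := mmap polyC (fun k => mxvec (diag_mx (\row_i (Lp i i * Up i i))) 0 k) P.
have p1E s : p1.[s] = P.@[coordW ((L + s%:M) *m (U + s%:M))].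
  by rewrite eval_poly_mx map_mxM Ls Us.
have p2E s : p2.[s] = P.@[coordW (diag_mx (\row_i ((L + s%:M) i i * (U + s%:M) i i)))].
  rewrite eval_poly_mx map_diag_mx; congr (_.@[coordW (diag_mx _)]).
  by apply/rowP => i; rewrite !mxE /= /horner_eval hornerM !hornerD !hornerC !hornerMn !hornerX.
have [c1 c10 c1E] := det_shift_poly L; have [c2 c20 c2E] := det_shift_poly U.
have /(congr1 (fun p => p.[0])) : p1 - p2 = 0.
  apply: (@poly_generic_eq0 _ _ (c1 * c2)); first by rewrite mulf_neq0.
  move=> s _; rewrite hornerM mulf_eq0 negb_or c1E c2E => /andP[d1 d2].
  rewrite hornerD hornerN p1E p2E h ?subrr // ?unitmxE ?unitfE //; first exact: trig_shift.
  by rewrite linearD /= tr_scalar_mx; exact: trig_shift.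
rewrite hornerD hornerN p1E p2E horner0 !raddf0 !addr0 => /eqP; rewrite subr_eq0 => /eqP ->.
by congr (_.@[coordW (diag_mx _)]); apply/rowP => i; rewrite !mxE !addr0.
Qed.

Definition diag_restr (P : {mpoly K[N]}) : {mpoly K[n]} :=
  P \mPo [tuple mxvec (diag_mx (\row_i 'X_i)) 0 k | k < N].

Lemma diag_restr_eval (P : {mpoly K[N]}) d :
  (diag_restr P).@[d] = P.@[coordW (diag_mx (\row_i d i))].
Proof.
rewrite comp_mpoly_meval; congr (_.@[_]); apply: functional_extensionality_dep => k.
rewrite tnth_mktuple; case/mxvec_indexP: k => i j; rewrite mxvecE coordWE !mxE.
by rewrite mevalMn mevalXU.
Qed.

Lemma diag_restr_homog (P : {mpoly K[N]}) : P \is n.-homog -> diag_restr P \is n.-homog.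
Proof.
move=> hP; rewrite -[X in X.-homog]muln1; apply: comp_homog => // k.
rewrite tnth_mktuple; case/mxvec_indexP: k => i j; rewrite mxvecE !mxE.
by apply: rpredMn; rewrite dhomogX; apply/eqP; exact: mdeg1.
Qed.

Lemma mcoeff_scale m (p : {mpoly K[m]}) (c : 'I_m -> K) u :
  (p \mPo [tuple c i *: 'X_i | i < m])@_u = (\prod_i c i ^+ u i) * p@_u.
Proof.
have -> : p \mPo [tuple c i *: 'X_i | i < m] =
    \sum_(v <- msupp p) (p@_v * \prod_i c i ^+ v i) *: 'X_[v].
  rewrite comp_mpolyE; apply: eq_bigr => v _; rewrite -scalerA; congr (_ *: _).
  rewrite mpolyXE_id -scaler_prod; apply: eq_bigr => i _.
  by rewrite tnth_mktuple exprZn.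
rewrite raddf_sum /=; under eq_bigr do rewrite mcoeffZ mcoeffX.
have [us|us] := boolP (u \in msupp p).
  rewrite (bigD1_seq u) ?msupp_uniq //= eqxx mulr1 [X in _ + X]big1 => [|v vu].
    by rewrite addr0 mulrC.
  by rewrite (negPf vu) mulr0.
rewrite (memN_msupp_eq0 us) mulr0 big_seq big1 // => v vs.
by case: eqP vs => [->|]; rewrite ?mulr0 // (negPf us).
Qed.

(** The restriction to diagonal matrices is a form of degree n whose monomials all have torus weight
    h. The weight, written in base n + 1, has the exponents as digits, so only one monomial
    occurs. *)
Lemma weight_diag h P : weight_vector h P -> exists c (m : 'X_{1..n}),
  [/\ (mdeg m = n)%N & forall d : 'I_n -> K,
    (mpoly_of_dhomog P).@[coordW (diag_mx (\row_i d i))] = c * \prod_i d i ^+ m i].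
Proof.
move=> Pw; pose q := diag_restr (mpoly_of_dhomog P).
have qh : q \is n.-homog by exact: diag_restr_homog (dhomog_is_dhomog P).
have [q0|q0] := eqVneq q 0.
  exists 0, [multinom [tuple if i == o then n else 0%N | i < n]]; split.
    rewrite mdegE (bigD1 o) //= mnmE eqxx big1 ?addn0 // => i /negPf io.
    by rewrite mnmE io.
  by move=> d; rewrite -diag_restr_eval -/q q0 meval0 mul0r.
(* The parameter t = 2 alone is used: a power of 2 determines its exponent. *)
have qw : q \mPo [tuple (2 ^ (2 * height i))%:R *: 'X_i | i < n] = (2 ^ h)%:R *: q.
  apply: mpoly_ext => w; rewrite comp_mpoly_meval mevalZ !diag_restr_eval natrX.
  have two0 : (2%:R : K) != 0 by rewrite pnatr_eq0.
  rewrite -mevalZ -homform_valZ -(Pw _ two0) evalW_lin_forms actW_rho /torus.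
  rewrite !mulmx_diag; congr (_.@[coordW (diag_mx _)]); apply/rowP => i.
  rewrite !mxE tnth_mktuple mevalZ mevalXU natrX mul2n -addnn exprD; ring.
have wq u : u \in msupp q -> (\sum_i (2 * height i) * u i)%N = h.
  rewrite mcoeff_msupp => u0; have := congr1 (mcoeff u) qw.
  rewrite mcoeff_scale mcoeffZ => /(mulIf u0).
  under eq_bigr do rewrite -natrX -expnM.
  rewrite -natr_prod -expn_sum => /eqP; rewrite eqr_nat eqn_exp2l // => /eqP.
  by [].
have uq u v : u \in msupp q -> v \in msupp q -> u = v.
  move=> us vs; have du := dhomog_mf qh us; have dv := dhomog_mf qh vs.
  have lt (w : 'X_{1..n}) i : mdeg w = n -> (w i < n.+1)%N.
    by move=> dw; rewrite ltnS -{2}dw mdegE (bigD1 i) //= leq_addr.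
  have revE (w : 'X_{1..n}) : (2 * \sum_(i < n) w (rev_ord i) * n.+1 ^ i)%N =
      (\sum_i (2 * height i) * w i)%N.
    rewrite big_distrr /= (reindex_inj rev_ord_inj) /=; apply: eq_bigr => i _.
    rewrite rev_ordK [(w i * _)%N]mulnC mulnA; congr (2 * _ ^ _ * _)%N.
    by rewrite -subn1 -subnDA add1n.
  have := @digits_inj n n.+1 (fun i => u (rev_ord i)) (fun i => v (rev_ord i))
    (fun i => lt u _ du) (fun i => lt v _ dv).
  have /eqP := etrans (wq u us) (esym (wq v vs)).
  rewrite -!revE eqn_pmul2l // => /eqP E /(_ E) H.
  by apply/mnmP => i; have := H (rev_ord i); rewrite rev_ordK.
have lq := mlead_supp q0; exists q@_(mlead q), (mlead q); split; first exact: dhomog_mf qh _ lq.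
move=> d; rewrite -diag_restr_eval -/q [in LHS]mevalE (bigD1_seq (mlead q)) ?msupp_uniq //=.
rewrite [X in _ + X]big_seq_cond [X in _ + X]big1 ?addr0 // => u /andP[us].
by rewrite (uq _ _ us lq) eqxx.
Qed.

Lemma mul_delta_mxE (a b : 'I_n) (A : W) x y : (delta_mx a b *m A) x y = (x == a)%:R * A b y.
Proof.
rewrite mxE (bigD1 b) //= big1 ?addr0 => [|k /negPf kb].
  by rewrite mxE eqxx andbT.
by rewrite mxE kb andbF mul0r.
Qed.

Lemma dform_det_eval (g h A : W) :
  (mpoly_of_dhomog (dform n3 (rho g h) (det_form K n))).@[coordW A] =
  \sum_i \sum_j (g *m A *m h) i j * cofactor A i j.
Proof.
rewrite dform_eval actW_rho /= dirder_det (raddf_sum (meval _)); apply: eq_bigr => i _ /=.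
rewrite (raddf_sum (meval _)); apply: eq_bigr => j _ /=.
rewrite mevalM mxE dirderX mevalC coordWE; congr (_ * _).
rewrite -cofactor_map_mx; congr (cofactor _ i j).
by rewrite -[in RHS](eval_genmx A).
Qed.

Lemma dform_row (A : W) :
  (mpoly_of_dhomog (dform n3 (rho (delta_mx o o) 1%:M) (det_form K n))).@[coordW A] = \det A.
Proof.
rewrite dform_det_eval mulmx1 (expand_det_row _ o) (bigD1 o) //= [X in _ + X]big1 ?addr0.
  by apply: eq_bigr => j _; rewrite mul_delta_mxE eqxx mul1r.
move=> i /negPf io; rewrite big1 // => j _.
by rewrite mul_delta_mxE io !mul0r.
Qed.

(** The substitution X |-> E_n1 X E_1n equals x_11 E_nn, so differentiating det in that direction
    leaves x_11 times the last cofactor. *)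
Lemma dform_corner (A : W) :
  (mpoly_of_dhomog (dform n3 (rho (delta_mx l o) (delta_mx o l)) (det_form K n))).@[coordW A] =
  A o o * cofactor A l l.
Proof.
have E i j : (delta_mx l o *m A *m delta_mx o l) i j = ((i == l) && (j == l))%:R * A o o.
  rewrite -mulmxA mul_delta_mxE mxE (bigD1 o) //= [X in _ + X]big1 ?addr0 => [|k /negPf ko].
    by rewrite !mxE eqxx /= [A o o * _]mulrC mulrA -natrM mulnb.
  by rewrite mxE ko mulr0.
rewrite dform_det_eval (bigD1 l) //= [X in _ + X]big1 ?addr0; last first.
  by move=> i /negPf il; rewrite big1 // => j _; rewrite E il !mul0r.
rewrite (bigD1 l) //= [X in _ + X]big1 ?addr0; first by rewrite E eqxx mul1r.
by move=> j /negPf jl; rewrite E jl andbF !mul0r.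
Qed.

Lemma le_last (i : 'I_n) : (i <= l)%N.
Proof. by move: (ltn_ord i) => /=; lia. Qed.

(** This is the leading principal minor of L U of size n - 1, computed by Cramer's rule from the
    last diagonal entry of the inverse. *)
Lemma cofactor_last (L U : W) : L \in unitmx -> U \in unitmx -> is_trig_mx L -> is_trig_mx U^T ->
  cofactor (L *m U) l l = \prod_(i | i != l) (L i i * U i i).
Proof.
move=> Lu Uu Lt Ut.
have L0 : L l l != 0 by exact: trig_diag_unit.
have U0 : U l l != 0 by have := trig_diag_unit l Ut; rewrite unitmx_tr mxE; exact.
have rU : delta_mx 0 l *m invmx U = (U l l)^-1 *: delta_mx 0 l :> 'rV_n.
  apply: (can_inj (mulmxK Uu)); rewrite mulmxKV // -scalemxAl -rowE; apply/rowP => j.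
  rewrite !mxE eqxx /=; have [->|jl] := eqVneq j l; first by rewrite mulVf.
  have := is_trig_mxP Ut j l; rewrite mxE => ->; first by rewrite mulr0.
  by rewrite ltn_neqAle val_eqE jl le_last.
have cL : invmx L *m delta_mx l 0 = (L l l)^-1 *: delta_mx l 0 :> 'cV_n.
  apply: (can_inj (mulKmx Lu)); rewrite mulKVmx // -scalemxAr -colE; apply/colP => j.
  rewrite !mxE andbT; have [->|jl] := eqVneq j l; first by rewrite mulVf.
  have jl1 : (j < l)%N by rewrite ltn_neqAle val_eqE jl le_last.
  by rewrite (is_trig_mxP Lt j l jl1) mulr0.
have LUu : L *m U \in unitmx by rewrite unitmx_mul Lu.
have -> : cofactor (L *m U) l l = \det (L *m U) * invmx (L *m U) l l.
  by rewrite /invmx LUu !mxE mulrA divff ?mul1r // -unitfE -unitmxE.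
have -> : invmx (L *m U) l l = (U l l)^-1 * (L l l)^-1.
  have iE : invmx (L *m U) = invmx U *m invmx L.
    by apply: (can_inj (mulKmx LUu)); rewrite mulmxV // mulmxA mulmxK // mulmxV.
  have : (delta_mx 0 l *m invmx (L *m U) *m delta_mx l 0 : 'M_1) 0 0 =
      (U l l)^-1 * (L l l)^-1.
    rewrite iE mulmxA -mulmxA cL rU -scalemxAl -scalemxAr mul_delta_mx !mxE !eqxx.
    by rewrite mulr1.
  by rewrite -rowE -colE !mxE.
rewrite det_mulmx (det_trig Lt) -[U]trmxK det_tr (det_trig Ut).
rewrite [in RHS]trmxK; under [X in _ * X * _]eq_bigr do rewrite mxE.
rewrite (bigD1 l) //= [X in _ * X * _](bigD1 l) //= big_split /=.
rewrite trmxK; move: L0 U0; set x := \prod_(i | _) _; set y := \prod_(i | _) _.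
move=> L0 U0; field; exact/andP.
Qed.

Section Monomial.
Variables (P : SW) (c : K) (m : 'X_{1..n}).
Hypotheses (c0 : c != 0) (dm : mdeg m = n).
Hypothesis PLU : forall L U : W, is_trig_mx L -> is_trig_mx U^T ->
  (mpoly_of_dhomog P).@[coordW (L *m U)] = c * \prod_i (L i i * U i i) ^+ m i.

Lemma eval_line (A B : W) s :
  (linep (coordW A) (coordW B) (mpoly_of_dhomog P)).[s] =
  (mpoly_of_dhomog P).@[coordW (s *: A + B)].
Proof.
rewrite horner_linep coordW_lin; congr (_.@[_]).
by apply: functional_extensionality_dep => k; rewrite mulrC.
Qed.

(** The test matrix has the block (s, 1; 1, 0) in positions j, l and ones elsewhere on the diagonal.
    For s != 0 its triangular factors have diagonal products s, -1/s and 1, so P takes the value c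
    (-1)^(m_l) s^(m_j - m_l), which must be polynomial in s. *)
Lemma monomial_last (j : 'I_n) : j != l -> (m l <= m j)%N.
Proof.
move=> jl.
pose M0 : W := \matrix_(a, b) ((a == b) && (a != j) && (a != l))%:R +
  (delta_mx j l + delta_mx l j).
pose r := linep (coordW (delta_mx j j)) (coordW M0) (mpoly_of_dhomog P).
have rE (s : K) : s != 0 -> r.[s] * s ^+ m l = c * (-1) ^+ m l * s ^+ m j.
  move=> s0; rewrite eval_line.
  pose dg (i : 'I_n) : K := if i == j then s else if i == l then - s^-1 else 1.
  pose L : W := 1%:M + s^-1 *: delta_mx l j.
  pose U : W := diag_mx (\row_i dg i) + delta_mx j l.
  have lj : (l == j) = false by rewrite eq_sym (negPf jl).
  have LU : L *m U = s *: delta_mx j j + M0.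
    rewrite mulmxDl mul1mx -scalemxAl; apply/matrixP => a b.
    have E : (s^-1 *: (delta_mx l j *m U)) a b = s^-1 * ((a == l)%:R * U j b).
      by rewrite mxE mul_delta_mxE.
    rewrite [LHS]mxE E !mxE /dg.
    have [->|aj] := eqVneq a j; have [->|bj] := eqVneq b j;
      rewrite ?eqxx ?lj ?(negPf jl) ?[j == b]eq_sym ?(negPf bj) ?(negPf aj) /=.
    - by rewrite mulr1n; ring.
    - by rewrite mulr0n; ring.
    - by rewrite andbT mulr0n mulr1n; field.
    have [->|al] := eqVneq a l; have [bl|bl] := eqVneq b l;
      rewrite ?eqxx ?[l == b]eq_sym ?(negPf al) ?(negPf bl) /= ?mulr1n ?mulr0n; try ring;
      by rewrite ?andbT; case: eqP => _; rewrite ?mulr1n ?mulr0n; ring.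
  have Lt : is_trig_mx L.
    apply/is_trig_mxP => a b ab; rewrite !mxE (ltn_eqF ab : (a == b) = false).
    case: (eqVneq a l) => [al|]; last by rewrite mulr0 addr0.
    by move: (le_last b); rewrite leqNgt -al ab.
  have Ut : is_trig_mx U^T.
    apply/is_trig_mxP => a b ab; rewrite !mxE eq_sym (ltn_eqF ab : (a == b) = false).
    case: (eqVneq a l) => [al|]; last by rewrite andbF addr0.
    by move: (le_last b); rewrite leqNgt -al ab.
  rewrite -LU PLU // (bigD1 l) //= (bigD1 j) //= [X in _ * (_ * X)]big1 => [|i /andP[il ij]].
    rewrite !mxE /dg lj (negPf jl) !eqxx /= ?andbF ?andbT ?mulr0 ?addr0 ?mulr1n ?mul1r ?mulr1
      ?expr1n.
    by rewrite [(- s^-1) ^+ m l]exprNn exprVn; field; rewrite expf_neq0.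
  rewrite !mxE /dg (negPf il) (negPf ij) !eqxx /= !mulr0 !addr0 mulr1n mulr1.
  by rewrite expr1n.
have rp : r * 'X^(m l) = (c * (-1) ^+ m l) *: 'X^(m j).
  by apply: poly_fun_eq => s s0; rewrite hornerM hornerZ !hornerXn rE.
rewrite leqNgt; apply/negP => jl'.
have := congr1 (fun p : {poly K} => p`_(m j)) rp.
rewrite coefMXn jl' coefZ coefXn eqxx mulr1 => /eqP.
by rewrite eq_sym mulf_eq0 (negPf c0) /= signr_eq0.
Qed.

Lemma deriv_linep (a b : 'I_N -> K) (p : {mpoly K[N]}) :
  (linep a b p)^`() = linep a b (dirder a p).
Proof.
rewrite deriv_mmap /dirder (raddf_sum (linep a b)); apply: eq_bigr => k _ /=.
rewrite derivD derivZ derivX derivC addr0 alg_polyC -mul_mpolyC rmorphM mulrC.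
by congr (_ * _); rewrite /= /linep mmapC.
Qed.

(** On the line through diag(1,..,1,0) in the direction [kvec] the diagonal products are 1 - s^2 at
    j, 0 at the last index, where m_l = 0, and 1 elsewhere. So P equals c (1 - s^2)^(m_j), with
    second derivative -2 c m_j at 0, while [tangent_hess] requires -2c. *)
Lemma monomial_middle (j : 'I_n) : j != o -> j != l -> m l = 0%N ->
  tangent P -> m j = 1%N.
Proof.
move=> jo jl ml tP; pose k : W := kvec K n3 j.
pose r := linep (coordW k) (coordW (corank1 K n3)) (mpoly_of_dhomog P).
have rE : r = c *: (1 - 'X ^+ 2) ^+ m j.
  apply: poly_fun_eq => s _; rewrite eval_line hornerZ horner_exp hornerD hornerN hornerXn
    hornerC.
  pose L : W := 1%:M + s *: delta_mx j o.
  pose U : W := corank1 K n3 + s *: delta_mx o j - s ^+ 2 *: delta_mx j j.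
  have oj : (o == j) = false by rewrite eq_sym (negPf jo).
  have lj : (l == j) = false by rewrite eq_sym (negPf jl).
  have ol := fst_lst n3.
  have LU : L *m U = s *: k + corank1 K n3.
    rewrite mulmxDl mul1mx -scalemxAl; apply/matrixP => a b.
    have E : (s *: (delta_mx j o *m U)) a b = s * ((a == j)%:R * U o b).
      by rewrite mxE mul_delta_mxE.
    rewrite [LHS]mxE E !mxE ?eqxx ?oj ?ol /=.
    have [->|aj] := eqVneq a j; rewrite ?jl ?jo ?(negPf jo) ?andbT ?andbF /=; last first.
      by have [->|ao] := eqVneq a o; rewrite ?ol ?andbT /=; ring.
    by rewrite ![b == _]eq_sym; case: eqP => jb; case: eqP => ob; rewrite /=; ring.
  have Lt : is_trig_mx L.
    apply/is_trig_mxP => a b ab; rewrite !mxE (ltn_eqF ab : (a == b) = false).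
    case: (eqVneq b o) => [bo|]; last by rewrite andbF mulr0 addr0.
    by move: ab; rewrite bo.
  have Ut : is_trig_mx U^T.
    apply/is_trig_mxP => a b ab; rewrite !mxE eq_sym (ltn_eqF ab : (a == b) = false).
    case: (eqVneq b o) => [bo|_]; first by move: ab; rewrite bo.
    case: (eqVneq b j) => [bj|_] /=; last by rewrite !mulr0 addr0 subr0.
    by rewrite -bj (ltn_eqF ab : (a == b) = false) !mulr0 addr0 subr0.
  rewrite -LU PLU // (bigD1 j) //= big1 => [|i ij].
    rewrite !mxE /= !eqxx jl (negPf jo) ?oj /= ?andbF; congr (_ * _).
    by rewrite mulr1; congr (_ ^+ _); ring.
  have [->|il] := eqVneq i l; first by rewrite ml expr0.
  rewrite !mxE !eqxx il (negPf ij) /= ?andbF.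
  by rewrite mulr0n !mulr0 !addr0 subr0 mulr1 expr1n.
have at0 (p : {mpoly K[N]}) :
    p.@[coordW (corank1 K n3)] = (linep (coordW k) (coordW (corank1 K n3)) p).[0].
  rewrite horner_linep; congr (_.@[_]); apply: functional_extensionality_dep => x.
  by rewrite mulr0 add0r.
have := tangent_hess jo jl tP.
rewrite -/k !at0 -!deriv_linep -/r rE !derivZ deriv_exp derivMn derivM !hornerZ.
rewrite hornerMn hornerD !hornerM !derivB derivC sub0r derivXn /= !hornerE.
rewrite ?expr0n /= ?subr0 ?expr1n.
rewrite deriv0 derivMn expr1 derivX hornerMn hornerC ?horner0 oppr0 mul0r addr0 sub0r !mulr1.
rewrite -polyC1 hornerC.
move=> E; apply/eqP; rewrite -(eqr_nat K); apply/eqP.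
have c2 : c * - 2%:R != 0 :> K by rewrite mulf_neq0 // oppr_eq0 pnatr_eq0.
by apply: (mulfI c2); rewrite mulr1 -mulrA mulr_natr; apply: etrans E _; rewrite mulrC.
Qed.

(** If m_l = 0, the middle exponents are 1 and the degree forces m_o = 2, which is the form of
    [dform_corner]. If m_l > 0, all exponents are positive and add up to n, so they are 1 and the
    form is a multiple of det. *)
Lemma monomial_dform : tangent P -> exists X, P = dform n3 X (det_form K n).
Proof.
move=> tP; have ol := fst_lst n3.
have lo : l != o by rewrite eq_sym ol.
have md : (m o + (m l + \sum_(i | (i != o) && (i != l)) m i))%N = n.
  by rewrite -[RHS]dm mdegE [RHS](bigD1 o) //= [in RHS](bigD1 l).
have cardn : (1 + (1 + \sum_(i | (i != o) && (i != l)) 1))%N = n.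
  by rewrite -[RHS]card_ord -[in RHS]sum1_card [RHS](bigD1 o) //= [in RHS](bigD1 l).
have [ml|ml] := posnP (m l).
  have mj (j : 'I_n) : (j != o) && (j != l) -> m j = 1%N.
    by case/andP=> jo jl; exact: monomial_middle.
  have mo : m o = 2%N.
    have := etrans md (esym cardn); rewrite ml (eq_bigr (fun=> 1%N) mj) add0n addnA.
    exact: addIn.
  exists (c *: rho (delta_mx l o) (delta_mx o l) + 0); rewrite dform_lin dform0 addr0.
  apply: form_extLU => L U Lu Uu Lt Ut; rewrite PLU // homform_valZ mevalZ dform_corner.
  congr (_ * _); rewrite cofactor_last // (bigD1 o) //= mo.
  have -> : (L *m U) o o = L o o * U o o.
    rewrite mxE (bigD1 o) //= [X in _ + X]big1 ?addr0 // => k ko.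
    by rewrite (is_trig_mxP Lt) ?mul0r // lt0n; move: ko; rewrite -val_eqE.
  rewrite [in RHS](bigD1 o) /=; last by rewrite ol.
  rewrite expr2 -[_ * _ * \prod_(_ | _) _]mulrA; congr (_ * (_ * _)).
  rewrite (bigD1 l) //= ml expr0 mul1r; apply: eq_big => [i|i ij]; first exact: andbC.
  by rewrite mj // expr1.
have m1 (i : 'I_n) : (0 < m i)%N.
  by have [->//|il] := eqVneq i l; exact: leq_trans ml (monomial_last il).
have me : (\sum_i m i = \sum_(i < n) 1)%N by rewrite -mdegE dm sum1_card card_ord.
have mi1 (i : 'I_n) : m i = 1%N.
  apply/eqP; rewrite eqn_leq m1 andbT leqNgt; apply/negP => i1.
  move: me; rewrite (bigD1 i) //= [RHS](bigD1 i) //= => me.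
  have le : (\sum_(k | k != i) 1 <= \sum_(k | k != i) m k)%N by apply: leq_sum => k _.
  by have := leq_add i1 le; rewrite me leq_add2r.
exists (c *: rho (delta_mx o o) 1%:M + 0); rewrite dform_lin dform0 addr0.
apply: form_extLU => L U Lu Uu Lt Ut; rewrite PLU // homform_valZ mevalZ dform_row.
congr (_ * _); rewrite det_mulmx (det_trig Lt) -det_tr (det_trig Ut) -big_split /=.
by apply: eq_bigr => i _; rewrite mi1 expr1 mxE.
Qed.

End Monomial.

End ExtremalForms.

Theorem tangent_dform (C : numClosedFieldType) n (n3 : (3 <= n)%N) (P : homform C (n * n) n) :
  tangent P -> exists X, P = dform n3 X (det_form C n).
Proof.
move=> tP; pose U (Q : homform C (n * n) n) := exists X, Q = dform n3 X (det_form C n).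
have U0 : U 0 by exists 0; rewrite dform0.
have Ulin a Q R : U Q -> U R -> U (a *: Q + R).
  by move=> [X ->] [Y ->]; exists (a *: X + Y); rewrite dform_lin.
have Urho (g h : 'M[C]_n) Q : g \in unitmx -> h \in unitmx -> U Q -> U (precomp (rho g h) Q).
  move=> gu hu [X ->]; rewrite dform_precomp ?rho_unit // det_rho dform_det_lin.
  rewrite -[_ *: _]addr0; apply: Ulin => //.
  by exists (invmx (rho g h) *m X *m rho g h).
have [P1 [P2 [PE UP1 orth]]] := form_projection P U0 Ulin.
(* The orthogonal complement of [U] among the tangent forms; it is stable since the adjoint of
   [rho g h] is again a [rho] and preserves [U]. *)
pose T Q := tangent Q /\ forall R, U R -> fdot Q R = 0.
have T0 : T 0.
  split; first exact: tangent0.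
  by move=> R _; have := fdotPl (-1) 0 0 R; rewrite scaler0 addr0 mulN1r addNr.
have Tlin a Q R : T Q -> T R -> T (a *: Q + R).
  move=> [tQ oQ] [tR oR]; split; first exact: tangent_lin.
  by move=> S US; rewrite fdotPl oQ // oR // mulr0 addr0.
have Trho (g h : 'M[C]_n) Q : g \in unitmx -> h \in unitmx -> T Q -> T (precomp (rho g h) Q).
  move=> gu hu [tQ oQ]; split; first exact: tangent_rho.
  by move=> R UR; rewrite fdot_precomp rho_adj oQ //; apply: Urho; rewrite ?adjmx_unit.
have TP2 : T P2.
  split => //; have -> : P2 = (-1) *: P1 + P by rewrite PE scaleN1r addKr.
  by apply: tangent_lin => //; case: UP1 => X ->; exact: dform_tangent.
suff P20 : P2 = 0 by rewrite PE P20 addr0.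
apply/eqP/negPn/negP => P20.
have [h [pi [Tpi pi0 piw hmax]]] := highest_vector T0 Tlin Trho TP2 P20.
have [c [m [dm piD]]] := weight_diag n3 piw.
have piLU (L V : 'M[C]_n) : is_trig_mx L -> is_trig_mx V^T ->
    (mpoly_of_dhomog pi).@[coordW (L *m V)] = c * \prod_i (L i i * V i i) ^+ m i.
  move=> Lt Vt; rewrite -piD; apply: eval_trig => // L' V' *.
  exact: (highest_vector_trig n3 T0 Tlin Trho Tpi piw hmax).
have c0 : c != 0.
  apply: contra_neq pi0 => c0; apply: form_extLU => L V _ _ Lt Vt.
  by rewrite piLU // c0 mul0r meval0.
(* The extremal vector lies both in [U] and in its complement, hence is orthogonal to itself. *)
have Upi : U pi by apply: (monomial_dform n3 c0 dm piLU); case: Tpi.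
by case/eqP: pi0; apply: fdot_eq0; case: Tpi => _; apply.
Qed.

(** * The orbit closure as a component *)

Section Translation.
Variables (K : numFieldType) (M : nat).
Implicit Types (p : {mpoly K[M]}) (x w : 'I_M -> K).

Definition translate x p : {mpoly K[M]} := p \mPo [tuple 'X_i + (x i)%:MP | i < M].

Lemma translate_eval x p w : (translate x p).@[w] = p.@[fun i => w i + x i].
Proof.
rewrite comp_mpoly_meval; apply: meval_eq => i.
by rewrite tnth_mktuple mevalD mevalXU mevalC.
Qed.

Lemma meval_at0 p : p.@[fun=> 0] = p@_0%MM.
Proof.
rewrite [in LHS](mpolyE p) (raddf_sum (meval _)) /=.
have [p0|p0] := boolP (0%MM \in msupp p).
  rewrite (bigD1_seq 0%MM) ?msupp_uniq //= mevalZ mpolyX0 meval1 mulr1.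
  rewrite [X in _ + X]big1 ?addr0 // => m m0.
  have [i mi] : exists i, m i != 0%N.
    apply/not_existsP => h; case/negP: m0; apply/eqP/mnmP => i; rewrite mnm0E.
    by apply/eqP/negPn/negP; exact: h.
  by rewrite mevalZ mevalX (bigD1 i) //= expr0n (negPf mi) mul0r mulr0.
rewrite (memN_msupp_eq0 p0) big_seq big1 // => m ms.
have [i mi] : exists i, m i != 0%N.
  apply/not_existsP => h; case/negP: p0; suff -> : 0%MM = m by [].
  by apply/mnmP => i; rewrite mnm0E; apply/esym/eqP/negPn/negP; exact: h.
by rewrite mevalZ mevalX (bigD1 i) //= expr0n (negPf mi) mul0r mulr0.
Qed.

Lemma linear_part_translate x p w :
  \sum_i (translate x p)@_U_(i) * w i = (dirder w p).@[x].
Proof.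
have E : mmap polyC (fun k => w k *: 'X) (translate x p) =
    mmap polyC (fun k => w k *: 'X + (x k)%:P) p.
  apply: poly_fun_eq => s _; rewrite !horner_mmap translate_eval.
  by apply: meval_eq => i; rewrite hornerD hornerC.
have := congr1 (fun q : {poly K} => q`_1) E; rewrite !mmap_coef1.
have -> : (fun k => (w k *: 'X)`_1) = w.
  by apply: functional_extensionality_dep => k; rewrite coefZ coefX mulr1.
have -> : (fun k => (w k *: 'X)`_0) = (fun=> 0).
  by apply: functional_extensionality_dep => k; rewrite coefZ coefX mulr0.
have -> : (fun k => (w k *: 'X + (x k)%:P)`_1) = w.
  by apply: functional_extensionality_dep => k; rewrite coefD coefZ coefX coefC mulr1 addr0.
have -> : (fun k => (w k *: 'X + (x k)%:P)`_0) = x.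
  by apply: functional_extensionality_dep => k; rewrite coefD coefZ coefX coefC mulr0 add0r.
move=> <-; rewrite /dirder (raddf_sum (meval _)); apply: eq_bigr => i _ /=.
rewrite mevalZ meval_at0 mcoeff_mderiv mnm0E mulr1n mulrC.
by congr (_ * _@__); apply/mnmP => j; rewrite mnmDE mnm0E.
Qed.

(** Along a curve sv + s^2 r(s) a polynomial of order N starts with s^N times its leading form at
    v. *)
Lemma lead_curve N p (v : 'rV[K]_M) (r : 'I_M -> {poly K}) : has_order N p ->
  (mmap polyC (fun i => 'X * ((v 0 i)%:P + 'X * r i)) p)`_N = evalr (pihomog mdeg N p) v.
Proof.
move=> op; rewrite /evalr pihomogE (raddf_sum (meval _)) /mmap coef_sum [RHS]big_mkcond /=.
rewrite [LHS]big_seq [RHS]big_seq; apply: eq_bigr => m ms.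
have -> : mmap1 (fun i => 'X * ((v 0 i)%:P + 'X * r i)) m =
    'X^(mdeg m) * \prod_i ((v 0 i)%:P + 'X * r i) ^+ m i.
  rewrite /mmap1 mdegE -prodrXr -big_split; apply: eq_bigr => i _ /=.
  by rewrite exprMn.
rewrite mulrCA coefXnM; case: ltngtP => [h|h|->].
- by [].
- by move: ms; rewrite mcoeff_msupp op ?eqxx.
- rewrite subnn -horner_coef0 hornerM hornerC mevalZ mevalX horner_prod; congr (_ * _).
  by apply: eq_bigr => i _; rewrite horner_exp hornerD hornerM hornerX hornerC mul0r addr0.
Qed.

End Translation.

(** * Functions vanishing on the orbit, near det *)

Section LocalVanishing.
Variables (C : numClosedFieldType) (n : nat).
Hypothesis n3 : (3 <= n)%N.
Notation N := (n * n)%N.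
Notation S := (homform C N n).
Notation M := (\dim {:S}).
Implicit Types (P Q : S).

Definition row_coords P : 'rV[C]_M := \row_i coords P i.
Definition of_coords (r : 'rV[C]_M) : S := \sum_i r 0 i *: (vbasis {:S})`_i.

Lemma of_coordsK r i : coords (of_coords r) i = r 0 i.
Proof. by rewrite /coords /of_coords coord_sum_free // (basis_free (vbasisP _)). Qed.

Lemma row_coordsP a P Q : row_coords (a *: P + Q) = a *: row_coords P + row_coords Q.
Proof. by apply/rowP => i; rewrite !mxE /coords linearP. Qed.

Lemma generic_unit (X : 'M[C]_N) : exists2 c : {poly C}, c != 0 &
  forall s, c.[s] != 0 -> 1%:M + s *: X \in unitmx.
Proof.
pose c := \det (1%:M + 'X *: map_mx polyC X).
have cE s : c.[s] = \det (1%:M + s *: X).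
  rewrite -[c.[s]]/(horner_eval s c) -det_map_mx; congr (\det _); apply/matrixP => i j.
  by rewrite !mxE /= /horner_eval hornerD hornerMn hornerM hornerX hornerC hornerE.
exists c; last by move=> s; rewrite cE unitmxE unitfE.
apply: contraTneq (oner_neq0 C) => c0; have := cE 0.
by rewrite c0 horner0 scale0r addr0 det1 => <-; rewrite eqxx.
Qed.

(** The ideals of functions vanishing on Y and on the orbit are translated so that det becomes the
    origin and are compared by [local_inclusion]. The factor y is the 1 - x of [krull_intersection],
    translated back. *)
Lemma local_vanishing (Y : S -> Prop) (h : {mpoly C[M]}) :
  (forall g, g \in unitmx -> Y (precomp g (det_form C n))) ->
  (forall (f : (2 * n + 1).-tuple 'M[C]_n) (u v : 'M[C]_n), free f -> free [:: u; v] ->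
     forall P, Y P -> E_fun f u v P = 0) ->
  (forall g, g \in unitmx -> h.@[coords (precomp g (det_form C n))] = 0) ->
  exists2 y : {mpoly C[M]}, y.@[coords (det_form C n)] = 1 &
    forall P, Y P -> h.@[coords P] * y.@[coords P] = 0.
Proof.
move=> orbitY YE orbit_h; pose d := det_form C n; pose x0 := coords d.
pose I (p : {mpoly C[M]}) := forall P, Y P -> p.@[fun i => coords P i - x0 i] = 0.
pose J (p : {mpoly C[M]}) := forall g, g \in unitmx ->
  p.@[fun i => coords (precomp g d) i - x0 i] = 0.
have idI : is_ideal I.
  split=> [P _|a x y Ix Iy P YP]; first by rewrite meval0.
  by rewrite mevalD mevalM Ix // Iy // mulr0 addr0.
have idJ : is_ideal J.
  split=> [g _|a x y Ix Iy g gu]; first by rewrite meval0.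
  by rewrite mevalD mevalM Ix // Iy // mulr0 addr0.
have IJ p : I p -> J p by move=> Ip g gu; apply: Ip; exact: orbitY.
have shiftE p P : (translate x0 p).@[fun i => coords P i - x0 i] = p.@[coords P].
  by rewrite translate_eval; apply: meval_eq => i; rewrite subrK.
have [L LE] : exists L : 'M[C]_M,
    forall r, (exists X, r = row_coords (dform n3 X d)) <-> (r <= L)%MS.
  apply: subspace_matrix.
    by exists 0; rewrite dform0; apply/rowP => i; rewrite !mxE /coords linear0.
  move=> a x y [X ->] [X' ->]; exists (a *: X + X').
  by rewrite dform_lin row_coordsP.
(* Duality: a vector [w] orthogonal to the linear parts of all elements of [I] is killed by the
   differentials of the equations. By [tangent_dform] it is then tangent to the orbit, so lies in
   [L], and [c] kills it. *)
have covec (c : 'rV[C]_M) : (forall v : 'rV[C]_M, (v <= L)%MS -> \sum_i c 0 i * v 0 i = 0) ->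
    exists2 p, I p & p@_0%MM = 0 /\ forall i, p@_U_(i) = c 0 i :> C.
  move=> cL; pose U (r : 'rV[C]_M) := exists2 p, I p & p@_0%MM = 0 /\ forall i, p@_U_(i) = r 0 i.
  have [A AE] : exists A : 'M[C]_M, forall r, U r <-> (r <= A)%MS.
    apply: subspace_matrix.
      by exists 0; [case: idI | split=> [|i]; rewrite ?mxE mcoeff0].
    move=> a x y [p Ip [p0 pU]] [q Iq [q0 qU]]; exists (a%:MP * p + q); first by apply idI.2.
    split=> [|i]; rewrite mcoeffD mcoeffCM ?p0 ?q0 ?mulr0 ?addr0 //.
    by rewrite pU qU !mxE.
  suff : U c by []. apply/AE; rewrite submxE; apply/eqP/rowP => j; rewrite mxE [RHS]mxE.
  pose w : 'rV[C]_M := \row_i cokermx A i j.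
  have orthA r : U r -> \sum_i r 0 i * w 0 i = 0.
    move/AE; rewrite submxE => /eqP/matrixP/(_ 0 j); rewrite mxE [RHS]mxE => {2}<-.
    by apply: eq_bigr => i _; rewrite mxE.
  have tQ : tangent (of_coords w).
    move=> f u v ff fuv; have [p _ pE] := E_fun_homog f u v n3.
    apply/(has_deriv_grad _ _ _ pE).
    rewrite /grad -linear_part_translate -[RHS](orthA (\row_i (translate x0 p)@_U_(i))).
      by apply: eq_bigr => i _; rewrite of_coordsK [in RHS]mxE.
    exists (translate x0 p); first by move=> P YP; rewrite shiftE -pE YE.
    split=> [|i]; last by rewrite mxE.
    rewrite -meval_at0 translate_eval -[RHS](@YE f u v ff fuv d); last first.
      by rewrite /d -(precomp1 (det_form C n)); apply: orbitY; exact: unitmx1.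
    by rewrite pE; apply: meval_eq => i; rewrite add0r.
  have [X XE] := tangent_dform n3 tQ.
  rewrite -[RHS](cL w); last first.
    by apply/LE; exists X; rewrite -XE; apply/rowP => i; rewrite [RHS]mxE of_coordsK.
  by apply: eq_bigr => i _; rewrite [w 0 i]mxE.
(* The curve (1 + sX) det lies in the orbit for generic s and has the given vector as velocity at
   det, so [p] vanishes along it; [lead_curve] identifies one of its coefficients with the leading
   form. *)
have lead k p : J p -> has_order k p -> forall v, (v <= L)%MS -> evalr (pihomog mdeg k p) v = 0.
  move=> Jp op v /LE[X ->]; have [w [wE w0 w1]] := precomp_jet n3 X d.
  pose r i : {poly C} := \poly_(j < n.-1) coords (w (inord j.+2)) i.
  rewrite -(lead_curve _ r op) (_ : mmap _ _ _ = 0) ?coef0 //.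
  have [c c0 cu] := generic_unit X.
  apply: (poly_generic_eq0 c0) => s _ /cu su; rewrite horner_mmap -[RHS](Jp _ su).
  apply: meval_eq => i; rewrite wE /coords linear_sum -/(coords _ _) !big_ord_recl.
  have Z (a : C) P : coord (vbasis {:S}) i (a *: P) = a * coords P i by rewrite /coords linearZ.
  rewrite /= !Z w0 w1 expr0 mul1r -/(x0 i) addrAC subrr add0r.
  rewrite hornerM hornerX hornerD hornerC hornerM hornerX horner_poly mxE expr1 mulrDr.
  congr (_ + _); rewrite !big_distrr /=; apply: eq_bigr => j _.
  rewrite Z (_ : bump 0 (bump 0 j) = j.+2) // !exprS -!mulrA [coords _ _ * _]mulrC.
  congr (_ * (_ * (_ * coords (w _) i))).
  by apply: val_inj; rewrite /= inordK //; move: (ltn_ord j); lia.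
have [x x0E Ix] : exists2 x, x.@[fun=> 0] = 0 & I (translate x0 h * (1 - x)).
  apply: krull_intersection => // k.
  apply: (local_inclusion idI idJ IJ covec lead) => g gu.
  by rewrite shiftE orbit_h.
exists (translate (fun i => - x0 i) (1 - x)).
  rewrite translate_eval mevalB meval1 -[RHS]subr0 -x0E; congr (_ - _).
  by apply: meval_eq => i; rewrite subrr.
move=> P YP; have := Ix P YP; rewrite mevalM shiftE translate_eval; exact.
Qed.

End LocalVanishing.

Section ProjectivePoints.
Variables (K : fieldType) (V : vectType K).

Fact pline_dim (v : V) : v != 0 -> \dim <[v]> == 1%N.
Proof. by move=> v0; rewrite dim_vline v0. Qed.

Definition pline v (v0 : v != 0) : projsp V := Projsp (pline_dim v0).

Lemma projspP (L : projsp V) : exists2 v, v != 0 & proj_line L = <[v]>%VS.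
Proof.
exists (vpick (proj_line L)).
  by rewrite vpick0 -dimv_eq0 (eqP (proj_line_dim L)).
apply/esym/eqP; rewrite eqEdim (eqP (proj_line_dim L)) dim_vline vpick0 -dimv_eq0.
by rewrite (eqP (proj_line_dim L)) -memvE memv_pick.
Qed.

End ProjectivePoints.

Lemma coef_mmap_homog (K : fieldType) m (p : {mpoly K[m]}) (c : 'I_m -> K) k :
  (mmap polyC (fun i => c i *: 'X) p)`_k = (pihomog mdeg k p).@[c].
Proof.
rewrite pihomogE (raddf_sum (meval _)) /mmap coef_sum [RHS]big_mkcond /=.
apply: eq_bigr => u _; rewrite coefCM.
have -> : mmap1 (fun i => c i *: 'X) u = (\prod_i c i ^+ u i) *: 'X^(mdeg u).
  rewrite /mmap1 mdegE -prodrXr -scaler_prod; apply: eq_bigr => i _.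
  by rewrite exprZn.
rewrite coefZ coefXn [k == _]eq_sym; case: eqP => _; last by rewrite !mulr0.
by rewrite mulr1 mevalZ mevalX.
Qed.

Section OrbitClosure.
Variables (C : numClosedFieldType) (n : nat).
Hypothesis n3 : (3 <= n)%N.
Notation N := (n * n)%N.
Notation S := (homform C N n).
Notation M := (\dim {:S}).
Notation d := (det_form C n).
Notation detbar := (zariski_closure (@det_orbit C n)).
Notation V := (@V_n C n).
Implicit Types (P Q : S) (L : projsp S).

Lemma homog_zero_line (S0 : set (S -> C)) L v :
  S0 `<=` \bigcup_(e in setT) @homog_fun C S e -> proj_line L = <[v]>%VS ->
  (forall F, S0 F -> F v = 0) -> zero_locus S0 L.
Proof.
move=> hS Lv Fv F SF w; rewrite Lv => /vlineP[a ->].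
by have [e _ hF] := hS F SF; rewrite (homog_funZ _ _ hF) Fv // mulr0.
Qed.

Lemma det_form_neq0 : d != 0.
Proof.
apply/eqP => d0; have := eval_det (1%:M : 'M[C]_n).
rewrite det1 -[det_poly C n]/(mpoly_of_dhomog d) d0 meval0 => /eqP.
by rewrite eq_sym oner_eq0.
Qed.

Lemma orbit_neq0 g : g \in unitmx -> precomp g d != 0.
Proof.
move=> gu; apply: contra_neq det_form_neq0 => E.
by rewrite -[LHS]precomp1 -(mulmxV gu) -precomp_comp E linear0.
Qed.

Lemma orbit_point g (gu : g \in unitmx) : det_orbit (pline (orbit_neq0 gu)).
Proof. by exists (invmx g); rewrite ?unitmx_inv // /act_form invmxK. Qed.

Lemma orbit_closure (X : set (projsp S)) : X `<=` zariski_closure X.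
Proof. by move=> L XL Z [_]; exact. Qed.

Lemma closure_sub (X Z : set (projsp S)) :
  zariski_closed Z -> X `<=` Z -> zariski_closure X `<=` Z.
Proof. by move=> cZ XZ L; apply. Qed.

Lemma V_vanish F g : V F -> g \in unitmx -> F (precomp g d) = 0.
Proof.
move=> [m [c [B [BE ->]]]] gu; rewrite big1 // => i _.
by have [f [u [v [_ fuv ->]]]] := BE i; rewrite E_orbit // mulr0.
Qed.

Lemma V_homog : V `<=` \bigcup_(e in setT) @homog_fun C S e.
Proof. by move=> F /(V_n_homog n3) hF; exists (2 * n * (n - 1))%N. Qed.

Lemma detbar_zero_locus : detbar `<=` zero_locus V.
Proof.
apply: closure_sub; first by exists V => //; exact: V_homog.
move=> L [g gu Lg]; apply: (homog_zero_line V_homog Lg) => F VF.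
by apply: V_vanish => //; rewrite unitmx_inv.
Qed.

Lemma V_vanishing_ideal : V `<=` vanishing_ideal detbar.
Proof.
move=> F VF; split.
  by have [p _ pE] := V_n_homog n3 VF; exists p.
by move=> v [L DL vL]; exact: (detbar_zero_locus DL VF vL).
Qed.

Lemma closed_avoid (A : set (projsp S)) : zariski_closed A -> ~ detbar `<=` A ->
  exists g F, [/\ g \in unitmx, F (precomp g d) != 0, exists e, @homog_fun C S e F &
    forall L v, A L -> v \in proj_line L -> F v = 0].
Proof.
move=> [S0 hS AE] nA.
have [L [OL nAL]] : exists L, det_orbit L /\ ~ A L.
  apply: contrapT => h; apply: nA; apply: closure_sub; first by exists S0.
  by move=> L OL; apply: contrapT => nL; apply: h; exists L.
have [g gu Lg] := OL.
have [F [SF F0]] : exists F, S0 F /\ F (act_form g d) != 0.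
  apply: contrapT => h; apply: nAL; rewrite AE; apply: (homog_zero_line hS Lg) => F SF.
  by apply/eqP/negPn/negP => F0; apply: h; exists F.
exists (invmx g), F; split; rewrite ?unitmx_inv //.
  by have [e _ hF] := hS F SF; exists e.
by move=> L' v; rewrite AE => AL'; exact: AL'.
Qed.

(** If neither closed set contains the closure, homogeneous F and G vanishing on them are nonzero at
    orbit points given by g1 and g2. On the line joining g1 to g2, F, G and the determinant of the
    matrix are nonzero polynomials in s, so some invertible matrix avoids both sets. *)
Lemma detbar_irreducible : irreducible_set detbar.
Proof.
split.
  by exists (pline (orbit_neq0 (unitmx1 C N))); apply: orbit_closure; exact: orbit_point.
move=> A B cA cB AB; apply: contrapT => /not_orP[nA nB].
have [g1 [F [gu1 F1 [e hF] FA]]] := closed_avoid cA nA.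
have [g2 [G [gu2 G2 [e' hG] GB]]] := closed_avoid cB nB.
have [pF _ pFE] := homog_fun_precomp_curve g1 (g2 - g1) d hF.
have [pG _ pGE] := homog_fun_precomp_curve g1 (g2 - g1) d hG.
pose c : {poly C} := \det (map_mx polyC g1 + 'X *: map_mx polyC (g2 - g1)).
have cE s : c.[s] = \det (g1 + s *: (g2 - g1)).
  rewrite -[c.[s]]/(horner_eval s c) -det_map_mx; congr (\det _); apply/matrixP => i j.
  by rewrite !mxE /= /horner_eval hornerD hornerM hornerX !hornerC.
have pF0 : pF != 0.
  by apply: contraNneq F1 => p0; have := pFE 0; rewrite p0 horner0 scale0r addr0 => ->.
have pG0 : pG != 0.
  apply: contraNneq G2 => p0; have := pGE 1; rewrite p0 horner0 scale1r.
  by rewrite addrC subrK => ->.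
have c0 : c != 0.
  apply: contraTneq gu1 => c0; rewrite unitmxE unitfE negbK.
  by have := cE 0; rewrite c0 horner0 scale0r addr0 => <-.
have [s _] := natr_nonroot (mulf_neq0 (mulf_neq0 pF0 pG0) c0).
rewrite !hornerM !mulf_eq0 !negb_or => /andP[/andP[pFs pGs]]; rewrite cE => cs.
have gu : g1 + s *: (g2 - g1) \in unitmx by rewrite unitmxE unitfE.
have vL : precomp (g1 + s *: (g2 - g1)) d \in proj_line (pline (orbit_neq0 gu)).
  exact: memv_line.
case: (AB _ (orbit_closure (orbit_point gu))) => [AL|BL].
  by move: pFs; rewrite -pFE (FA _ _ AL vL) eqxx.
by move: pGs; rewrite -pGE (GB _ _ BL vL) eqxx.
Qed.

(** On the affine cone of Y an equation F of the closure satisfies F y = 0 with y(det) = 1. A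
    homogeneous component G of y replaces y, so that Y lies in the union of the zero loci of F and
    G, and G is nonzero at det. *)
Lemma irreducible_sub_detbar (Y : set (projsp S)) :
  irreducible_set Y -> detbar `<=` Y -> Y `<=` zero_locus V -> Y `<=` detbar.
Proof.
move=> [_ irrY] DY YV L YL Z [[S0 hS ->] OZ] F SF w wL.
have [e _ [p ph pE]] := hS F SF; have hF : @homog_fun C S e F by exists p.
have orbitY g : g \in unitmx -> affine_cone Y (precomp g d).
  move=> gu; exists (pline (orbit_neq0 gu)); last exact: memv_line.
  by apply: DY; apply: orbit_closure; exact: orbit_point.
have [y y1 yY] : exists2 y : {mpoly C[M]}, y.@[coords d] = 1 &
    forall P, affine_cone Y P -> p.@[coords P] * y.@[coords P] = 0.
  apply: (local_vanishing n3) => // [f u v ff fuv P [L' YL' PL']|g gu].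
    apply: (YV _ YL' (E_fun f u v)) => //.
    exists 1%N, (fun=> 1), (fun=> E_fun f u v); split; first by move=> _; exists f, u, v.
    by apply/funext => Q; rewrite big_ord1 mul1r.
  rewrite -pE; apply: (OZ _ (orbit_point gu) F SF); exact: memv_line.
pose q P : {poly C} := mmap polyC (fun i => coords P i *: 'X) y.
have qE P a : (q P).[a] = y.@[coords (a *: P)].
  rewrite horner_mmap; apply: meval_eq => i.
  by rewrite hornerZ hornerX /coords linearZ /= mulrC.
(* [y] is in general not homogeneous; k is its degree along the line of det, so its component of
   degree k is nonzero there. *)
pose k := (size (q d)).-1; pose G P := (pihomog mdeg k y).@[coords P].
have Gd : G d != 0.
  rewrite /G -coef_mmap_homog -/(q d) -/k -lead_coefE lead_coef_eq0.
  by apply: contraTneq (oner_neq0 C) => q0; rewrite -y1 -[d]scale1r -qE q0 horner0 eqxx.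
have hG : @homog_fun C S k G by exists (pihomog mdeg k y); first exact: pihomogP.
pose A := zero_locus [set F]; pose B := zero_locus [set G].
have cA : zariski_closed A by exists [set F] => // _ ->; exists e.
have cB : zariski_closed B by exists [set G] => // _ ->; exists k.
have YAB : Y `<=` A `|` B.
  move=> L' YL'; have [v v0 Lv] := projspP L'.
  have cone a : affine_cone Y (a *: v) by exists L' => //; rewrite Lv memvZ // memv_line.
  have [Fv|Fv] := eqVneq (F v) 0.
    by left; apply: (homog_zero_line _ Lv) => [_ ->|_ ->//]; exists e.
  right; apply: (homog_zero_line _ Lv) => [_ ->|_ ->]; first by exists k.
  rewrite /G -coef_mmap_homog -/(q v) (_ : q v = 0) ?coef0 //.
  (* The cone contains every multiple of [v]. As F(av) = a^e F(v) is nonzero for a != 0, [y]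
     vanishes on the whole line, and so do all its homogeneous components. *)
  apply: poly_fun_eq => a a0; rewrite horner0 qE.
  have /eqP := yY _ (cone a); rewrite -pE (homog_funZ _ _ hF) !mulf_eq0.
  by rewrite expf_eq0 (negPf a0) andbF (negPf Fv) => /eqP.
case: (irrY A B cA cB YAB) => [YA|YB]; first exact: (YA _ YL F).
have [L' YL' dL'] := orbitY _ (unitmx1 C N).
by case/eqP: Gd; apply: (YB _ YL' G) => //; rewrite precomp1 in dL'.
Qed.

Lemma detbar_component : irreducible_component detbar (zero_locus V).
Proof.
split; [exact: detbar_irreducible | exact: detbar_zero_locus |].
move=> Y irrY DY YV; apply/seteqP; split => //.
exact: irreducible_sub_detbar.
Qed.

End OrbitClosure.

Theorem theorem1p0p2 (R : realType) (n : nat) (hn : (3 <= n)%N) :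
  let C : fieldType := R[i] in
  let S : vectType C := homform C (n * n) n in
  let detbar : set (projsp S) := zariski_closure (@det_orbit C n) in
  let V : set (S -> C) := @V_n C n in
  let omega := @fund_weight (n * n) in
  [/\ gl_submodule V,
      V `<=` vanishing_ideal detbar,
      exists2 M : set (S -> C), M `<=` V &
        irreducible_of_highest_weight
          (omega 1%N *+ (2 * n * (n - 1) * (n - 2))
           + omega 2%N *+ (2 * n ^ 2 - 4 * n - 1)
           + omega (2 * n + 1)%N *+ 2) M,
      V `<=` @homog_fun C S (2 * n * (n - 1)) &
      irreducible_component detbar (zero_locus V)].
Proof.
pose C : numClosedFieldType := R[i].
split.
- exact: (@V_n_submodule C n).
- exact: (@V_vanishing_ideal C n hn).
- exists (gl_span (@hw_fun C n hn)).
    apply: gl_span_sub; [exact: (@V_n_submodule C n) | exact: (@hw_fun_in_V C n hn)].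
  split; last first.
    exists (@hw_fun C n hn); first exact: gl_span_gen.
    exact: (@hw_fun_highest_weight C n hn).
  apply: (@gl_span_irreducible C _ _ (2 * n * (n - 1))).
    exact: (V_n_homog hn (@hw_fun_in_V C n hn)).
  exact: (@hw_fun_highest_weight C n hn).
- exact: (@V_n_homog C n hn).
- exact: (@detbar_component C n hn).
Qed.
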